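(* Let $\Omega_1,\Omega_2\subset\mathbb{R}^2$ be two open disks with non-empty intersection, neither contained in the other, and let $\gamma_2:L^2(\partial\Omega_1)\to L^2(\partial\Omega_2)$ and the angles $\theta,\sigma\in(0,\pi)$ be as in the context. Then $$1\le\|\gamma_2\|^2\le1+\left(\frac{\sin\theta}{\tan(\sigma+\theta)}\right)_+\frac{\pi-\sigma-\theta}{\pi},$$ where $a_+=\max\{0,a\}$ and the quotient is read as $0$ if $\sigma+\theta=\pi/2$. Moreover, there exist $\theta,\sigma\in(0,\pi)$ (i.e. a configuration of two such disks with these angles) such that $\|\gamma_2\|>1$.
   Context: Geometry: $\Omega_i=B_{r_i}(\mathbf{x}_i)\subset\mathbb{R}^2$, $i=1,2$; $\Omega=\Omega_1\cup\Omega_2$; $\Gamma_i^{\rm ext}=\partial\Omega_i\cap\partial\Omega$, $\Gamma_i^{\rm int}=\partial\Omega_i\setminus\Gamma_i^{\rm ext}$. $\theta\in(0,\pi)$ is the angle, at one of the two points $p$ of $\partial\Omega_1\cap\partial\Omega_2$, between the segments from $p$ to $\mathbf{x}_1$ and from $p$ to $\mathbf{x}_2$. $\sigma\in(0,\pi)$ is half the aperture angle of the arc $\Gamma_1^{\rm int}$ seen from $\mathbf{x}_1$; then $\sigma+\theta=\pi-\beta_2\in(0,\pi)$, where $\beta_2$ is half the aperture angle of $\Gamma_2^{\rm int}$ seen from $\mathbf{x}_2$. $L^2(\partial\Omega_i)$ is the complex $L^2$ space for the one-dimensional Hausdorff measure $\mathscr{H}^1$. $\gamma_2:L^2(\partial\Omega_1)\to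 L^2(\partial\Omega_2)$ sends $g$ to the function equal to $\mathrm{P}_1[g]|_{\Gamma_2^{\rm int}}$ on $\Gamma_2^{\rm int}$ and $0$ on $\Gamma_2^{\rm ext}$, where $\mathrm{P}_1[g](\mathbf{x})=\frac1{2\pi}\int_{\partial\Omega_1}\frac{r_1^2-|\mathbf{x}-\mathbf{x}_1|^2}{r_1|\mathbf{x}-\mathbf{y}|^2}g(\mathbf{y})\,d\mathscr{H}^1(\mathbf{y})$ for $\mathbf{x}\in\Omega_1$ is the Poisson integral. $\|\gamma_2\|$ is its operator norm. *)

(* Defs.v *)
From HB Require Import structures.
From mathcomp Require Import all_boot all_order all_algebra.
From mathcomp Require Import all_classical all_reals all_analysis.
From mathcomp Require Import complex.
From mathcomp Require Import ring lra.

Set Implicit Arguments.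
Unset Strict Implicit.
Unset Printing Implicit Defensive.

Import Order.TTheory GRing.Theory Num.Theory.
Import numFieldNormedType.Exports.

Local Open Scope classical_set_scope.
Local Open Scope ring_scope.

Section HausdorffOuterMeasure.
Context {R : realType}.
Local Notation plane := (R * R)%type.
Implicit Types (A B X : set plane).

(* The norm that the library puts on [R * R] is the max norm; it induces the
   right topology and Borel sets, but not the right metric. *)
Definition edist (x y : plane) : R :=
  Num.sqrt ((x.1 - y.1) ^+ 2 + (x.2 - y.2) ^+ 2).

(* The [0] only matters for the empty set. *)
Definition ediam A : \bar R :=
  maxe 0%E (ereal_sup [set (edist a b)%:E | a in A & b in A]).

Local Open Scope ereal_scope.

Definition hausdorff1_delta (delta : R) A : \bar R :=
  ereal_inf [set \sum_(k <oo) ediam (U k) | U in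
    [set U : (set plane)^nat |
      A `<=` \bigcup_k U k /\ forall k, ediam (U k) <= delta%:E]].

Definition hausdorff1 A : \bar R :=
  ereal_sup [set hausdorff1_delta delta A | delta in [set delta | (0 < delta)%R]].

Lemma edistC x y : edist x y = edist y x.
Proof. by rewrite /edist -(sqrrN (x.1 - _)) -(sqrrN (x.2 - _)) !opprB. Qed.

Lemma ediam_ge0 A : 0 <= ediam A.
Proof. by rewrite /ediam le_max lexx. Qed.

Lemma ediam0 : ediam set0 = 0.
Proof.
rewrite /ediam (_ : image2 _ _ _ = set0) ?ereal_sup0; first by rewrite maxeNy.
by rewrite -subset0 => z [].
Qed.

Lemma le_ediam A B : A `<=` B -> ediam A <= ediam B.
Proof.
move=> AB; rewrite /ediam ge_max le_max lexx/= le_max; apply/orP; right.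
by apply: ereal_sup_le => _ [a Aa [b Ab <-]]; exists a; [exact: AB|exists b => //; exact: AB].
Qed.

Lemma hausdorff1_delta_ge0 delta A : 0 <= hausdorff1_delta delta A.
Proof.
apply: le_ereal_inf_tmp => _ [U _ <-].
by apply: nneseries_ge0 => k _ _; exact: ediam_ge0.
Qed.

Lemma le_hausdorff1_delta delta A B :
  A `<=` B -> hausdorff1_delta delta A <= hausdorff1_delta delta B.
Proof.
move=> AB; apply/ereal_inf_le_tmp => _ [U [BU Ud] <-].
by exists U => //; split => //; exact: subset_trans BU.
Qed.

Lemma hausdorff1_delta_mesh d1 d2 A : (d1 <= d2)%R ->
  hausdorff1_delta d2 A <= hausdorff1_delta d1 A.
Proof.
move=> d12; apply/ereal_inf_le_tmp => _ [U [AU Ud] <-].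
by exists U => //; split => // k; rewrite (le_trans (Ud k))// lee_fin.
Qed.

Lemma hausdorff1_delta0 delta : (0 < delta)%R -> hausdorff1_delta delta set0 = 0.
Proof.
move=> d0; apply/eqP; rewrite eq_le hausdorff1_delta_ge0 andbT.
apply: ereal_inf_lbound; exists (fun=> set0).
  by split => // k; rewrite ediam0 lee_fin ltW.
by apply: eseries0 => k _ _; rewrite ediam0.
Qed.

Lemma hausdorff1_delta_sigma_subadditive delta :
  sigma_subadditive (hausdorff1_delta delta).
Proof.
move=> A; have [[i ioo]|] := pselect (exists i, hausdorff1_delta delta (A i) = +oo).
  rewrite (eseries_pinfty _ _ ioo) ?leey// => n _.
  by rewrite -ltNye (lt_le_trans _ (hausdorff1_delta_ge0 _ _)).
rewrite -forallNE => Aoo.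
suff add2e (e : {posnum R}) : hausdorff1_delta delta (\bigcup_n A n) <=
    \sum_(i <oo) hausdorff1_delta delta (A i) + e%:num%:E.
  by apply/lee_addgt0Pr => _/posnumP[].
rewrite (le_trans _ (epsilon_trick _ _ _))//; last first.
  by move=> n; exact: hausdorff1_delta_ge0.
pose P n (B : (set plane)^nat) :=
  (A n `<=` \bigcup_k B k /\ forall k, ediam (B k) <= delta%:E) /\
  \sum_(k <oo) ediam (B k) <=
    hausdorff1_delta delta (A n) + (e%:num / (2 ^ n.+1)%:R)%:E.
have [G PG] : {G : ((set plane)^nat)^nat & forall n, P n (G n)}.
  apply: (@choice _ _ P) => n; rewrite /P /hausdorff1_delta.
  set S := (X in ereal_inf X); move infS : (ereal_inf S) => iS.
  case: iS infS => [r Sr|Soo|Soo].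
  - have en1 : (0 < e%:num / (2 ^ n.+1)%:R)%R by [].
    have /(lb_ereal_inf_adherent en1) : ereal_inf S \is a fin_num by rewrite Sr.
    move=> [x [B AnB muBx] xS].
    by exists B; split => //; rewrite muBx -Sr; exact/ltW.
  - by have := Aoo n; rewrite /hausdorff1_delta Soo.
  - by have := hausdorff1_delta_ge0 delta (A n); rewrite /hausdorff1_delta Soo.
have muG_ge0 x : 0 <= (ediam \o uncurry G) x by exact: ediam_ge0.
apply: (@le_trans _ _ (\esum_(i in setT) (ediam \o uncurry G) i)).
  apply: ereal_inf_lbound => /=.
  have /card_esym/ppcard_eqP[f] := card_nat2.
  exists (uncurry G \o f).
    split; last first.
      by move=> k /=; case: (f k) => a b; exact: ((PG a).1.2 b).
    apply: (@subset_trans _  (\bigcup_n \bigcup_k G n k)) => [t [i _]|].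
      by move=> /((PG i).1.1) -[j _ ?]; exists i => //; exists j.
    move=> t [i _ [j _ Bijt]]; exists (f^-1%FUN (i, j)) => //=.
    by rewrite invK ?inE.
  rewrite -(esum_pred_image (ediam \o uncurry G) _ xpredT) ?[fun=> _]set_true//.
  by rewrite image_eq.
rewrite (_ : esum _ _ = \sum_(i <oo) \sum_(j <oo ) ediam (G i j)); last first.
  pose J : nat -> set (nat * nat) := fun i => [set (i, j) | j in setT].
  rewrite (_ : setT = \bigcup_k J k); last first.
    by rewrite predeqE => -[a b]; split => // _; exists a => //; exists b.
  rewrite esum_bigcupT /=; last 2 first.
    - apply/trivIsetP => i j _ _ ij.
      rewrite predeqE => -[n m] /=; split => //= -[] [_] _ [<-{n} _].
      by move=> [m' _] [] /esym/eqP; rewrite (negbTE ij).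
    - by move=> /= [n m]; exact: ediam_ge0.
  rewrite -(image_id [set: nat]) -fun_true esum_pred_image//; last first.
    by move=> n _; apply: esum_ge0 => p _; exact: muG_ge0.
  apply: eq_eseriesr => /= j _.
  rewrite -(esum_pred_image (ediam \o uncurry G) (pair j) predT)//=; last first.
    by move=> ? ? _ _; exact: (@can_inj _ _ _ snd).
    by move=> n _; exact: ediam_ge0.
  by congr esum; rewrite predeqE => -[a b]; split; move=> [i _ <-]; exists i.
apply: lee_nneseries => n _.
  by move=> _; apply: nneseries_ge0 => m *; exact: ediam_ge0.
by have [_] := PG n.
Qed.

Lemma hausdorff1_ge_delta delta A : (0 < delta)%R ->
  hausdorff1_delta delta A <= hausdorff1 A.
Proof. by move=> d0; apply: ereal_sup_ubound; exists delta. Qed.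

Lemma hausdorff1_ge0 A : 0 <= hausdorff1 A.
Proof.
by apply: (le_trans (hausdorff1_delta_ge0 1 A)); exact: hausdorff1_ge_delta.
Qed.

Lemma hausdorff1_0 : hausdorff1 set0 = 0.
Proof.
apply/eqP; rewrite eq_le hausdorff1_ge0 andbT.
by apply: ge_ereal_sup => _ [delta d0 <-]; rewrite hausdorff1_delta0.
Qed.

Lemma le_hausdorff1 : {homo hausdorff1 : A B / A `<=` B >-> A <= B}.
Proof.
move=> A B AB; apply: ge_ereal_sup => _ [delta d0 <-].
exact: (le_trans (le_hausdorff1_delta delta AB) (hausdorff1_ge_delta B d0)).
Qed.

Lemma hausdorff1_sigma_subadditive : sigma_subadditive hausdorff1.
Proof.
move=> F; apply: ge_ereal_sup => _ [delta d0 <-].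
apply: (le_trans (hausdorff1_delta_sigma_subadditive delta F)).
apply: lee_nneseries => n _; first by move=> _; exact: hausdorff1_delta_ge0.
exact: hausdorff1_ge_delta.
Qed.

HB.instance Definition _ := isOuterMeasure.Build R plane hausdorff1
  hausdorff1_0 hausdorff1_ge0 le_hausdorff1 hausdorff1_sigma_subadditive.


Lemma edist_le_ediam A x y : A x -> A y -> (edist x y)%:E <= ediam A.
Proof.
move=> Ax Ay; rewrite /ediam le_max; apply/orP; right.
by apply: ereal_sup_ubound; exists x => //; exists y.
Qed.

Lemma hausdorff1_delta_setU_separated (c delta : R) A B : (delta < c)%R ->
  (forall a b, A a -> B b -> c <= edist a b)%R ->
  hausdorff1_delta delta A + hausdorff1_delta delta B <=
  hausdorff1_delta delta (A `|` B).
Proof.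
move=> dc sep; apply: le_ereal_inf_tmp => _ [U [ABU Ud] <-].
apply: (@le_trans _ _ (\sum_(k <oo) ediam (U k `&` A) +
                       \sum_(k <oo) ediam (U k `&` B))).
  apply: leeD; apply: ereal_inf_lbound.
  - exists (fun k => U k `&` A) => //; split => [t At|k].
      by have [|k _ Ukt] := ABU t; [left|exists k].
    by apply: le_trans (Ud k); apply: le_ediam; exact: subIsetl.
  - exists (fun k => U k `&` B) => //; split => [t Bt|k].
      by have [|k _ Ukt] := ABU t; [right|exists k].
    by apply: le_trans (Ud k); apply: le_ediam; exact: subIsetl.
rewrite -nneseriesD; [|by move=> *; exact: ediam_ge0..].
apply: lee_nneseries => k _.
  by move=> _; apply: adde_ge0; exact: ediam_ge0.
have [UA0|/set0P[a [Ua Aa]]] := eqVneq (U k `&` A) set0.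
  by rewrite UA0 ediam0 add0e; apply: le_ediam; exact: subIsetl.
have [UB0|/set0P[b [Ub Bb]]] := eqVneq (U k `&` B) set0.
  by rewrite UB0 ediam0 adde0; apply: le_ediam; exact: subIsetl.
have := le_trans (edist_le_ediam Ua Ub) (Ud k); rewrite lee_fin => abd.
by have := lt_le_trans dc (sep _ _ Aa Bb); rewrite ltNge abd.
Qed.

Lemma hausdorff1_setU_separated (c : R) A B : (0 < c)%R ->
  (forall a b, A a -> B b -> c <= edist a b)%R ->
  hausdorff1 A + hausdorff1 B <= hausdorff1 (A `|` B).
Proof.
move=> c0 sep; set M := hausdorff1 (A `|` B).
have M0 : 0 <= M := hausdorff1_ge0 _.
have AM : hausdorff1 A <= M by apply: le_hausdorff1; exact: subsetUl.
have BM : hausdorff1 B <= M by apply: le_hausdorff1; exact: subsetUr.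
have [->|Moo] := eqVneq M +oo; first by rewrite leey.
have Mfin : M \is a fin_num by rewrite ge0_fin_numE// lt_neqAle Moo leey.
have Bfin : hausdorff1 B \is a fin_num.
  by rewrite ge0_fin_numE ?hausdorff1_ge0// (le_lt_trans BM)// ltey_eq Mfin.
rewrite -leeBrDr//; apply: ge_ereal_sup => _ [d1 d10 <-].
have dAfin : hausdorff1_delta d1 A \is a fin_num.
  rewrite ge0_fin_numE ?hausdorff1_delta_ge0//.
  by rewrite (le_lt_trans (hausdorff1_ge_delta _ d10))// (le_lt_trans AM)// ltey_eq Mfin.
rewrite leeBrDr// addeC -leeBrDr//; apply: ge_ereal_sup => _ [d2 d20 <-].
rewrite leeBrDr//.
pose d := Num.min (Num.min d1 d2) (c / 2)%R.
have d0 : (0 < d)%R by rewrite /d !lt_min d10 d20 divr_gt0.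
have dc : (d < c)%R by rewrite /d gt_min; apply/orP; right; lra.
have dd1 : (d <= d1)%R by rewrite /d !ge_min lexx.
have dd2 : (d <= d2)%R by rewrite /d !ge_min lexx orbT.
rewrite addeC; apply: (@le_trans _ _ (hausdorff1_delta d A + hausdorff1_delta d B)).
  by apply: leeD; exact: hausdorff1_delta_mesh.
exact: (le_trans (hausdorff1_delta_setU_separated dc sep) (hausdorff1_ge_delta _ d0)).
Qed.

Lemma hausdorff1_sum_strips (f : plane -> R) X (lo hi : nat -> R) n :
  (forall x y, `|f x - f y| <= edist x y)%R ->
  (forall i j, (i < j)%N -> hi i < lo j)%R ->
  \sum_(k < n) hausdorff1 (X `&` [set x | (lo k < f x <= hi k)%R]) <=
  hausdorff1 (X `&` \big[setU/set0]_(k < n) [set x | (lo k < f x <= hi k)%R]).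
Proof.
move=> flip lohi; elim: n => [|n IHn].
  by rewrite !big_ord0 setI0 hausdorff1_0.
rewrite !big_ord_recr/= setIUr.
have gap m : (m <= n)%N ->
    exists2 c, (0 < c)%R & forall i, (i < m)%N -> (c <= lo n - hi i)%R.
  elim: m => [_|m IHm mn]; first by exists 1%R.
  have [c c0 hc] := IHm (ltnW mn).
  exists (Num.min c (lo n - hi m)%R).
    by rewrite lt_min c0 subr_gt0 lohi.
  move=> i; rewrite ltnS leq_eqVlt => /predU1P[->|im].
    by rewrite ge_min lexx orbT.
  by rewrite ge_min hc.
have [c c0 hc] := gap _ (leqnn n).
apply: (le_trans (leeD2r _ IHn)).
apply: (@hausdorff1_setU_separated c) => // a b [_ Aa] [_ /andP[lob _]].
rewrite edistC; apply: le_trans (flip _ _); apply: le_trans (ler_norm _).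
move: Aa; rewrite -(bigcup_mkord n (fun k => [set x | (lo k < f x <= hi k)%R])) => -[i /= im /andP[_ ahi]].
by have := hc _ im; lra.
Qed.


Lemma hausdorff1_caratheodory_ge (f : plane -> R) (a : R) :
  (forall x y, `|f x - f y| <= edist x y)%R ->
  hausdorff1.-caratheodory [set x | (a <= f x)%R].
Proof.
move=> flip; apply: le_caratheodory_measurable => X /=; set A := [set x | _].
have [->|Xoo] := eqVneq (hausdorff1 X) +oo; first by rewrite leey.
have Xfin : hausdorff1 X < +oo by rewrite lt_neqAle Xoo leey.
pose b k : R := (a - k.+1%:R^-1)%R.
have bE i j : (i < j)%N -> (b i < b j)%R.
  by move=> ij; rewrite ltrD2l ltrN2 ltf_pV2 ?posrE// ltr_nat.
pose D n := X `&` [set x | (f x <= b n)%R].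
pose S k := X `&` [set x | (b k < f x <= b k.+1)%R].
have AD n : hausdorff1 (X `&` A) + hausdorff1 (D n) <= hausdorff1 X.
  apply: (@le_trans _ _ (hausdorff1 ((X `&` A) `|` D n))).
    apply: (@hausdorff1_setU_separated n.+1%:R^-1) => //.
    move=> x y [_ /= Ax] [_ /= Dy]; apply: le_trans (flip _ _).
    by apply: le_trans (ler_norm _); move: Ax Dy; rewrite /b /A/=; move: (n.+1%:R^-1)%R => d; lra.
  by apply: le_hausdorff1 => x [|] [].
have S_fin : \sum_(k <oo) hausdorff1 (S k) < +oo.
  apply: (@le_lt_trans _ _ (hausdorff1 X + hausdorff1 X)); last first.
    by rewrite lte_add_pinfty.
  apply: lime_le; first by apply: is_cvg_nneseries => *; exact: hausdorff1_ge0.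
  apply: nearW => n; rewrite big_mkord.
  apply: (@le_trans _ _ (\sum_(k < n) hausdorff1 (S k.*2) +
                         \sum_(k < n) hausdorff1 (S k.*2.+1))).
    apply: (@le_trans _ _ (\sum_(k < n.*2) hausdorff1 (S k))).
      rewrite -!(big_mkord xpredT (fun k => hausdorff1 (S k))).
      apply: lee_sum_nneg_natr; last by rewrite -addnn leq_addr.
      by move=> *; exact: hausdorff1_ge0.
    elim: n => [|n IHn]; first by rewrite !big_ord0 adde0.
    rewrite doubleS !big_ord_recr/= addeACA.
    have := leeD2r (hausdorff1 (S n.*2) + hausdorff1 (S n.*2.+1)) IHn.
    by move=> H; rewrite -addrA; exact: H.
  apply: leeD.
    apply: le_trans (le_hausdorff1 (@subIsetl _ X _)).
    apply: (hausdorff1_sum_strips X (lo := fun k => b k.*2)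
      (hi := fun k => b k.*2.+1)) => // i j ij; apply: bE.
    by rewrite -doubleS leq_double.
  apply: le_trans (le_hausdorff1 (@subIsetl _ X _)).
  apply: (hausdorff1_sum_strips X (lo := fun k => b k.*2.+1)
    (hi := fun k => b k.*2.+2)) => // i j ij; apply: bE.
  by rewrite ltnS -doubleS leq_double.
have XA n : hausdorff1 (X `&` ~` A) <=
    hausdorff1 (D n) + \sum_(n <= k <oo) hausdorff1 (S k).
  apply: (@le_trans _ _
      (hausdorff1 (D n `|` \bigcup_(k in ~` `I_n) S k))); last first.
    apply: (le_trans (outer_measureU2 _ _ _)); apply: leeD2l.
    exact: outer_measure_sigma_subadditive_tail.
  apply: le_hausdorff1 => x [Xx /= /negP]; rewrite -ltNge => fxa.
  have [m fxm] : exists m, (f x <= b m)%R.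
    have [m] := ltr_add_invr fxa.
    by move=> hm; exists m; move: hm; rewrite /b; move: (m.+1%:R^-1)%R => d; lra.
  have ex : exists m, (f x <= b m)%R by exists m.
  case: (ex_minnP ex) => {fxm ex}m fxm mmin.
  have [fxn|nfx] := leP (f x) (b n); first by left.
  right; case: m fxm mmin => [|m] fxm mmin.
    have := lt_le_trans nfx fxm; case: n {AD nfx} => [|n]; first by rewrite ltxx.
    by move/lt_trans => /(_ _ (bE _ _ (ltn0Sn n))); rewrite ltxx.
  exists m.
    move=> /= mn; have := lt_le_trans nfx fxm.
    by move: mn; rewrite leq_eqVlt => /predU1P[->|/bE/lt_trans h /h]; rewrite ltxx.
  split => //=; rewrite fxm andbT ltNge; apply/negP => /mmin.
  by rewrite ltnn.
apply/lee_addgt0Pr => e e0.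
have tail0 := nneseries_tail_cvg S_fin (fun k _ => hausdorff1_ge0 (S k)).
have [n _ tn] : \forall n \near \oo, \sum_(n <= k <oo) hausdorff1 (S k) <= e%:E.
  apply: (tail0 [set y | y <= e%:E]).
  apply: (@filterS _ _ _ [set y | y < e%:E]); first by move=> y /= /ltW.
  by apply: open_ereal_lt'; rewrite lte_fin.
apply: (@le_trans _ _ (hausdorff1 (X `&` A) +
   (hausdorff1 (D n) + \sum_(n <= k <oo) hausdorff1 (S k)))).
  by apply: leeD2l; exact: XA.
by rewrite addeA; apply: (leeD (AD n)); exact: (tn n (leqnn n)).
Qed.


Lemma fst_le_edist (x y : plane) : (`|x.1 - y.1| <= edist x y)%R.
Proof. by rewrite -sqrtr_sqr ler_wsqrtr// lerDl sqr_ge0. Qed.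

Lemma snd_le_edist (x y : plane) : (`|x.2 - y.2| <= edist x y)%R.
Proof. by rewrite -sqrtr_sqr ler_wsqrtr// lerDr sqr_ge0. Qed.

Lemma hausdorff1_caratheodory_measurable_fun (f : plane -> R) :
  (forall x y, `|f x - f y| <= edist x y)%R ->
  measurable_fun setT (f : caratheodory_type hausdorff1 -> R).
Proof.
move=> flip; apply: (measurability (@measurable_realfun.RGenCInfty.G R)).
  exact: measurable_realfun.RGenCInfty.measurableE.
move=> _ [_ [a ->] <-]; rewrite setTI.
have := hausdorff1_caratheodory_ge a flip.
rewrite (_ : [set x | _] = f @^-1` `[a, +oo[%classic)//.
by apply/seteqP; split => x /=; rewrite in_itv/= andbT.
Qed.

Lemma borel_hausdorff1_caratheodory A :
  measurable A -> hausdorff1.-cara.-measurable A.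
Proof.
move=> mA.
have mid : measurable_fun setT (fun x : caratheodory_type hausdorff1 =>
    ((x : plane).1, (x : plane).2)).
  apply/measurable_fun_pair.
    exact: (hausdorff1_caratheodory_measurable_fun fst_le_edist).
  exact: (hausdorff1_caratheodory_measurable_fun snd_le_edist).
have := mid measurableT A mA; rewrite setTI.
by congr (measurable _); apply/seteqP; split => -[].
Qed.

Lemma hausdorff1_semi_sigma_additive :
  semi_sigma_additive (hausdorff1 : set plane -> \bar R).
Proof.
move=> F mF tF mUF; apply: caratheodory_measure_sigma_additive => //.
  by move=> i; exact: borel_hausdorff1_caratheodory.
exact: borel_hausdorff1_caratheodory.
Qed.

HB.instance Definition _ := isMeasure.Build _ plane R hausdorff1
  hausdorff1_0 hausdorff1_ge0 hausdorff1_semi_sigma_additive.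

End HausdorffOuterMeasure.

(* Square-integrable complex functions on a subset of the plane, for arc
   length.  They are plain functions, not classes modulo equality a.e.: the
   norms below, and the Poisson integral, depend only on the class. *)
Section L2.
Context {R : realType}.
Local Notation plane := (R * R)%type.
Local Notation H1 := (@hausdorff1 R).
Implicit Types (D : set plane) (g : plane -> R[i]).

Definition L2norm D g : \bar R :=
  ((\int[H1]_(x in D) (Normc.normc (g x) ^+ 2)%:E) `^ 2^-1)%E.

Definition L2 D : set (plane -> R[i]) :=
  [set g | [/\ measurable_fun D (fun x => complex.Re (g x)),
               measurable_fun D (fun x => complex.Im (g x)) &
               (L2norm D g < +oo)%E]].

Definition opnorm D1 D2 (T : (plane -> R[i]) -> plane -> R[i]) : \bar R :=
  ereal_sup [set L2norm D2 (T g) | g in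
    [set g | L2 D1 g /\ (L2norm D1 g <= 1)%E]].

End L2.

Section TwoDisks.
Context {R : realType}.
Local Notation plane := (R * R)%type.
Local Notation H1 := (@hausdorff1 R).

Definition disk (c : plane) (r : R) : set plane := [set y | edist y c < r].

Definition boundary (A : set plane) : set plane := closure A `\` A^°.

(* The pieces of the boundary of [O], when the other disk is [O']. *)
Definition ext_arc (O O' : set plane) : set plane :=
  boundary O `&` boundary (O `|` O').

Definition int_arc (O O' : set plane) : set plane :=
  boundary O `\` ext_arc O O'.

Definition poisson (c : plane) (r : R) (g : plane -> R[i]) (x : plane) : R[i] :=
  let K y := (r ^+ 2 - edist x c ^+ 2) / (r * edist x y ^+ 2) in
  Complex
    ((2 * pi)^-1 * \int[H1]_(y in boundary (disk c r)) (K y * complex.Re (g y)))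
    ((2 * pi)^-1 * \int[H1]_(y in boundary (disk c r)) (K y * complex.Im (g y))).

Definition gamma2 (x1 : plane) (r1 : R) (x2 : plane) (r2 : R)
    (g : plane -> R[i]) (x : plane) : R[i] :=
  if x \in int_arc (disk x2 r2) (disk x1 r1) then poisson x1 r1 g x else 0.

Definition gamma2_norm (x1 : plane) (r1 : R) (x2 : plane) (r2 : R) : \bar R :=
  opnorm (boundary (disk x1 r1)) (boundary (disk x2 r2)) (gamma2 x1 r1 x2 r2).

(* Angle at [p] between the segments from [p] to [a] and from [p] to [b]. *)
Definition angle (p a b : plane) : R :=
  acos (((a.1 - p.1) * (b.1 - p.1) + (a.2 - p.2) * (b.2 - p.2)) /
        (edist a p * edist b p)).

(* [A] is an arc, without its endpoints, of the circle of center [c] and radius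
   [r], and [s] is half its aperture angle seen from [c]. *)
Definition half_aperture (c : plane) (r : R) (A : set plane) (s : R) : Prop :=
  exists phi : R,
    A = [set (c.1 + r * cos (phi + t), c.2 + r * sin (phi + t)) | t in `]- s, s[].

Record two_disks (x1 : plane) (r1 : R) (x2 : plane) (r2 : R)
    (p : plane) (theta sigma : R) : Prop := TwoDisks {
  radius1_gt0 : 0 < r1;
  radius2_gt0 : 0 < r2;
  disks_meet : disk x1 r1 `&` disk x2 r2 !=set0;
  disk1_not_sub : ~ disk x1 r1 `<=` disk x2 r2;
  disk2_not_sub : ~ disk x2 r2 `<=` disk x1 r1;
  crossing_point : (boundary (disk x1 r1) `&` boundary (disk x2 r2)) p;
  theta_range : 0 < theta < pi;
  theta_angle : theta = angle p x1 x2;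
  sigma_range : 0 < sigma < pi;
  sigma_aperture :
    half_aperture x1 r1 (int_arc (disk x1 r1) (disk x2 r2)) sigma }.

End TwoDisks.

(* Main.v *)
From HB Require Import structures.
From mathcomp Require Import all_boot all_order all_algebra.
From mathcomp Require Import all_classical all_reals all_analysis.
From mathcomp Require Import measurable_realfun.
From mathcomp Require Import complex ring lra.
Require Import Defs.

Set Implicit Arguments.
Unset Strict Implicit.
Unset Printing Implicit Defensive.

Import Order.TTheory GRing.Theory Num.Theory.
Import numFieldNormedType.Exports.

Local Open Scope classical_set_scope.
Local Open Scope ring_scope.

(** Let |t| < be, with be = pi - sigma - theta, be the angles of the arc of the
    second circle that lies in the first disk. Arc length on a circle is r dt
    (hausdorff1_circ, ge0_integral_circle), and after rescaling the first disk
    to the unit disk gamma2 becomes the integral operator T whose kernel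
    unit_poisson (arcpt t) s is the Poisson kernel at the point arcpt t of the
    arc. With rho = r2 / r1, the square of the norm of gamma2 is rho times that
    of T, hence rho times the norm of T T* (TTstar_bound). The kernel of T T* is
    explicit: the product of two Poisson kernels integrates to the Poisson
    kernel extended harmonically (integral_chord2_chord2), and on the arc this
    is a rational function of trigonometric functions (poissonPP_arc).

    Bound from above. The kernel of rho T T* is at most cornerK + kappa
    (arc_kernel_le), where kappa is a constant that vanishes if cos be >= 0. The
    kernel cornerK satisfies the condition of Schur's test (schur_test) with the
    weight (gap t)^(-1/2) and the constant 1 exactly, because its integral
    against this weight has an elementary primitive, an arctangent
    (is_derive_cornerK_prim, integral_cornerK_le). The constant kernel has norm
    2 * be * kappa on the arc, which is the correction term of the bound.

    Bound from below. Close to an end of the arc, where the circles cross, the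
    kernel of rho T T* is asymptotic to cornerK. The Schur weight is almost
    reproduced by cornerK there, but its square is not integrable, the
    divergence being logarithmic; so suitable truncations of it (corner_test)
    are almost eigenfunctions for the value 1, and the norm is at least 1
    (corner_form_ge, corner_energy_le, gamma2_norm_ge1).

    A norm above 1. If the second circle passes through the center of the first
    one and the angles sigma = theta = e tend to 0, the arc becomes almost the
    whole second circle. With a Poisson kernel as boundary data, its harmonic
    extension restricted to the second circle is a constant plus another Poisson
    kernel (thin_profile), so that both norms are explicit, and their ratio is
    above 1 once e is small (thin_norm_gt1). *)

(** * Measurability *)

Section Measurability.
Context {R : realType}.

(** Inversion is not continuous at 0, but f^-1 = f * (f ^ 2)^(-1), where the
    power with a real exponent is a measurable function. *)
Lemma measurable_funV d (T : measurableType d) (D : set T) (f : T -> R) :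
  measurable_fun D f -> measurable_fun D (fun x => (f x)^-1).
Proof.
move=> mf; rewrite (_ : (fun x => _) = fun x => f x * (f x ^+ 2) `^ (-1)).
  apply: measurable_funM => //.
  apply: (@measurableT_comp _ _ _ _ _ _ (fun y : R => y `^ (-1))); first exact: measurable_powR.
  exact: measurable_funX.
apply/funext => x; rewrite powR_inv1 ?sqr_ge0//.
have [->|fx0] := eqVneq (f x) 0; first by rewrite invr0 mul0r.
by field.
Qed.

Lemma measurable_cosf d (T : measurableType d) (D : set T) (f : T -> R) :
  measurable_fun D f -> measurable_fun D (fun x => cos (f x)).
Proof.
apply: measurableT_comp; apply: continuous_measurable_fun; exact: continuous_cos.
Qed.

Lemma measurable_sinf d (T : measurableType d) (D : set T) (f : T -> R) :
  measurable_fun D f -> measurable_fun D (fun x => sin (f x)).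
Proof.
apply: measurableT_comp; apply: continuous_measurable_fun; exact: continuous_sin.
Qed.

Lemma measurable_sqrtf d (T : measurableType d) (D : set T) (f : T -> R) :
  measurable_fun D f -> measurable_fun D (fun x => Num.sqrt (f x)).
Proof.
apply: measurableT_comp; apply: continuous_measurable_fun; exact: sqrt_continuous.
Qed.

Lemma measurable_oppf d (T : measurableType d) (D : set T) (f : T -> R) :
  measurable_fun D f -> measurable_fun D (fun x => - f x).
Proof. by move=> mf; exact: measurable_funN. Qed.

Lemma integral_indicator d (T : measurableType d) (mu : {measure set T -> \bar R})
  (D : set T) (f : T -> R) :
  (\int[mu]_(x in D) (f x)%:E = \int[mu]_x (f x * \1_D x)%:E)%E.
Proof.
rewrite integral_mkcond; apply: eq_integral => x _.
by rewrite patchE indicE; case: ifP => _; rewrite ?mulr1 ?mulr0.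
Qed.

Lemma indic_in (A : set R) t : A t -> \1_A t = 1 :> R.
Proof. by move=> At; rewrite indicE mem_set. Qed.

Lemma indic_notin (A : set R) t : ~ A t -> \1_A t = 0 :> R.
Proof. by move=> At; rewrite indicE memNset. Qed.

Lemma measurable_indE d (T : measurableType d) (A : set R) (g : T -> R) :
  measurable A -> measurable_fun setT g -> measurable_fun setT (fun x => \1_A (g x) : R).
Proof.
by move=> mA mg; apply: (@measurableT_comp _ _ _ _ _ _ (\1_A : R -> R) _ g) => //; exact: measurable_indic.
Qed.

Lemma eq_integral_support d (T : measurableType d) (mu : {measure set T -> \bar R})
  (D : set T) (f g : T -> R) :
  (forall x, D x -> g x = f x) -> (forall x, ~ D x -> g x = 0) ->
  (\int[mu]_(x in D) (f x)%:E = \int[mu]_x (g x)%:E)%E.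
Proof.
move=> gf g0; rewrite integral_indicator; apply: eq_integral => x _; congr (_%:E).
have [xD|xD] := pselect (D x); first by rewrite indicE mem_set// mulr1 gf.
by rewrite indicE memNset// mulr0 g0.
Qed.

End Measurability.

Ltac meas := cbv beta; lazymatch goal with
  | |- measurable_fun _ (fun _ => ?c) => exact: measurable_cst
  | |- measurable_fun _ (fun x => - @?f x) => apply: measurable_oppf; meas
  | |- measurable_fun _ (fun x => @?f x + @?g x) => apply: measurable_funD; meas
  | |- measurable_fun _ (fun x => @?f x * @?g x) => apply: measurable_funM; meas
  | |- measurable_fun _ (fun x => @?f x ^+ _) => apply: measurable_funX; meas
  | |- measurable_fun _ (fun x => (@?f x)^-1) => apply: measurable_funV; meas
  | |- measurable_fun _ (fun x => cos (@?f x)) => apply: measurable_cosf; meas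
  | |- measurable_fun _ (fun x => sin (@?f x)) => apply: measurable_sinf; meas
  | |- measurable_fun _ (fun x => Num.sqrt (@?f x)) => apply: measurable_sqrtf; meas
  | |- measurable_fun _ (+%R ?c) => apply: (@measurable_funD _ _ _ _ (fun=> c) id); meas
  | |- measurable_fun _ ( *%R ?c) => apply: (@measurable_funM _ _ _ _ (fun=> c) id); meas
  | |- measurable_fun _ -%R => apply: (@measurable_oppf _ _ _ _ id); meas
  | |- measurable_fun _ cos => apply: measurable_cosf; exact: measurable_id
  | |- measurable_fun _ sin => apply: measurable_sinf; exact: measurable_id
  | |- measurable_fun _ Num.sqrt => apply: measurable_sqrtf; exact: measurable_id
  | |- _ => first [exact: measurable_fst | exact: measurable_snd | exact: measurable_id | idtac]
  end.

(** * Arc length on a circle *)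

Section CircleMeasure.
Context {R : realType}.
Local Notation plane := (R * R)%type.
Local Notation H1 := (@hausdorff1 R).
Local Notation leb := (@lebesgue_measure R).

(** The angle phi moves the cut at t = -pi and t = pi to where it does no harm. *)
Definition circ (c : plane) (r phi t : R) : plane :=
  (c.1 + r * cos (phi + t), c.2 + r * sin (phi + t)).

Lemma sin_le_id (x : R) : 0 <= x -> sin x <= x.
Proof.
rewrite le_eqVlt => /predU1P[<-|x0]; first by rewrite sin0.
have [|y _] := @MVT R sin cos 0 x x0 (fun y _ => is_derive_sin y).
  by apply: continuous_subspaceT => y; exact: continuous_sin.
by rewrite sin0 !subr0 => ->; rewrite ler_piMl ?cos_le1// ltW.
Qed.

Lemma cosE_half (x : R) : cos x = 1 - 2 * sin (x / 2) ^+ 2.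
Proof.
have -> : x = (x / 2) *+ 2 by rewrite mulr2n; field.
by rewrite cos_mulr2n cos2sin2 (_ : (x / 2) *+ 2 / 2 = x / 2); [ring|rewrite mulr2n; field].
Qed.

Lemma cos_ge_quad (x : R) : 0 <= x -> 1 - x ^+ 2 / 2 <= cos x.
Proof.
move=> x0; rewrite cosE_half lerD2l lerN2.
have h : `|sin (x / 2)| <= x / 2.
  rewrite ler_norml; apply/andP; split; last by rewrite sin_le_id// divr_ge0.
  rewrite lerNl; have [xp|xp] := leP x pi.
    apply: (@le_trans _ _ 0); last by rewrite divr_ge0.
    by rewrite oppr_le0 sin_ge0_pi// divr_ge0//=; lra.
  by apply: (@le_trans _ _ 1); [rewrite lerNl sin_geN1|have := @pi_ge2 R; lra].
have : sin (x / 2) ^+ 2 <= (x / 2) ^+ 2.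
  by rewrite -(real_normK (num_real (sin _))) lerXn2r// nnegrE// divr_ge0.
by move: (sin _) => s; rewrite expr_div_n; lra.
Qed.

Lemma sin_ge_cubic (x : R) : 0 <= x -> x * (1 - x ^+ 2 / 2) <= sin x.
Proof.
rewrite le_eqVlt => /predU1P[<-|x0]; first by rewrite sin0 mul0r.
have [|y /[!in_itv]/= /andP[y0 yx]] := @MVT R sin cos 0 x x0 (fun y _ => is_derive_sin y).
  by apply: continuous_subspaceT => y; exact: continuous_sin.
rewrite sin0 !subr0 => ->; rewrite mulrC ler_pM2r//.
apply: le_trans (cos_ge_quad (ltW y0)); rewrite lerD2l lerN2 ler_pM2r ?invr_gt0//.
by rewrite lerXn2r ?nnegrE ?ltW.
Qed.

Lemma abs_sin_le (x : R) : `|sin x| <= `|x|.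
Proof.
wlog x0 : x / 0 <= x => [H|].
  have [/H//|/ltW x0] := leP 0 x.
  by rewrite -normrN -sinN -(normrN x); apply: H; rewrite oppr_ge0.
rewrite (ger0_norm x0) ler_norml sin_le_id// andbT lerNl.
have [xp|xp] := leP x pi.
  by apply: (@le_trans _ _ 0) => //; rewrite oppr_le0 sin_ge0_pi// x0.
by apply: (@le_trans _ _ 1); [rewrite lerNl sin_geN1|have := @pi_ge2 R; lra].
Qed.

Lemma edist_circ (c : plane) (r phi s t : R) : 0 <= r ->
  edist (circ c r phi s) (circ c r phi t) = 2 * r * `|sin ((s - t) / 2)|.
Proof.
move=> r0; rewrite /edist /circ/=.
rewrite (_ : _ + _ = (2 * r * sin ((s - t) / 2)) ^+ 2).
  by rewrite sqrtr_sqr normrM (ger0_norm (mulr_ge0 _ r0)).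
have h : 2 * sin ((s - t) / 2) ^+ 2 = 1 - cos (s - t) by rewrite cosE_half; ring.
have -> : (2 * r * sin ((s - t) / 2)) ^+ 2 = 2 * r ^+ 2 * (1 - cos (s - t)).
  by rewrite -h; ring.
have -> : s - t = (phi + s) - (phi + t) by ring.
rewrite cosB; have := cos2Dsin2 (phi + s); have := cos2Dsin2 (phi + t).
move: (cos _) (sin _) (cos _) (sin _) => a b a' b' h1 h2.
have -> : 2 * r ^+ 2 * (1 - (a * a' + b * b')) =
   r ^+ 2 * ((a ^+ 2 + b ^+ 2) + (a' ^+ 2 + b' ^+ 2) - 2 * (a' * a + b' * b)).
  by rewrite h1 h2; ring.
by ring.
Qed.

Lemma edist_circ_le (c : plane) (r phi s t : R) : 0 <= r ->
  edist (circ c r phi s) (circ c r phi t) <= r * `|s - t|.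
Proof.
move=> r0; rewrite edist_circ//.
apply: (@le_trans _ _ (2 * r * `|(s - t) / 2|)).
  by rewrite ler_wpM2l ?mulr_ge0 ?abs_sin_le.
by rewrite normrM (@ger0_norm _ 2^-1) ?invr_ge0//; move: `|_| => x; lra.
Qed.

(** A chord shorter than r * sin x0 has a half-angle below x0, unless the
    complementary arc is the short one; the bound by pi - tau, with x0 <= tau,
    excludes that. On such arcs chord and arc length agree up to 1 - x0. *)
Lemma circ_small_chord (c : plane) (r phi s t x0 tau : R) : 0 < r ->
  0 < x0 -> x0 <= tau -> x0 <= 1 -> `|s - t| / 2 <= pi - tau ->
  edist (circ c r phi s) (circ c r phi t) <= r * sin x0 ->
  `|s - t| * (r * (1 - x0)) <= edist (circ c r phi s) (circ c r phi t).
Proof.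
move=> r0 x00 x0tau x01 st; rewrite (edist_circ _ _ _ _ (ltW r0)).
set x := `|s - t| / 2; have x_ge0 : 0 <= x by rewrite divr_ge0.
have xpi : x <= pi by rewrite (le_trans st)//; lra.
have -> : `|sin ((s - t) / 2)| = sin x.
  have sx_ge0 : 0 <= sin x by rewrite sin_ge0_pi// x_ge0.
  rewrite -(ger0_norm sx_ge0) /x; case: (ler0P (s - t)) => h.
    by rewrite mulNr sinN normrN.
  by [].
have -> : `|s - t| = 2 * x by rewrite /x; field.
have sx0 : 0 < sin x0 by rewrite sin_gt0_pi// x00/=; have := @pi_ge2 R; lra.
move=> h; have {}h : sin x < sin x0.
  by move: h; rewrite -mulrA mulrCA ler_pM2l//; lra.
have pih : 1 <= pi / 2 :> R := pihalf_ge1 R.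
have xx0 : x < x0.
  have [xh|xh] := leP x (pi / 2).
    by move: h; rewrite ltr_sin// in_itv/=; apply/andP; split; lra.
  have sE : sin x = sin (pi - x) by rewrite sinB sinpi cospi; ring.
  have : sin (pi - x) < sin x0 by rewrite -sE.
  have st' : x <= pi - tau := st.
  by rewrite ltr_sin ?in_itv/=; [lra|apply/andP; split; lra..].
have := sin_ge_cubic x_ge0 => sx.
have : x * (1 - x0) <= sin x.
  apply: le_trans sx; rewrite ler_wpM2l// lerD2l lerN2.
  have : x ^+ 2 <= x0 * 1 by rewrite expr2 ler_pM//; lra.
  by lra.
by move=> ?; rewrite (_ : 2 * x * _ = 2 * r * (x * (1 - x0))); [rewrite ler_wpM2l// mulr_ge0// ltW|ring].
Qed.

Section Circ.
Variables (c : plane) (r phi : R).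
Hypothesis r_gt0 : 0 < r.
Local Notation C := (circ c r phi).

(** At a fine mesh, a covering set meets the arc in a set of angles whose length
    is at most its diameter divided by r * (1 - e), because the parametrization
    is nearly an isometry there. A full turn is excluded since its two ends are
    close to each other in the plane. *)
Lemma hausdorff1_circ_ge (a b : R) (B : set R) : b - a < pi *+ 2 ->
  measurable B -> B `<=` `[a, b] ->
  (r%:E * leb B <= H1 (C @` B))%E.
Proof.
move=> ba mB BI.
have lebB : (leb B <= (b - a)%:E \/ B = set0)%E.
  have [ab|ab] := leP a b.
    left; apply: (@le_trans _ _ (leb `[a, b]%classic)); first by apply: le_measure; rewrite ?inE.
    by rewrite lebesgue_measure_itv/= lte_fin; case: ltP => //; rewrite lee_fin; lra.
  by right; apply/seteqP; split => // t /BI/=; rewrite in_itv/=; lra.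
case: lebB => [lebB|->]; last by rewrite measure0 mule0 hausdorff1_ge0.
have lebfin : leb B \is a fin_num.
  by rewrite ge0_fin_numE ?measure_ge0// (le_lt_trans lebB) ?ltry.
have key (e : R) : 0 < e < 1 -> ((r * (1 - e))%:E * leb B <= H1 (C @` B))%E.
  move=> /andP[e0 e1].
  pose tau := (pi - (b - a) / 2) : R.
  have tau0 : 0 < tau by move: ba; rewrite /tau mulr2n; lra.
  pose x0 := Num.min tau e.
  have x00 : 0 < x0 by rewrite lt_min tau0.
  have x0tau : x0 <= tau by rewrite ge_min lexx.
  have x0e : x0 <= e by rewrite ge_min lexx orbT.
  have x01 : x0 <= 1 by lra.
  have delta0 : 0 < r * sin x0.
    by rewrite mulr_gt0// sin_gt0_pi// x00/=; have := @pi_ge2 R; lra.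
  apply: le_trans (hausdorff1_ge_delta _ delta0).
  apply: le_ereal_inf_tmp => _ [U [BU Ud] <-].
  pose V k := `[a, b]%classic `&` C @^-1` (U k).
  have dV k s t : V k s -> V k t -> ((`|s - t| * (r * (1 - e)))%:E <= ediam (U k))%E.
    move=> [/= sI Us] [/= tI Ut].
    have stU := edist_le_ediam Us Ut.
    have stx0 : edist (C s) (C t) <= r * sin x0.
      by rewrite -lee_fin (le_trans stU)// Ud.
    apply: le_trans stU; rewrite lee_fin.
    apply: le_trans (circ_small_chord r_gt0 x00 x0tau x01 _ stx0).
      by rewrite ler_wpM2l// ler_wpM2l ?(ltW r_gt0)// lerD2l lerN2.
    rewrite /tau opprB addrCA subrr addr0 ler_pM2r ?invr_gt0//.
    by move: sI tI; rewrite !in_itv/= => /andP[? ?] /andP[? ?]; rewrite ler_norml; lra.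
  pose L k := fine (ediam (U k)) / (r * (1 - e)).
  (* An interval that contains the angles of U k, of length L k. *)
  pose J k := if V k == set0 then set0 else `[inf (V k), inf (V k) + L k]%classic.
  have re0 : 0 < r * (1 - e) by rewrite mulr_gt0//; lra.
  have Ufin k : ediam (U k) \is a fin_num.
    by rewrite ge0_fin_numE ?ediam_ge0// (le_lt_trans (Ud k)) ?ltry.
  have BJ : B `<=` \bigcup_k J k.
    move=> t Bt; have [k _ Uk] : (\bigcup_k U k) (C t) by apply: BU; exists t.
    exists k => //; have Vt : V k t by split => //; exact: BI.
    rewrite /J ifF; last by apply/eqP => V0; rewrite V0 in Vt.
    have lb : has_lbound (V k).
      by exists a => s [/=]; rewrite in_itv/= => /andP[].
    rewrite /= in_itv/= ge_inf//= -lerBlDr.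
    apply: lb_le_inf; first by exists t.
    move=> s Vs; have := dV k _ _ Vt Vs.
    rewrite -[ediam _]fineK// lee_fin -ler_pdivlMr// -/(L k) => h.
    by have := le_trans (ler_norm _) h; lra.
  have mJ k : measurable (J k) by rewrite /J; case: ifP.
  have lebJ k : (leb (J k) <= (L k)%:E)%E.
    have L0 : 0 <= L k by rewrite divr_ge0 ?fine_ge0 ?ediam_ge0 ?ltW.
    rewrite /J; case: ifP => _; first by rewrite measure0 lee_fin.
    rewrite lebesgue_measure_itv/= lte_fin; case: ltP => _; last by rewrite lee_fin.
    by rewrite -EFinD lee_fin; lra.
  apply: (@le_trans _ _ ((r * (1 - e))%:E * \sum_(k <oo) leb (J k))%E).
    rewrite lee_pmul2l// ?lte_fin//.
    exact: measure_sigma_subadditive.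
  rewrite -nneseriesZl; last by move=> k _; rewrite measure_ge0.
  apply: lee_nneseries => k _ //.
    by move=> _; rewrite mule_ge0// lee_fin ltW.
  apply: (@le_trans _ _ ((r * (1 - e))%:E * (L k)%:E)%E).
    by rewrite lee_pmul2l ?lte_fin.
  by rewrite -EFinM /L mulrCA divff ?mulr1 ?fineK// gt_eqF.
rewrite -(fineK lebfin) -EFinM.
have [H1oo|H1fin] := eqVneq (H1 (C @` B)) +oo%E; first by rewrite H1oo leey.
have {}H1fin : H1 (C @` B) \is a fin_num.
  by rewrite ge0_fin_numE ?hausdorff1_ge0// ltey.
rewrite -(fineK H1fin) lee_fin.
set m := fine (leb B) in key *; set h := fine (H1 _) in key *.
have m0 : 0 <= m by rewrite fine_ge0// measure_ge0.
apply/ler_addgt0Pr => eps eps0.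
pose e := Num.min (1/2) (eps / (r * m + 1)).
have rm : 0 <= r * m by rewrite mulr_ge0// ltW.
have e0 : 0 < e.
  rewrite lt_min; apply/andP; split; first by lra.
  by rewrite divr_gt0// ltr_wpDl.
have e1 : e < 1 by rewrite gt_min; apply/orP; left; lra.
have := key e; rewrite e0 e1 => /(_ isT); rewrite -(fineK lebfin) -(fineK H1fin) -EFinM lee_fin -/m -/h.
have : e * (r * m + 1) <= eps by rewrite -ler_pdivlMr; [rewrite ge_min lexx orbT|lra].
by move: e0 e1; clear -rm; nra.
Qed.

Lemma hausdorff1_circ_le (a b : R) : a <= b ->
  (H1 (C @` `[a, b]) <= (r * (b - a))%:E)%E.
Proof.
move=> ab; apply: ge_ereal_sup => _ [delta d0 <-].
have [n nP] : exists n, r * (b - a) / n.+1%:R <= delta.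
  pose n := Num.truncn (r * (b - a) / delta).
  exists n; rewrite ler_pdivrMr// -ler_pdivrMl// mulrC.
  by apply/ltW/truncnS_gt.
pose h := (b - a) / n.+1%:R.
have h0 : 0 <= h by rewrite divr_ge0//; lra.
(* The arc is covered by n + 1 arcs of equal length. *)
pose U k := if (k <= n)%N then C @` `[a + k%:R * h, a + k.+1%:R * h] else set0.
have dU k : (ediam (U k) <= (if (k <= n)%N then r * h else 0)%:E)%E.
  rewrite /U; case: ifP => _; last by rewrite ediam0.
  rewrite /ediam ge_max lee_fin mulr_ge0 ?(ltW r_gt0)//=.
  apply: ge_ereal_sup => _ [_ [s /= sI <-]] [_ [t /= tI <-] <-].
  rewrite lee_fin (le_trans (edist_circ_le _ _ _ _ (ltW r_gt0)))// ler_wpM2l ?(ltW r_gt0)//.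
  move: sI tI; rewrite !in_itv/= -(natr1 k) => /andP[? ?] /andP[? ?].
  by rewrite ler_norml; lra.
have rh : r * h * n.+1%:R = r * (b - a) by rewrite /h; field.
apply: (@le_trans _ _ (\sum_(k <oo) ediam (U k))%E).
  apply: ereal_inf_lbound; exists U => //; split; last first.
    move=> k; rewrite (le_trans (dU k))// lee_fin; case: ifP => _; last exact: ltW.
    by rewrite /h mulrA.
  move=> _ [t /= tI <-]; move: tI; rewrite in_itv/= => /andP[ta tb].
  have [h00|hn0] := eqVneq h 0.
    have ba : b = a by apply/eqP; rewrite -subr_eq0; move: h00 => /eqP; rewrite mulf_eq0 invr_eq0 pnatr_eq0 orbF.
    exists 0%N => //; rewrite /U/=; exists t => //=; rewrite in_itv/= h00 !mulr0 addr0; lra.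
  have hp : 0 < h by rewrite lt_neqAle eq_sym hn0.
  pose k := Num.truncn ((t - a) / h).
  have t0 : 0 <= (t - a) / h by rewrite divr_ge0//; lra.
  have k1 : k%:R <= (t - a) / h by rewrite /k truncn_le.
  have k2 : (t - a) / h < k.+1%:R by exact: truncnS_gt.
  move: k1 k2; rewrite ler_pdivlMr// ltr_pdivrMr// => k1 k2.
  have [kn|nk] := leqP k n.
    by exists k => //; rewrite /U kn; exists t => //=; rewrite in_itv/=; apply/andP; split; lra.
  exists n => //; rewrite /U leqnn; exists t => //=; rewrite in_itv/=.
  have -> : n.+1%:R * h = b - a by rewrite /h; field.
  have : (n.+1%:R : R) <= k%:R by rewrite ler_nat.
  have : n.+1%:R * h = b - a by rewrite /h; field.
  have : n%:R * h <= n.+1%:R * h by rewrite ler_wpM2r// ler_nat.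
  by move=> h1 h2 h3; have h4 : n.+1%:R * h <= k%:R * h by [rewrite ler_wpM2r]; apply/andP; split; lra.
apply: lime_le; first by apply: is_cvg_nneseries => *; exact: ediam_ge0.
apply: nearW => m; rewrite big_mkord.
apply: (@le_trans _ _ (\sum_(k < m) (if (k <= n)%N then r * h else 0)%:E)%E).
  by apply: lee_sum => k _; exact: dU.
rewrite sumEFin lee_fin.
have rh0 : 0 <= r * h by rewrite mulr_ge0// ltW.
suff -> : \sum_(k < m) (if (k <= n)%N then r * h else 0) = r * h * (minn m n.+1)%:R.
  by rewrite -rh ler_wpM2l// ler_nat geq_minr.
elim: m => [|m IH]; first by rewrite big_ord0 min0n mulr0.
rewrite big_ord_recr/= IH; case: leqP => mn.
  by rewrite (minn_idPl (ltnW _))// (minn_idPl _)// -[in RHS](natr1 m) mulrDr mulr1.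
by rewrite addr0 (minn_idPr _)// (minn_idPr _)// ltnW.
Qed.

End Circ.

Section Circ2.
Variables (c : plane) (r phi : R).
Hypothesis r_gt0 : 0 < r.
Local Notation C := (circ c r phi).
Local Notation I := (`[- pi, pi[%classic : set R).

Lemma lebesgue_itv_cc (a b : R) : a <= b -> leb `[a, b]%classic = (b - a)%:E.
Proof.
move=> ab; rewrite lebesgue_measure_itv/= lte_fin; case: ltP => // ba.
by rewrite (_ : b - a = 0)//; lra.
Qed.

Lemma measurable_circ : measurable_fun setT C.
Proof. by apply: measurable_fun_pair; meas. Qed.

Lemma measurable_circ_preimage (A : set plane) : measurable A -> measurable (C @^-1` A).
Proof. by move=> mA; rewrite -[X in measurable X]setTI; exact: measurable_circ. Qed.

Lemma hausdorff1_caratheodoryE (A X : set plane) : measurable A ->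
  H1 X = (H1 (X `&` A) + H1 (X `&` ~` A))%E.
Proof. by move=> mA; apply: (borel_hausdorff1_caratheodory mA). Qed.

(** Arc length is at least r times Lebesgue measure on both A and its
    complement, and at most that on the whole arc, so additivity forces
    equality. *)
Lemma hausdorff1_circ_arc (a b : R) (A : set plane) : a <= b -> b - a < pi *+ 2 ->
  measurable A ->
  H1 ((C @` `[a, b]) `&` A) = (r%:E * leb (`[a, b] `&` C @^-1` A))%E.
Proof.
move=> ab ba mA.
pose B := `[a, b]%classic `&` C @^-1` A; pose B' := `[a, b]%classic `&` ~` (C @^-1` A).
have mA' := measurable_circ_preimage mA.
have mB : measurable B by apply: measurableI.
have mB' : measurable B' by apply: measurableI => //; exact: measurableC.
have E1 : (C @` `[a, b]) `&` A = C @` B.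
  apply/seteqP; split => [_ [[t It <-] At]|_ [t [It At] <-]]; first by exists t.
  by split => //; exists t.
have E2 : (C @` `[a, b]) `&` ~` A = C @` B'.
  apply/seteqP; split => [_ [[t It <-] At]|_ [t [It At] <-]]; first by exists t.
  by split => //; exists t.
have h1 := hausdorff1_circ_ge c phi r_gt0 ba mB (@subIsetl _ _ _).
have h2 := hausdorff1_circ_ge c phi r_gt0 ba mB' (@subIsetl _ _ _).
have := hausdorff1_caratheodoryE (C @` `[a, b]) mA; rewrite E1 E2 => h3.
have h4 := hausdorff1_circ_le c phi r_gt0 ab.
have lebI : (leb B + leb B' = (b - a)%:E)%E.
  rewrite -(lebesgue_itv_cc ab) -measureU//; last first.
    by rewrite /B /B' setIACA setICr setI0.
  by rewrite /B /B' -setIUr setUv setIT.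
have fB : leb B \is a fin_num.
  by rewrite ge0_fin_numE// (@le_lt_trans _ _ (b - a)%:E) ?ltry// -lebI leeDl.
have fB' : leb B' \is a fin_num.
  by rewrite ge0_fin_numE// (@le_lt_trans _ _ (b - a)%:E) ?ltry// -lebI leeDr.
have H0 X : (0 <= H1 X)%E by exact: hausdorff1_ge0.
have fC : H1 (C @` `[a, b]) \is a fin_num.
  by rewrite ge0_fin_numE// (le_lt_trans h4) ?ltry.
have fH : H1 (C @` B) \is a fin_num.
  by rewrite ge0_fin_numE// (@le_lt_trans _ _ (H1 (C @` `[a, b]))) ?h3 ?leeDl// -h3 ltey_eq fC.
have fH' : H1 (C @` B') \is a fin_num.
  by rewrite ge0_fin_numE// (@le_lt_trans _ _ (H1 (C @` `[a, b]))) ?h3 ?leeDr// -h3 ltey_eq fC.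
rewrite -[in RHS]/B; move: h1 h2 h3 h4 lebI.
rewrite -(fineK fB) -(fineK fB') -(fineK fH) -(fineK fH') -(fineK fC).
rewrite -!EFinM -!EFinD !lee_fin => h1 h2 [h3] h4 [h5]; congr (_%:E).
by move: h1 h2 h4; rewrite h3 -h5 mulrDr; lra.
Qed.

(** The full turn is cut by a half-plane into two half turns, and Caratheodory's
    criterion for this half-plane adds their lengths. *)
Lemma hausdorff1_circ (A : set plane) : measurable A ->
  H1 ((C @` I) `&` A) = (r%:E * leb (I `&` C @^-1` A))%E.
Proof.
move=> mA; have pi0 := @pi_gt0 R.
pose M : set plane := [set x | (x.2 - c.2) * cos phi - (x.1 - c.1) * sin phi <= 0].
have mM : measurable M.
  rewrite (_ : M = setT `&` (fun x => (x.2 - c.2) * cos phi - (x.1 - c.1) * sin phi) @^-1` `]-oo, 0]).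
    suff mf : measurable_fun setT (fun x : plane => (x.2 - c.2) * cos phi - (x.1 - c.1) * sin phi) by exact: mf.
    by meas.
  by apply/seteqP; split=> x; rewrite /M/= in_itv/=; [|case].
have MC t : M (C t) <-> sin t <= 0.
  have -> : sin t = sin (phi + t) * cos phi - cos (phi + t) * sin phi.
    by rewrite -sinB addrAC subrr add0r.
  rewrite /M /circ/= !(addrC _.1) !(addrC _.2) !addrK -!mulrA -mulrBr.
  by rewrite pmulr_rle0.
have sub1 t : `[- pi, 0]%classic t <-> I t /\ M (C t).
  rewrite /= !in_itv/=; split=> [/andP[t1 t2]|[/andP[t1 t2] /MC st]].
    split; first by apply/andP; split; lra.
    by apply/MC; rewrite -oppr_ge0 -sinN; apply: sin_ge0_pi; apply/andP; split; lra.
  by rewrite t1 leNgt; apply: contraTN st => t0; rewrite -ltNge sin_gt0_pi// t0.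
have sub2 t : `[0, pi]%classic t /\ ~ M (C t) <-> I t /\ ~ M (C t).
  split=> -[tI tM]; split => //; move: tI; rewrite /= !in_itv/= => /andP[t1 t2].
    apply/andP; split; first lra.
    rewrite lt_neqAle t2 andbT; apply/eqP => tpi; apply: tM; apply/MC.
    by rewrite tpi sinpi.
  apply/andP; split; last exact: ltW.
  rewrite leNgt; apply/negP => t0; apply: tM.
  by have /sub1[] : `[- pi, 0]%classic t by rewrite /= in_itv/= t1 ltW.
have mM' : measurable (~` M) by exact: measurableC.
rewrite (hausdorff1_caratheodoryE _ mM).
have -> : C @` I `&` A `&` M = C @` `[- pi, 0] `&` (A `&` M).
  apply/seteqP; split=> [_ [[[t tI <-] At] Mt]|_ [[t /sub1[tI _] <-] [At Mt]]].
    by split => //; exists t => //; apply/sub1.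
  by split => //; split => //; exists t.
have -> : C @` I `&` A `&` ~` M = C @` `[0, pi] `&` (A `&` ~` M).
  apply/seteqP; split=> [_ [[[t tI <-] At] Mt]|_ [[t tI <-] [At Mt]]].
    by split => //; exists t => //; exact: (proj1 ((sub2 t).2 (conj tI Mt))).
  by split => //; split => //; exists t => //; exact: (proj1 ((sub2 t).1 (conj tI Mt))).
rewrite !hausdorff1_circ_arc//; [|first [exact: measurableI|rewrite ?mulr2n; lra]..].
rewrite -ge0_muleDr//; congr (_ * _)%E; rewrite -measureU.
- congr (leb _); apply/seteqP; split=> [t [[/sub1[tI _] [At _]]|[tI [At Mt]]]|t [tI At]].
  + by [].
  + by split => //; exact: (proj1 ((sub2 t).1 (conj tI Mt))).
  have [Mt|Mt] := pselect (M (C t)); first by left; split => //; apply/sub1.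
  by right; split => //; exact: (proj1 ((sub2 t).2 (conj tI Mt))).
- by apply: measurableI => //; apply: measurable_circ_preimage; exact: measurableI.
- by apply: measurableI => //; apply: measurable_circ_preimage; exact: measurableI.
- by apply/seteqP; split=> // t [[_ [_ ?]] [_ [_ ?]]].
Qed.

End Circ2.

Lemma polar (a b : R) : a ^+ 2 + b ^+ 2 = 1 ->
  exists2 t, t \in `[- pi, pi[ & cos t = a /\ sin t = b.
Proof.
move=> ab1.
have a1 : -1 <= a <= 1.
  rewrite -ler_norml -(@ler_pXn2r _ 2)// ?nnegrE// expr1n real_normK ?num_real//.
  by have := sqr_ge0 b; lra.
have pi0 := @pi_gt0 R.
have cK : cos (acos a) = a by rewrite acosK// in_itv.
have sK : sin (acos a) = Num.sqrt (b ^+ 2) by rewrite sin_acos//; congr Num.sqrt; lra.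
have a0 := acos_ge0 a1; have api := acos_lepi a1.
have [/andP[b0 an]|nb] := boolP ((0 <= b) && (-1 < a)).
  exists (acos a); last by rewrite cK sK sqrtr_sqr ger0_norm.
  rewrite in_itv/=; apply/andP; split; first lra.
  by rewrite acos_ltpi// an; case/andP: a1.
exists (- acos a); first by rewrite in_itv/=; apply/andP; split; lra.
rewrite cosN cK sinN sK sqrtr_sqr; split => //.
move: nb; rewrite negb_and -!leNgt -ltNge => /orP[b0|am1].
  by rewrite ltr0_norm// opprK.
have -> : b = 0; last by rewrite normr0 oppr0.
have am : a = -1 by case/andP: a1 => ? ?; lra.
by apply/eqP; rewrite -sqrf_eq0; apply/eqP; move: ab1; rewrite am sqrrN expr1n; lra.
Qed.

Lemma polar_shift (phi a b : R) : a ^+ 2 + b ^+ 2 = 1 ->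
  exists2 t, t \in `[- pi, pi[ & cos (phi + t) = a /\ sin (phi + t) = b.
Proof.
move=> ab1; have cs := cos2Dsin2 phi.
have [|t tI [ct st]] := @polar (a * cos phi + b * sin phi) (b * cos phi - a * sin phi).
  have -> : (a * cos phi + b * sin phi) ^+ 2 + (b * cos phi - a * sin phi) ^+ 2 =
     (a ^+ 2 + b ^+ 2) * (cos phi ^+ 2 + sin phi ^+ 2) by ring.
  by rewrite ab1 cs mulr1.
exists t => //; rewrite cosD sinD ct st; move: (cos phi) (sin phi) cs => x y cs.
split; [transitivity (a * (x ^+ 2 + y ^+ 2))|transitivity (b * (x ^+ 2 + y ^+ 2))];
  by [ring|rewrite cs mulr1].
Qed.

Lemma edist_ge0 (x y : plane) : 0 <= edist x y.
Proof. exact: sqrtr_ge0. Qed.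

Lemma sqr_edist (x y : plane) :
  edist x y ^+ 2 = (x.1 - y.1) ^+ 2 + (x.2 - y.2) ^+ 2.
Proof. by rewrite sqr_sqrtr// addr_ge0// sqr_ge0. Qed.

Lemma edist_circ_center (c : plane) (r phi t : R) : 0 <= r -> edist (circ c r phi t) c = r.
Proof.
move=> r0; rewrite /edist /circ/= (_ : _ + _ = r ^+ 2); last first.
  by transitivity (r ^+ 2 * (cos (phi + t) ^+ 2 + sin (phi + t) ^+ 2)); [ring|rewrite cos2Dsin2 mulr1].
by rewrite sqrtr_sqr ger0_norm.
Qed.

Lemma circ_image (c : plane) (r phi : R) : 0 < r ->
  circ c r phi @` `[- pi, pi[ = [set x | edist x c = r].
Proof.
move=> r0; apply/seteqP; split => [_ [t _ <-]|[x y] /= xc]; first exact/edist_circ_center/ltW.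
have := sqr_edist (x, y) c; rewrite xc/= => h.
have [|t tI [ct st]] := @polar_shift phi ((x - c.1) / r) ((y - c.2) / r).
  by rewrite !expr_div_n -mulrDl -h divff// sqrf_eq0 gt_eqF.
exists t => //; rewrite /circ ct st; congr pair; field; exact: lt0r_neq0.
Qed.

Lemma continuous_edist (c : plane) : continuous (fun x => edist x c).
Proof.
move=> x; apply: continuous_comp; last exact: sqrt_continuous.
by apply: cvgD; (apply: cvgM; apply: cvgB; [|exact: cvg_cst| |exact: cvg_cst]); first [exact: cvg_fst|exact: cvg_snd].
Qed.

Lemma disk_open (c : plane) (r : R) : open (disk c r).
Proof.
by apply: (@open_comp _ _ (fun x => edist x c) [set y | y < r]);
  [move=> x _; exact: continuous_edist|exact: open_lt].
Qed.

Lemma edist_scale (c x : plane) (s : R) :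
  edist (c.1 + s * (x.1 - c.1), c.2 + s * (x.2 - c.2)) c = `|s| * edist x c.
Proof.
rewrite /edist/= !(addrC c.1) !(addrC c.2) !addrK !exprMn -mulrDr sqrtrM ?sqr_ge0//.
by rewrite sqrtr_sqr.
Qed.

(** A point at distance at most r is the limit of its contractions towards the
    center. *)
Lemma closure_disk (c : plane) (r : R) : 0 < r ->
  closure (disk c r) = [set x | edist x c <= r].
Proof.
move=> r0; apply/seteqP; split.
  rewrite closureE; apply: smallest_sub => /=; last by move=> x; rewrite /disk/= => /ltW.
  apply: (@preimage_closed _ _ (fun x => edist x c) [set y | y <= r]) => //.
    by move=> x _; exact: continuous_edist.
move=> x /= xr B xB.
pose f (s : R) : plane := (c.1 + s * (x.1 - c.1), c.2 + s * (x.2 - c.2)).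
have /nbhs_ballP[e /= e0 eB] := xB.
pose M := `|x.1 - c.1| + `|x.2 - c.2| + 1.
have n1 := normr_ge0 (x.1 - c.1); have n2 := normr_ge0 (x.2 - c.2).
have M0 : 0 < M by rewrite /M; lra.
pose d := Num.min (e / (2 * M)) (1 / 2).
have d0 : 0 < d by rewrite lt_min; apply/andP; split; [rewrite divr_gt0//|]; lra.
have de : d * M < e.
  have : d <= e / (2 * M) by rewrite ge_min lexx.
  by rewrite ler_pdivlMr; lra.
have d1 : d <= 1 / 2 by rewrite ge_min lexx orbT.
have dball (a b : R) : `|a - b| <= M -> ball a e (b + (1 - d) * (a - b)).
  move=> abM; rewrite /ball/= (_ : a - (b + (1 - d) * (a - b)) = d * (a - b)); last by ring.
  rewrite normrM gtr0_norm//; apply: le_lt_trans de.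
  by rewrite ler_wpM2l// ltW.
exists (f (1 - d)); split; last first.
  by apply: eB; split; apply: dball; rewrite /M; lra.
rewrite /disk/= edist_scale ger0_norm; last by lra.
apply: (@le_lt_trans _ _ ((1 - d) * r)); first by rewrite ler_wpM2l//; lra.
by rewrite gtr_pMl//; lra.
Qed.

Lemma boundary_disk (c : plane) (r : R) : 0 < r ->
  boundary (disk c r) = [set x | edist x c = r].
Proof.
move=> r0; rewrite /boundary closure_disk// (interior_id _).1; last exact: disk_open.
apply/seteqP; split => x; rewrite /disk/=.
  by move=> [xr /negP]; rewrite -leNgt => rx; apply/eqP; rewrite eq_le xr.
by move=> ->; split => //; rewrite ltxx.
Qed.

(** A boundary point of the first disk that lies in the second one is interior
    to the union; one that lies outside of both stays on the boundary of the
    union. *)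
Lemma int_arc_disk (c c' : plane) (r r' : R) : 0 < r ->
  int_arc (disk c r) (disk c' r') = [set x | edist x c = r /\ edist x c' < r'].
Proof.
move=> r0; have oU : open (disk c r `|` disk c' r') by apply: openU; exact: disk_open.
rewrite /int_arc /ext_arc; apply/seteqP; split => x.
  move=> [bx nbx]; have xr : edist x c = r by move: bx; rewrite boundary_disk.
  split => //; apply: contrapT => nx; apply: nbx; split => //.
  split; first by apply: closureS bx.1; exact: subsetUl.
  rewrite (interior_id _).1// => -[|//]; rewrite /disk/= xr ltxx//.
move=> [xr xr']; have bx : boundary (disk c r) x by rewrite boundary_disk.
split => // -[_ [_]]; apply; rewrite (interior_id _).1//; by right.
Qed.

Lemma measurable_edist (c : plane) : measurable_fun setT (fun x => edist x c).
Proof. by rewrite /edist; meas. Qed.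

Lemma measurable_circle (c : plane) (r : R) : 0 < r -> measurable (boundary (disk c r)).
Proof.
move=> r0; rewrite boundary_disk// (_ : mkset _ = (fun x => edist x c) @^-1` [set r]) //.
by rewrite -[X in measurable X]setTI; apply: measurable_edist.
Qed.

(** Arc length on the circle is the image of r dt under the parametrization. *)
Lemma ge0_integral_circle (c : plane) (r phi : R) (F : plane -> \bar R) : 0 < r ->
  measurable_fun (boundary (disk c r)) F ->
  (forall x, boundary (disk c r) x -> 0 <= F x)%E ->
  (\int[H1]_(x in boundary (disk c r)) F x =
   r%:E * \int[leb]_(t in `[(- pi)%R, (pi : R)[) F (circ c r phi t))%E.
Proof.
move=> r0 mF F0; set D := boundary _ in mF F0 *.
have mD : measurable D by exact: measurable_circle.
have DE : D = circ c r phi @` `[- pi, pi[ by rewrite circ_image// /D boundary_disk.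
have mC := measurable_circ c r phi.
have mI : measurable (`[- pi, pi[%classic : set R) by [].
have DC t : D (circ c r phi t) by rewrite /D boundary_disk//= edist_circ_center// ltW.
have CDT : circ c r phi @^-1` D = setT by rewrite -subTset => t _; exact: DC.
have rnn : 0 <= r by exact: ltW.
pose lebm := lebesgue_measure_lebesgue_measure__canonical__measure_function_Measure R.
pose m1 := measure_function_mrestr__canonical__measure_function_Measure lebm mI.
pose m2 := measure_function_pushforward__canonical__measure_function_Measure m1 mC.
pose m3 := mscale (NngNum rnn) m2.
rewrite (eq_measure_integral m3); last first.
  move=> A mA AD; transitivity (r%:E * leb (`[(- pi)%R, pi[%classic `&` circ c r phi @^-1` A))%E.
    by rewrite -hausdorff1_circ// -DE setIidr.
  by rewrite setIC.
rewrite ge0_integral_mscale//=; congr (_ * _)%E.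
rewrite ge0_integral_pushforward//; last by move=> x /set_mem; exact: F0.
rewrite CDT.
have mFC : measurable_fun setT (F \o circ c r phi).
  by apply: (measurable_comp mD _ mF mC) => _ [t _ <-]; exact: DC.
have mCI : measurable (~` `[- pi, pi[%classic : set R) by exact: measurableC.
transitivity (\int[m1]_(t in setT `\` ~` `[(- pi)%R, (pi : R)[%classic) (F \o circ c r phi) t)%E.
  apply: ge0_negligible_integral => //; first by move=> t _; exact/F0/DC.
  transitivity (leb (~` `[- pi, pi[%classic `&` `[- pi, pi[%classic)) => //.
  by rewrite setICl measure0.
rewrite setTD setCK; apply: eq_measure_integral => A mA AI.
by transitivity (leb (A `&` `[- pi, pi[%classic)) => //; rewrite setIidl.
Qed.

End CircleMeasure.

(** * Two crossing circles *)

Section Geometry.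
Context {R : realType}.
Local Notation plane := (R * R)%type.
Local Notation H1 := (@hausdorff1 R).
Local Notation leb := (@lebesgue_measure R).
Local Notation I := (`[(- pi), pi[%classic : set R).

Lemma cos_lt_cos (be t : R) : 0 <= be <= pi -> - pi <= t <= pi ->
  (cos be < cos t) = (- be < t < be).
Proof.
move=> /andP[be0 bepi] /andP[t1 t2].
rewrite -(cos_norm t) ltr_cos ?in_itv/= ?be0 ?bepi ?normr_ge0//; last first.
  by rewrite ler_norml t1.
by rewrite ltr_norml.
Qed.

Lemma sin_eq0_small (x : R) : `|x| < pi -> sin x = 0 -> x = 0.
Proof.
move=> xpi sx; apply/eqP; rewrite -normr_eq0; apply/negPn/negP => x0.
have : 0 < sin `|x| by apply: sin_gt0_pi; rewrite lt_neqAle eq_sym x0 normr_ge0.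
by case: (ger0P x) => _; rewrite ?sinN sx ?oppr0 ltxx.
Qed.

Lemma sqr_edist_circ (x c : plane) (r d al t : R) :
  c = (x.1 + d * cos al, x.2 + d * sin al) ->
  edist (circ x r al t) c ^+ 2 = r ^+ 2 + d ^+ 2 - 2 * r * d * cos t.
Proof.
move=> ->; rewrite sqr_edist /circ/= cosD sinD.
have h1 := cos2Dsin2 al; have h2 := cos2Dsin2 t.
apply/eqP; rewrite -subr_eq0; apply/eqP.
transitivity ((cos al ^+ 2 + sin al ^+ 2 - 1) * (r ^+ 2 * (cos t ^+ 2 + sin t ^+ 2) + d ^+ 2 - 2 * r * d * cos t)
   + r ^+ 2 * (cos t ^+ 2 + sin t ^+ 2 - 1)); first by ring.
by rewrite h1 h2 !subrr mul0r mulr0 addr0.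
Qed.

Lemma scaled_law_cos (r1 r2 d be : R) : 0 < r1 ->
  r1 ^+ 2 = r2 ^+ 2 + d ^+ 2 - 2 * r2 * d * cos be ->
  1 = (r2 / r1) ^+ 2 + (d / r1) ^+ 2 - 2 * (r2 / r1) * (d / r1) * cos be.
Proof.
move=> r10 r1E; rewrite -[LHS](divff (expf_neq0 2 (lt0r_neq0 r10))) {1}r1E; field.
by rewrite gt_eqF.
Qed.

Lemma edist_lt_sqr (x y : plane) (r : R) : 0 < r -> (edist x y < r) = (edist x y ^+ 2 < r ^+ 2).
Proof. by move=> r0; rewrite ltr_pXn2r ?nnegrE ?edist_ge0// ltW. Qed.

Lemma int_arc_circ (c c' : plane) (r r' d al be t : R) : 0 < r -> 0 < r' -> 0 < d ->
  0 < be < pi -> c' = (c.1 + d * cos al, c.2 + d * sin al) ->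
  r' ^+ 2 = r ^+ 2 + d ^+ 2 - 2 * r * d * cos be -> I t ->
  int_arc (disk c r) (disk c' r') (circ c r al t) <-> - be < t < be.
Proof.
move=> r0 r'0 d0 /andP[be0 bepi] cE r'E; rewrite /= in_itv/= => /andP[t1 t2].
rewrite int_arc_disk//=; set P := edist _ c' < r'; set Q := _ && _.
rewrite edist_circ_center ?(ltW r0)//.
have -> : P = Q; last by split=> [[]|].
rewrite /P edist_lt_sqr// (sqr_edist_circ _ _ cE) r'E ltrD2l ltrN2 ltr_pM2l ?mulr_gt0//.
by rewrite cos_lt_cos ?(ltW be0) ?(ltW bepi)// t1 ltW.
Qed.

Lemma measurable_int_arc (c c' : plane) (r r' : R) : 0 < r -> 0 < r' ->
  measurable (int_arc (disk c r) (disk c' r')).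
Proof.
move=> r0 r'0; rewrite int_arc_disk//.
rewrite (_ : [set x | _] = boundary (disk c r) `&` disk c' r'); last first.
  by rewrite boundary_disk//; apply/seteqP; split.
apply: measurableI; first exact: measurable_circle.
rewrite (_ : disk _ _ = setT `&` (fun x => edist x c') @^-1` `]-oo, r'[); first exact: measurable_edist.
by apply/seteqP; split=> x; rewrite /disk/= in_itv/=; [|case].
Qed.

Lemma circ_inj (c : plane) (r phi s t : R) : 0 < r -> `|s - t| < 2 * pi ->
  circ c r phi s = circ c r phi t -> s = t.
Proof.
move=> r0 st e; have := edist_circ c phi s t (ltW r0); rewrite e edist_circ ?(ltW r0)//.
rewrite subrr mul0r sin0 normr0 mulr0 => /esym/eqP.
rewrite mulf_eq0 gt_eqF ?mulr_gt0//= normr_eq0 => /eqP/sin_eq0_small.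
move=> /(_ _)/eqP; rewrite mulf_eq0 subr_eq0 invr_eq0 pnatr_eq0 orbF => h.
by apply/eqP; apply: h; rewrite normrM (@ger0_norm _ 2^-1)// ltr_pdivrMr// mulrC.
Qed.

(** Any parametrization of the arc gives it the H1-measure 2 r s, which
    determines the half-aperture s. *)
Lemma half_aperture_int_arc (c c' : plane) (r r' d al be s : R) : 0 < r -> 0 < r' -> 0 < d ->
  0 < be < pi -> c' = (c.1 + d * cos al, c.2 + d * sin al) ->
  r' ^+ 2 = r ^+ 2 + d ^+ 2 - 2 * r * d * cos be -> 0 < s < pi ->
  half_aperture c r (int_arc (disk c r) (disk c' r')) s -> s = be.
Proof.
move=> r0 r'0 d0 beR cE r'E sR [phi AE]; have /andP[be0 bepi] := beR; have /andP[s0 spi] := sR.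
set A := int_arc _ _ in AE.
have mA : measurable A by exact: measurable_int_arc.
have H al' : (H1 (boundary (disk c r) `&` A) = r%:E * leb (I `&` circ c r al' @^-1` A))%E.
  by rewrite -hausdorff1_circ// circ_image// boundary_disk.
have lebE x : 0 < x -> leb (`]- x, x[%classic : set R) = (2 * x)%:E.
  move=> x0; rewrite lebesgue_measure_itv/= lte_fin gtrN// -EFinB; congr (_%:E); ring.
have e1 : I `&` circ c r al @^-1` A = `]- be, be[%classic.
  apply/seteqP; split=> t.
    by move=> [It]; rewrite /= in_itv/= => /(int_arc_circ r0 r'0 d0 beR cE r'E It).
  rewrite /= in_itv/= => /[dup] tb /andP[t1 t2].
  have It : I t by rewrite /= in_itv/=; apply/andP; split; lra.
  by split => //; apply/(int_arc_circ r0 r'0 d0 beR cE r'E It).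
have e2 : I `&` circ c r phi @^-1` A = `]- s, s[%classic.
  apply/seteqP; split=> t.
    rewrite AE /= in_itv/= => -[/andP[t1 t2] [t']]; rewrite in_itv/= => /andP[t'1 t'2] e.
    suff <- : t' = t by rewrite in_itv/= t'1.
    by apply: (circ_inj (r := r) (c := c) (phi := phi) r0) => //; rewrite ltr_norml; apply/andP; split; lra.
  rewrite /= in_itv/= => /andP[t1 t2]; split; first by rewrite in_itv/=; apply/andP; split; lra.
  by rewrite AE; exists t => //; rewrite /= in_itv/= t1.
have := H phi; rewrite (H al) e1 e2 !lebE// -!EFinM => -[] /(mulfI (lt0r_neq0 r0))/(mulfI _) h.
by apply/esym/h.
Qed.

(** In the triangle with vertices x1, x2 and p, theta is the angle at p, sigma
    is the angle at x1 and therefore pi - sigma - theta is the angle at x2; the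
    last two conclusions are the laws of cosines and of sines. *)
Lemma two_disks_angles (x1 : plane) (r1 : R) (x2 : plane) (r2 : R) (p : plane) (theta sigma : R) :
  two_disks x1 r1 x2 r2 p theta sigma -> exists d al,
  [/\ 0 < d, x1 = (x2.1 + d * cos al, x2.2 + d * sin al), 0 < pi - sigma - theta < pi,
      r1 ^+ 2 = r2 ^+ 2 + d ^+ 2 - 2 * r2 * d * cos (pi - sigma - theta) &
      d * sin (sigma + theta) = r1 * sin theta].
Proof.
move=> [r10 r20 _ _ _ [p1 p2] /andP[th0 thpi] thE sR ap]; have /andP[s0 spi] := sR.
rewrite boundary_disk// in p1; rewrite boundary_disk// in p2.
rewrite /= edistC in p1; rewrite /= edistC in p2.
set w := (x1.1 - p.1) * (x2.1 - p.1) + (x1.2 - p.2) * (x2.2 - p.2).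
have q1 : (x1.1 - p.1) ^+ 2 + (x1.2 - p.2) ^+ 2 = r1 ^+ 2 by rewrite -p1 sqr_edist.
have q2 : (x2.1 - p.1) ^+ 2 + (x2.2 - p.2) ^+ 2 = r2 ^+ 2 by rewrite -p2 sqr_edist.
have r12 : 0 < r1 * r2 by exact: mulr_gt0.
have cw : w ^+ 2 <= (r1 * r2) ^+ 2.
  rewrite exprMn -q1 -q2 -subr_ge0.
  have -> : ((x1.1 - p.1) ^+ 2 + (x1.2 - p.2) ^+ 2) * ((x2.1 - p.1) ^+ 2 + (x2.2 - p.2) ^+ 2) - w ^+ 2
    = ((x1.1 - p.1) * (x2.2 - p.2) - (x1.2 - p.2) * (x2.1 - p.1)) ^+ 2 by rewrite /w; ring.
  exact: sqr_ge0.
have cth : cos theta * (r1 * r2) = w.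
  rewrite thE /angle p1 p2 acosK; first by rewrite -/w divfK// lt0r_neq0.
  rewrite in_itv/= -ler_norml normrM normfV (gtr0_norm r12) ler_pdivrMr// mul1r.
  by rewrite -(ler_pXn2r (n := 2)) ?nnegrE ?(ltW r12)// real_normK ?num_real.
have sth : 0 < sin theta by apply: sin_gt0_pi; rewrite th0.
have cs := cos2Dsin2 theta.
have cth1 : cos theta ^+ 2 < 1 by rewrite -cs ltrDl exprn_gt0.
set d := edist x1 x2; set ct := cos theta in cth cs cth1; set st := sin theta in sth cs.
have dE : d ^+ 2 = r1 ^+ 2 + r2 ^+ 2 - 2 * r1 * r2 * ct.
  rewrite -mulrA -mulrA (mulrA r1) (mulrC (r1 * r2)) cth sqr_edist -q1 -q2 /w; ring.
have d0 : 0 < d.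
  rewrite lt_neqAle edist_ge0 andbT eq_sym; apply/eqP => d0.
  have h : (r1 - r2) ^+ 2 + 2 * r1 * r2 * (1 - ct) = 0.
    have := dE; rewrite d0 expr0n/= => e; rewrite [RHS]e; ring.
  have : 0 < 2 * r1 * r2 * (1 - ct).
    apply: mulr_gt0; first by rewrite -mulrA mulr_gt0.
    rewrite subr_gt0 ltNge; apply/negP => c1; move: cth1; rewrite ltNge -(expr1n _ 2).
    by rewrite lerXn2r ?nnegrE//; exact: le_trans c1.
  have := sqr_ge0 (r1 - r2); lra.
have [al _ [c_al s_al]] : exists2 t, t \in `[- pi, pi[ & cos t = (x1.1 - x2.1) / d /\ sin t = (x1.2 - x2.2) / d.
  by apply: polar; rewrite !expr_div_n -mulrDl -sqr_edist divff// expf_neq0// gt_eqF.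
exists d, al.
set k := (r1 ^+ 2 + d ^+ 2 - r2 ^+ 2) / (2 * r1 * d).
have r1d : 0 < 2 * r1 * d by rewrite !mulr_gt0.
have k1 : 1 - k ^+ 2 = (r2 * st / d) ^+ 2.
  rewrite /k; have := dE; move: d0 r1d => {k}; move: (d) => e e0 r1e eE.
  have -> : r1 ^+ 2 + e ^+ 2 - r2 ^+ 2 = 2 * r1 * (r1 - r2 * ct) by rewrite eE; ring.
  have -> : 2 * r1 * (r1 - r2 * ct) / (2 * r1 * e) = (r1 - r2 * ct) / e.
    by field; rewrite !gt_eqF.
  have -> : (r2 * st / e) ^+ 2 = (r2 ^+ 2 - r2 ^+ 2 * ct ^+ 2) / e ^+ 2.
    by rewrite expr_div_n exprMn -[st ^+ 2](addKr (ct ^+ 2)) cs; congr (_ / _); ring.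
  rewrite expr_div_n -[X in X - _](divff (expf_neq0 2 (lt0r_neq0 e0))) -mulrBl; congr (_ / _).
  by rewrite {1}eE; ring.
have kk : - 1 < k < 1.
  rewrite -ltr_norml -(ltr_pXn2r (n := 2)) ?nnegrE// expr1n real_normK ?num_real// -subr_gt0 k1.
  by rewrite exprn_gt0// divr_gt0// mulr_gt0.
have /andP[k2 k3] := kk.
have kin : k \in `[(-1), 1] by rewrite in_itv/= !ltW.
have sgE : sigma = acos k.
  apply: (half_aperture_int_arc (al := al + pi) r10 r20 d0 _ _ _ sR ap).
  - by rewrite acos_gt0 ?acos_ltpi ?k2 ?k3 ?(ltW k2) ?(ltW k3).
  - rewrite cosDpi sinDpi c_al s_al; case: (x1) (x2) @d d0 {al c_al s_al dE k r1d k1 kk k2 k3 kin} => a b [a' b'] d d0 /=.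
    by rewrite !mulrN !(mulrC d) !divfK ?gt_eqF//; congr pair; ring.
  - rewrite acosK// /k (mulrC _ (_ / _)) divfK ?gt_eqF//; ring.
have csg : cos sigma = k by rewrite sgE acosK.
have ssg0 : 0 < sin sigma by apply: sin_gt0_pi.
have ssg : sin sigma = r2 * st / d.
  apply/eqP; rewrite -(eqrXn2 (n := 2))// ?(ltW ssg0)//; last by rewrite ltW// divr_gt0// mulr_gt0.
  by rewrite -k1 -csg sin2cos2.
have ssum : d * sin (sigma + theta) = r1 * st.
  rewrite sinD csg ssg -/st -/ct /k.
  have := dE; move: (d) d0 => e e0 eE.
  have -> : r1 ^+ 2 + e ^+ 2 - r2 ^+ 2 = 2 * r1 * (r1 - r2 * ct) by rewrite eE; ring.
  by field; rewrite !gt_eqF.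
have sum0 : 0 < sin (sigma + theta) by rewrite -(pmulr_rgt0 _ d0) ssum mulr_gt0.
have sumpi : sigma + theta < pi.
  rewrite ltNge; apply/negP => h.
  have : sin (sigma + theta) <= 0.
    rewrite -[sigma + theta](subrK pi) sinDpi oppr_le0; apply: sin_ge0_pi; apply/andP; split; lra.
  by rewrite leNgt sum0.
have dal : x1 = (x2.1 + d * cos al, x2.2 + d * sin al).
  rewrite c_al s_al !(mulrC d) !divfK ?gt_eqF// !(addrC _ (_ - _)) !subrK.
  by case: (x1).
split => //; first by apply/andP; split; lra.
have -> : pi - sigma - theta = - (sigma + theta) + pi by ring.
rewrite cosDpi cosN cosD csg ssg -/st -/ct /k.
have := dE; move: (d) d0 => e e0 eE.
have -> : r1 ^+ 2 + e ^+ 2 - r2 ^+ 2 = 2 * r1 * (r1 - r2 * ct) by rewrite eE; ring.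
have -> : 2 * r2 * e * - (2 * r1 * (r1 - r2 * ct) / (2 * r1 * e) * ct - r2 * st / e * st)
  = - (2 * r2 * (r1 * ct - r2 * (ct ^+ 2 + st ^+ 2))) by field; rewrite !gt_eqF.
rewrite cs eE; ring.
Qed.
End Geometry.

(** * Integral operators with nonnegative kernels *)

(** The integral of a nonnegative function is the supremum over the simple
    functions below it. *)
Lemma le_integral_nonmeas d (T : measurableType d) (R : realType) (mu : {measure set T -> \bar R})
    (D : set T) (f g : T -> \bar R) :
  (forall x, D x -> 0 <= f x)%E -> (forall x, D x -> f x <= g x)%E ->
  (\int[mu]_(x in D) f x <= \int[mu]_(x in D) g x)%E.
Proof.
move=> f0 fg; rewrite !ge0_integralE//; last by move=> x Dx; exact: le_trans (f0 _ Dx) (fg _ Dx).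
apply: ereal_sup_le => _ [h hf <-]; exists h => // x; apply: le_trans (hf x) _.
exact: lee_restrict.
Qed.

Section AmGm.
Context d (Z : measurableType d) (R : realType).
Variables (m : {measure set Z -> \bar R}) (C : R).
Hypothesis C0 : 0 < C.
Local Open Scope ereal_scope.

Lemma measurable_sqre (D : set Z) (v : Z -> \bar R) :
  measurable_fun D v -> measurable_fun D (fun x => v x ^+ 2).
Proof. by move=> mv; under eq_fun do rewrite expe2; exact: emeasurable_funM. Qed.

(** In place of the Cauchy-Schwarz inequality: being linear in the two squares,
    it integrates without a case on whether their integrals are finite. *)
Lemma amgm_ereal (g : R) (v : \bar R) : (0 <= g)%R -> 0 <= v ->
  g%:E * v <= (C / 2 * g ^+ 2)%:E + (2 * C)^-1%:E * v ^+ 2.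
Proof.
move=> g0; case: v => [v| |//]; last first.
  by move=> _; rewrite expe2 mulyy (@gt0_muley _ (2 * C)^-1%:E) ?addey ?leey// lte_fin invr_gt0 mulr_gt0.
rewrite lee_fin => v0; rewrite -EFin_expe -!EFinM -EFinD lee_fin -subr_ge0.
have -> : (C / 2 * g ^+ 2 + (2 * C)^-1 * v ^+ 2 - g * v =
  (2 * C)^-1 * (C * g - v) ^+ 2)%R by field; rewrite gt_eqF.
by rewrite mulr_ge0 ?sqr_ge0// invr_ge0 mulr_ge0// ltW.
Qed.

Lemma integral_amgm (g : Z -> R) (v : Z -> \bar R) :
  measurable_fun setT g -> (forall x, (0 <= g x)%R) ->
  measurable_fun setT v -> (forall x, 0 <= v x) ->
  \int[m]_x ((g x)%:E * v x) <=
  (C / 2)%:E * \int[m]_x (g x ^+ 2)%:E + (2 * C)^-1%:E * \int[m]_x (v x ^+ 2).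
Proof.
move=> mg g0 mv v0.
have mg2 : measurable_fun setT (fun y => (g y ^+ 2)%:E).
  by apply/measurable_EFinP; exact: measurable_funX.
have mv2 := measurable_sqre mv.
have C20 : (0 <= C / 2)%R by rewrite divr_ge0// ltW.
have C2i0 : (0 <= (2 * C)^-1)%R by rewrite invr_ge0 mulr_ge0// ltW.
rewrite -!ge0_integralZl//; last 2 first.
- by move=> y _; rewrite expe_ge0.
- by move=> y _; rewrite lee_fin sqr_ge0.
rewrite -ge0_integralD//; last 4 first.
- by move=> y _; rewrite mule_ge0 ?lee_fin ?sqr_ge0.
- exact: measurable_funeM.
- by move=> y _; rewrite mule_ge0 ?expe_ge0.
- exact: measurable_funeM.
apply: le_integral_nonmeas => y _; first by rewrite mule_ge0// lee_fin.
by rewrite -EFinM; exact: amgm_ereal.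
Qed.

End AmGm.

Section TTstar.
Context d1 d2 (X : measurableType d1) (Y : measurableType d2) (R : realType).
Variables (mu : {sigma_finite_measure set X -> \bar R}).
Variables (nu : {sigma_finite_measure set Y -> \bar R}).
Variables (p : X -> Y -> R) (C : R) (E : set X).
Hypothesis mp : measurable_fun setT (fun z : X * Y => p z.1 z.2).
Hypothesis p0 : forall x y, 0 <= p x y.
Hypothesis C0 : 0 < C.
Local Open Scope ereal_scope.

Lemma measurable_section2 x : measurable_fun setT (p x).
Proof. exact: (measurableT_comp mp (pair1_measurable x)). Qed.

Lemma measurable_section1 y : measurable_fun setT (p^~ y).
Proof. exact: (measurableT_comp mp (pair2_measurable y)). Qed.

(** The square of the norm of T* f is the quadratic form of T T* at f, by
    Tonelli. *)
Lemma adjoint_norm (f : X -> R) : measurable_fun setT f -> (forall x, (0 <= f x)%R) ->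
  \int[nu]_y ((\int[mu]_x (p x y * f x)%:E) ^+ 2) =
  \int[mu]_x \int[mu]_x' ((f x * f x')%:E * \int[nu]_y (p x y * p x' y)%:E).
Proof.
move=> mf f0; pose V y := \int[mu]_x (p x y * f x)%:E.
have pf0 x y : (0 <= p x y * f x)%R by rewrite mulr_ge0.
have mpf : measurable_fun setT (fun z : X * Y => (p z.1 z.2 * f z.1)%:E).
  apply/measurable_EFinP; apply: measurable_funM => //.
  exact: measurableT_comp.
have mV : measurable_fun setT V.
  by apply: (measurable_fun_fubini_tonelli_G (fun z => (p z.1 z.2 * f z.1)%:E)) => // z; rewrite lee_fin.
have V0 y : 0 <= V y by apply: integral_ge0 => x _; rewrite lee_fin.
transitivity (\int[nu]_y \int[mu]_x ((p x y * f x)%:E * V y)).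
  apply: eq_integral => y _; rewrite expe2 -/(V y) ge0_integralZr//.
  - by apply/measurable_EFinP; apply: measurable_funM => //; exact: measurable_section1.
  - by move=> x _; rewrite lee_fin.
rewrite -(@fubini_tonelli _ _ _ _ _ mu nu (fun z => (p z.1 z.2 * f z.1)%:E * V z.2)); last 2 first.
- by apply: emeasurable_funM => //; exact: measurableT_comp.
- by move=> z; rewrite mule_ge0// lee_fin.
apply: eq_integral => x _ /=.
transitivity (\int[nu]_y \int[mu]_x' (p x y * f x * (p x' y * f x'))%:E).
  apply: eq_integral => y _; rewrite -ge0_integralZl//.
  - by apply/measurable_EFinP; apply: measurable_funM => //; exact: measurable_section1.
  - by move=> x' _; rewrite lee_fin.
  - by rewrite lee_fin.
rewrite -(@fubini_tonelli _ _ _ _ _ mu nu (fun z => (p x z.2 * f x * (p z.1 z.2 * f z.1))%:E)); last 2 first.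
- apply/measurable_EFinP; apply: measurable_funM; last exact/measurable_EFinP.
  by apply: measurable_funM => //; apply: (measurableT_comp (measurable_section2 x)).
- by move=> z; rewrite lee_fin mulr_ge0.
apply: eq_integral => x' _ /=; rewrite -ge0_integralZl//.
- by apply: eq_integral => y _; rewrite -EFinM; congr (_%:E); ring.
- by apply/measurable_EFinP; apply: measurable_funM => //; exact: measurable_section2.
- by move=> y _; rewrite lee_fin mulr_ge0.
- by rewrite lee_fin mulr_ge0.
Qed.

Lemma kernel_duality (f : X -> R) (G : Y -> R) :
  measurable_fun setT f -> (forall x, (0 <= f x)%R) ->
  measurable_fun setT G -> (forall y, (0 <= G y)%R) ->
  \int[mu]_x ((f x)%:E * \int[nu]_y (p x y * G y)%:E) =
  \int[nu]_y ((G y)%:E * \int[mu]_x (p x y * f x)%:E).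
Proof.
move=> mf f0 mG G0.
transitivity (\int[mu]_x \int[nu]_y (f x * (p x y * G y))%:E).
  apply: eq_integral => x _; rewrite -ge0_integralZl//.
  - by apply/measurable_EFinP; apply: measurable_funM => //; exact: measurable_section2.
  - by move=> y _; rewrite lee_fin mulr_ge0.
  - by rewrite lee_fin.
rewrite (@fubini_tonelli _ _ _ _ _ mu nu (fun z => (f z.1 * (p z.1 z.2 * G z.2))%:E)); last 2 first.
- apply/measurable_EFinP; apply: measurable_funM; first exact: measurableT_comp.
  by apply: measurable_funM => //; exact: measurableT_comp.
- by move=> z; rewrite lee_fin !mulr_ge0.
apply: eq_integral => y _ /=; rewrite -ge0_integralZl//.
- by apply: eq_integral => x _; rewrite -EFinM; congr (_%:E); ring.
- by apply/measurable_EFinP; apply: measurable_funM => //; exact: measurable_section1.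
- by move=> x _; rewrite lee_fin mulr_ge0.
- by rewrite lee_fin.
Qed.

(** With h = T* f one has <h, h> = <f, T h>. *)
Lemma TTstar_dual (f : X -> R) (h : Y -> R) :
  measurable_fun setT f -> (forall x, (0 <= f x)%R) ->
  measurable_fun setT h -> (forall y, (0 <= h y)%R) ->
  (forall y, \int[mu]_x (p x y * f x)%:E = (h y)%:E) ->
  \int[nu]_y (h y ^+ 2)%:E <= (C / 2)%:E * \int[mu]_x (f x ^+ 2)%:E +
    (2 * C)^-1%:E * \int[mu]_x ((\int[nu]_y (p x y * h y)%:E) ^+ 2).
Proof.
move=> mf f0 mh h0 hE; pose V x := \int[nu]_y (p x y * h y)%:E.
have ph0 x y : (0 <= p x y * h y)%R by rewrite mulr_ge0.
have mph : measurable_fun setT (fun z : X * Y => (p z.1 z.2 * h z.2)%:E).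
  by apply/measurable_EFinP; apply: measurable_funM => //; exact: measurableT_comp.
have mV : measurable_fun setT V.
  by apply: (measurable_fun_fubini_tonelli_F (fun z => (p z.1 z.2 * h z.2)%:E)) => // z; rewrite lee_fin.
have V0 x : 0 <= V x by apply: integral_ge0 => y _; rewrite lee_fin.
have -> : \int[nu]_y (h y ^+ 2)%:E = \int[mu]_x ((f x)%:E * V x).
  rewrite (kernel_duality mf f0 mh h0).
  by apply: eq_integral => y _; rewrite hE -EFinM expr2.
exact: integral_amgm.
Qed.

Hypothesis mE : measurable E.
Hypothesis muE : mu E < +oo.
Hypothesis pE : forall x y, ~ E x -> p x y = 0%R.
Hypothesis form_le : forall f : X -> R, measurable_fun setT f -> (forall x, (0 <= f x)%R) ->
  \int[mu]_x \int[mu]_x' ((f x * f x')%:E * \int[nu]_y (p x y * p x' y)%:E) <=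
  C%:E * \int[mu]_x (f x ^+ 2)%:E.

(** Let U = T G and let f be the truncation of U at height n, which is square
    integrable. Then <f, f> <= <f, T G> = <T* f, G>, and the square of the norm
    of T* f is at most C times that of f, so that <f, f> <= C <G, G>. Now let n
    tend to infinity. *)
Lemma TTstar_bound (G : Y -> R) : measurable_fun setT G -> (forall y, (0 <= G y)%R) ->
  \int[mu]_x ((\int[nu]_y (p x y * G y)%:E) ^+ 2) <= C%:E * \int[nu]_y (G y ^+ 2)%:E.
Proof.
move=> mG G0; pose U x := \int[nu]_y (p x y * G y)%:E.
have mpG : measurable_fun setT (fun z : X * Y => (p z.1 z.2 * G z.2)%:E).
  by apply/measurable_EFinP; apply: measurable_funM => //; exact: measurableT_comp.
have mU : measurable_fun setT U.
  by apply: (measurable_fun_fubini_tonelli_F (fun z => (p z.1 z.2 * G z.2)%:E)) => // z; rewrite lee_fin mulr_ge0.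
have U0 x : 0 <= U x by apply: integral_ge0 => y _; rewrite lee_fin mulr_ge0.
have [Goo|Gfin] := eqVneq (\int[nu]_y (G y ^+ 2)%:E) +oo.
  by rewrite Goo gt0_muley ?leey// lte_fin.
(* The hypothesis on E makes the truncations square integrable. *)
pose f n x := fine (mine (U x) n%:R%:E).
have fE n x : (f n x)%:E = mine (U x) n%:R%:E.
  rewrite /f fineK// ge0_fin_numE; last by rewrite le_min U0 lee_fin ler0n.
  by rewrite gt_min ltry orbT.
have f0 n x : (0 <= f n x)%R by rewrite -lee_fin fE le_min U0 lee_fin ler0n.
have fn n x : (f n x <= n%:R)%R by rewrite -lee_fin fE ge_min lexx orbT.
have fU n x : (f n x)%:E <= U x by rewrite fE ge_min lexx.
have fEc n x : ~ E x -> f n x = 0%R.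
  move=> Ex; apply/eqP; rewrite eq_le f0 andbT -lee_fin (le_trans (fU n x))//.
  by rewrite /U integral0_eq// => y _; rewrite pE// mul0r.
have mf n : measurable_fun setT (f n).
  apply/measurable_EFinP; rewrite (_ : EFin \o f n = fun x => mine (U x) n%:R%:E).
    exact: measurable_mine.
  by apply/funext => x /=; rewrite fE.
have mf2 n : measurable_fun setT (fun x => (f n x ^+ 2)%:E).
  by apply/measurable_EFinP; exact: measurable_funX.
have ffin n : \int[mu]_x (f n x ^+ 2)%:E < +oo.
  apply: (@le_lt_trans _ _ (\int[mu]_x ((n%:R ^+ 2)%:E * (\1_E x)%:E))).
    apply: le_integral_nonmeas => x _; first by rewrite lee_fin sqr_ge0.
    rewrite -EFinM lee_fin indicE; case: (boolP (x \in E)) => [_|/negP].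
      by rewrite mulr1 lerXn2r ?nnegrE.
    by rewrite inE => /fEc ->; rewrite mulr0 expr0n.
  rewrite ge0_integralZl//;
    try by [apply/measurable_EFinP; exact: measurable_indic|rewrite lee_fin sqr_ge0].
  by rewrite integral_indic// setIT lte_mul_pinfty// lee_fin sqr_ge0.
have key n : \int[mu]_x (f n x ^+ 2)%:E <= C%:E * \int[nu]_y (G y ^+ 2)%:E.
  pose V y := \int[mu]_x (p x y * f n x)%:E.
  have mpf : measurable_fun setT (fun z : X * Y => (p z.1 z.2 * f n z.1)%:E).
    by apply/measurable_EFinP; apply: measurable_funM => //; exact: measurableT_comp.
  have mV : measurable_fun setT V.
    by apply: (measurable_fun_fubini_tonelli_G (fun z => (p z.1 z.2 * f n z.1)%:E)) => // z; rewrite lee_fin mulr_ge0.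
  have V0 y : 0 <= V y by apply: integral_ge0 => x _; rewrite lee_fin mulr_ge0.
  have step1 : \int[mu]_x (f n x ^+ 2)%:E <= \int[nu]_y ((G y)%:E * V y).
    apply: (@le_trans _ _ (\int[mu]_x ((f n x)%:E * U x))).
      apply: le_integral_nonmeas => x _; first by rewrite lee_fin sqr_ge0.
      by rewrite expr2 EFinM lee_pmul// lee_fin.
    by rewrite kernel_duality.
  have step2 := integral_amgm nu C0 mG G0 mV V0.
  have step3 : \int[nu]_y (V y ^+ 2) <= C%:E * \int[mu]_x (f n x ^+ 2)%:E.
    by rewrite adjoint_norm//; exact: form_le.
  have := le_trans step1 (le_trans step2 (leeD2l _ (lee_wpmul2l _ step3))).
  have C2i0 : 0 <= (2 * C)^-1%:E by rewrite lee_fin invr_ge0 mulr_ge0// ltW.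
  move=> /(_ C2i0).
  have ffn : \int[mu]_x (f n x ^+ 2)%:E \is a fin_num.
    by rewrite ge0_fin_numE ?ffin//; apply: integral_ge0 => x _; rewrite lee_fin sqr_ge0.
  have Gfn : \int[nu]_y (G y ^+ 2)%:E \is a fin_num.
    rewrite ge0_fin_numE ?ltey//; apply: integral_ge0 => y _; rewrite lee_fin sqr_ge0//.
  rewrite -(fineK ffn) -(fineK Gfn) -!EFinM -EFinD !lee_fin.
  set a := fine (\int[mu]_x _); set b := fine (\int[nu]_y _).
  have -> : ((2 * C)^-1 * (C * a) = a / 2)%R by field; rewrite gt_eqF.
  by lra.
have fnd x : {homo (fun n => (f n x ^+ 2)%:E) : m n / (m <= n)%N >-> m <= n}.
  move=> m n mn; rewrite lee_fin lerXn2r ?nnegrE// -lee_fin !fE le_min.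
  by rewrite ge_min lexx/= ge_min lee_fin ler_nat mn orbT.
have fcvg x : (fun n => (f n x ^+ 2)%:E) @ \oo --> U x ^+ 2.
  have := U0 x; case Ux : (U x) => [u| |//]; rewrite ?lee_fin => u0.
    apply: cvg_near_cst; near=> n.
    have un : (u <= n%:R)%R by near: n; exact: nbhs_infty_ger.
    by rewrite EFin_expe fE Ux -EFin_min min_l.
  rewrite expe2 mulyy; apply/cvgeryP.
  rewrite (_ : (fun n => _) = fun n => (n%:R ^+ 2 : R)%R).
    apply: (@ger_cvgy _ _ _ _ (fun n => n%:R : R)%R); last exact: cvgr_idn.
    by apply: nearW => -[|n]; rewrite ?expr0n//= expr2 ler_peMr// ler1n.
  by apply/funext => n; congr (_ ^+ 2)%R; apply: EFin_inj; rewrite fE Ux min_r ?leey.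
have -> : \int[mu]_x ((\int[nu]_y (p x y * G y)%:E) ^+ 2) =
    \int[mu]_x (limn (fun n => (f n x ^+ 2)%:E)).
  by apply: eq_integral => x _; apply/esym/cvg_lim => //; exact: fcvg.
rewrite monotone_convergence//; last by move=> n x _; rewrite lee_fin sqr_ge0.
apply: lime_le; last by apply: nearW => n; exact: key.
apply: ereal_nondecreasing_is_cvgn => m n mn; apply: le_integral_nonmeas => x _.
  by rewrite lee_fin sqr_ge0.
exact: fnd.
Unshelve. all: by end_near. Qed.

End TTstar.

Section Schur.
Context d1 (X : measurableType d1) (R : realType).
Variables (mu : {sigma_finite_measure set X -> \bar R}).
Variables (K : X -> X -> R) (w : X -> R).
Hypothesis mK : measurable_fun setT (fun z : X * X => K z.1 z.2).
Hypothesis mw : measurable_fun setT w.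
Hypothesis mwi : measurable_fun setT (fun x => (w x)^-1).
Hypothesis K0 : forall x y, 0 <= K x y.
Hypothesis Ksym : forall x y, K x y = K y x.
Hypothesis w0 : forall x, 0 < w x.
Local Open Scope ereal_scope.
Hypothesis Kw : forall x, \int[mu]_y (K x y * w y)%:E <= (w x)%:E.

(** Schur's test: f x * f y is at most half of f x ^ 2 * w y / w x plus f y ^ 2
    * w x / w y, and both terms integrate to the same bound. *)
Lemma schur_test (f : X -> R) : measurable_fun setT f -> (forall x, (0 <= f x)%R) ->
  \int[mu]_x \int[mu]_y (f x * f y * K x y)%:E <= \int[mu]_x (f x ^+ 2)%:E.
Proof.
move=> mf f0.
have w0' x : (0 <= w x)%R by exact: ltW.
have wi0 x : (0 <= (w x)^-1)%R by rewrite invr_ge0.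
pose A z : \bar R := (2^-1 * (f z.1 ^+ 2 / w z.1 * (K z.1 z.2 * w z.2)))%:E.
pose B z : \bar R := (2^-1 * (f z.2 ^+ 2 / w z.2 * (K z.1 z.2 * w z.1)))%:E.
have A0 z : 0 <= A z by rewrite lee_fin !mulr_ge0 ?sqr_ge0.
have B0 z : 0 <= B z by rewrite lee_fin !mulr_ge0 ?sqr_ge0.
have mA : measurable_fun setT A.
  apply/measurable_EFinP; apply: measurable_funM => //; apply: measurable_funM.
    apply: measurable_funM; last exact: (measurableT_comp mwi).
    by apply: measurable_funX; exact: measurableT_comp.
  by apply: measurable_funM => //; exact: measurableT_comp.
have mB : measurable_fun setT B.
  apply/measurable_EFinP; apply: measurable_funM => //; apply: measurable_funM.
    apply: measurable_funM; last exact: (measurableT_comp mwi).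
    by apply: measurable_funX; exact: measurableT_comp.
  by apply: measurable_funM => //; exact: measurableT_comp.
have mAx x : measurable_fun setT (fun y => A (x, y)) by exact: (measurableT_comp mA (pair1_measurable x)).
have mBx x : measurable_fun setT (fun y => B (x, y)) by exact: (measurableT_comp mB (pair1_measurable x)).
have AE x : \int[mu]_y A (x, y) <= (2^-1)%:E * (f x ^+ 2)%:E.
  have -> : \int[mu]_y A (x, y) =
     \int[mu]_y ((2^-1 * (f x ^+ 2 / w x))%:E * (K x y * w y)%:E).
    by apply: eq_integral => y _; rewrite /A/= -EFinM; congr (_%:E); ring.
  rewrite ge0_integralZl//; last 3 first.
  - apply/measurable_EFinP; apply: measurable_funM => //.
    exact: (measurableT_comp mK (pair1_measurable x)).
  - by move=> y _; rewrite lee_fin mulr_ge0.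
  - by rewrite lee_fin !mulr_ge0// sqr_ge0.
  apply: (@le_trans _ _ ((2^-1 * (f x ^+ 2 / w x))%:E * (w x)%:E)).
    by rewrite lee_wpmul2l// lee_fin !mulr_ge0// sqr_ge0.
  by rewrite -!EFinM lee_fin -!mulrA mulVf ?gt_eqF// mulr1.
have int_le (F : X -> \bar R) : (forall x, 0 <= F x) -> (forall x, F x <= (2^-1)%:E * (f x ^+ 2)%:E) ->
    \int[mu]_x F x <= (2^-1)%:E * \int[mu]_x (f x ^+ 2)%:E.
  move=> F0 Fle; rewrite -ge0_integralZl//; last 2 first.
  - by apply/measurable_EFinP; exact: measurable_funX.
  - by move=> x _; rewrite lee_fin sqr_ge0.
  exact: le_integral_nonmeas.
apply: (@le_trans _ _ (\int[mu]_x \int[mu]_y (A (x, y) + B (x, y)))).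
  have fK0 x y : 0 <= (f x * f y * K x y)%:E by rewrite lee_fin !mulr_ge0.
  apply: le_integral_nonmeas => x _; first by apply: integral_ge0.
  apply: le_integral_nonmeas => y _ //.
  rewrite /A /B/= -EFinD lee_fin -subr_ge0.
  have -> : (2^-1 * (f x ^+ 2 / w x * (K x y * w y)) +
     2^-1 * (f y ^+ 2 / w y * (K x y * w x)) - f x * f y * K x y =
     2^-1 * (K x y / (w x * w y)) * (f x * w y - f y * w x) ^+ 2)%R.
    by field; rewrite !gt_eqF.
  apply: mulr_ge0; last exact: sqr_ge0.
  by apply: mulr_ge0; [rewrite invr_ge0|apply: divr_ge0 => //; exact: mulr_ge0].
under eq_integral do rewrite ge0_integralD//.
rewrite ge0_integralD//; last 4 first.
- by move=> x _; apply: integral_ge0.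
- exact: measurable_fun_fubini_tonelli_F.
- by move=> x _; apply: integral_ge0.
- exact: measurable_fun_fubini_tonelli_F.
rewrite (@fubini_tonelli _ _ _ _ _ mu mu B)//.
have -> : \int[mu]_x (f x ^+ 2)%:E =
    (2^-1)%:E * \int[mu]_x (f x ^+ 2)%:E + (2^-1)%:E * \int[mu]_x (f x ^+ 2)%:E.
  rewrite -ge0_muleDl ?lee_fin ?invr_ge0// -EFinD (_ : _ + _ = 1)%R ?mul1e//; lra.
apply: leeD; apply: int_le => //; [by move=> x; apply: integral_ge0..|].
move=> y; apply: le_trans (AE y); rewrite le_eqVlt; apply/orP; left; apply/eqP.
by apply: eq_integral => x _; rewrite /A /B/= Ksym.
Qed.

End Schur.

(** * Poisson integrals on the unit circle *)

Section Calculus.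
Context {R : realType}.
Local Notation plane := (R * R)%type.
Local Notation leb := (@lebesgue_measure R).
Implicit Types (f g F : R -> R) (x a b : R).

Lemma derC c x : is_derive x (1 : R) (fun _ => c : R) 0.
Proof. exact: is_derive_cst. Qed.

Lemma derD f g x a b : is_derive x 1 f a -> is_derive x 1 g b ->
  is_derive x 1 (fun t => f t + g t) (a + b).
Proof. by move=> df dg; exact: is_deriveD. Qed.

Lemma derN f x a : is_derive x 1 f a -> is_derive x 1 (fun t => - f t) (- a).
Proof. by move=> df; exact: is_deriveN. Qed.

Lemma derM f g x a b : is_derive x 1 f a -> is_derive x 1 g b ->
  is_derive x 1 (fun t => f t * g t) (f x * b + g x * a).
Proof. by move=> df dg; exact: is_deriveM. Qed.

Lemma derX2 f x a : is_derive x 1 f a ->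
  is_derive x 1 (fun t => f t ^+ 2) (2 * f x * a).
Proof.
move=> df; have := derM df df; rewrite (_ : (fun t => _) = (fun t => f t ^+ 2)).
  by move=> h; apply: is_derive_eq; rewrite -mulr2n; ring.
by apply/funext => t; rewrite expr2.
Qed.

Lemma derComp F f x a b : is_derive (f x) 1 F b -> is_derive x 1 f a ->
  is_derive x 1 (fun t => F (f t)) (b * a).
Proof. by move=> dF df; exact: is_derive1_comp. Qed.

Lemma derV f x a : is_derive x 1 f a -> f x != 0 ->
  is_derive x 1 (fun t => (f t)^-1) (- f x ^- 2 * a).
Proof. by move=> df f0; exact: is_deriveV. Qed.

Lemma derCos f x a : is_derive x 1 f a -> is_derive x 1 (fun t => cos (f t)) (- sin (f x) * a).
Proof. by eapply derComp; exact: is_derive_cos. Qed.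

Lemma derSin f x a : is_derive x 1 f a -> is_derive x 1 (fun t => sin (f t)) (cos (f x) * a).
Proof. by eapply derComp; exact: is_derive_sin. Qed.

Lemma derAtan f x a : is_derive x 1 f a -> is_derive x 1 (fun t => atan (f t)) ((1 + f x ^+ 2)^-1 * a).
Proof. by eapply derComp; exact: is_derive1_atan. Qed.

Lemma derLn f x a : is_derive x 1 f a -> 0 < f x -> is_derive x 1 (fun t => ln (f t)) ((f x)^-1 * a).
Proof. by move=> df f0; eapply derComp => //; exact: is_derive1_ln. Qed.

Lemma derSqrt f x a : is_derive x 1 f a -> 0 < f x ->
  is_derive x 1 (fun t => Num.sqrt (f t)) ((2 * Num.sqrt (f x))^-1 * a).
Proof. by move=> df f0; eapply derComp => //; exact: is_derive1_sqrt. Qed.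

Lemma der_eq f x a b : is_derive x 1 f a -> a = b -> is_derive x 1 f b.
Proof. by move=> df <-. Qed.

(** Differentiability of the integrand, which the rules above provide, stands in
    for its continuity. *)
Lemma FTC F f a b : a < b ->
  (forall x, a <= x <= b -> is_derive x 1 F (f x)) ->
  (forall x, a <= x <= b -> exists d, is_derive x 1 f d) ->
  (\int[leb]_(x in `[a, b]) (f x)%:E = (F b - F a)%:E)%E.
Proof.
move=> ab dF df; rewrite EFinB; apply: continuous_FTC2 => //.
- apply: derivable_within_continuous => x; rewrite in_itv/= => /df[d [? _]] //.
- have cont x : a <= x <= b -> {for x, continuous F}.
    by move=> /dF[dx _]; apply/differentiable_continuous/derivable1_diffP.
  split.
  + move=> x; rewrite in_itv/= => /andP[ax xb].
    by have [|? _ //] := dF x; rewrite !ltW.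
  + by apply: cvg_at_right_filter; apply: cont; rewrite lexx ltW.
  + by apply: cvg_at_left_filter; apply: cont; rewrite lexx ltW.
move=> x; rewrite in_itv/= => /andP[ax xb]; rewrite derive1E.
by have [|_ -> //] := dF x; rewrite !ltW.
Qed.

Lemma FTC_co F f a b : a < b ->
  (forall x, a <= x <= b -> is_derive x 1 F (f x)) ->
  (forall x, a <= x <= b -> exists d, is_derive x 1 f d) ->
  (\int[leb]_(x in `[a, b[) (f x)%:E = (F b - F a)%:E)%E.
Proof.
move=> ab dF df; rewrite -(FTC ab dF df) integral_itv_bndo_bndc//.
apply/measurable_EFinP; apply: subspace_continuous_measurable_fun => //.
by apply: derivable_within_continuous => x; rewrite in_itv/= => /andP[ax xb]; have [|d []] := df x; rewrite // ax ltW.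
Qed.

End Calculus.

Section PoissonIntegrals.
Context {R : realType}.
Local Notation plane := (R * R)%type.
Local Notation leb := (@lebesgue_measure R).
Implicit Types (z w : plane) (s : R).

Definition nrm2 z : R := z.1 ^+ 2 + z.2 ^+ 2.
Definition dotp z w : R := z.1 * w.1 + z.2 * w.2.
(** The squared distance from z to the point of angle s on the unit circle. *)
Definition chord2 z s : R := 1 + nrm2 z - 2 * (z.1 * cos s + z.2 * sin s).

Lemma chord2E z s :
  chord2 z s = (1 - (z.1 * cos s + z.2 * sin s)) ^+ 2 + (z.1 * sin s - z.2 * cos s) ^+ 2.
Proof.
rewrite /chord2 /nrm2; have := cos2Dsin2 s; move: (cos s) (sin s) => c t h.
have -> : 1 + (z.1 ^+ 2 + z.2 ^+ 2) - 2 * (z.1 * c + z.2 * t) =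
  1 + (z.1 ^+ 2 + z.2 ^+ 2) * 1 - 2 * (z.1 * c + z.2 * t) by ring.
by rewrite -{2}h; ring.
Qed.

Lemma chord2_pole z s : nrm2 z < 1 -> z.1 * cos s + z.2 * sin s < 1.
Proof.
rewrite /nrm2; have := cos2Dsin2 s; move: (cos s) (sin s) z.1 z.2 => c t a b h1 h2.
have := sqr_ge0 (a - c); have := sqr_ge0 (b - t); nra.
Qed.

Lemma chord2_gt0 z s : nrm2 z < 1 -> 0 < chord2 z s.
Proof.
move=> z1; rewrite chord2E ltr_pwDl ?sqr_ge0// exprn_gt0// subr_gt0.
exact: chord2_pole.
Qed.

Lemma chord2_neq0 z s : nrm2 z < 1 -> chord2 z s != 0.
Proof. by move=> /chord2_gt0 => /(_ s) /lt0r_neq0. Qed.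

(** A primitive of the Poisson kernel: the angle s plus twice the argument of 1
    - z e^(-is), whose real part is positive. *)
Definition argF z s : R :=
  s + 2 * atan ((z.1 * sin s - z.2 * cos s) / (1 - (z.1 * cos s + z.2 * sin s))).

Lemma is_derive_argF z s : nrm2 z < 1 ->
  is_derive s 1 (argF z) ((1 - nrm2 z) / chord2 z s).
Proof.
move=> z1; have A1 := chord2_pole s z1; have Q0 := chord2_neq0 s z1.
have A0 : 1 - (z.1 * cos s + z.2 * sin s) != 0 by rewrite lt0r_neq0// subr_gt0.
rewrite /argF; apply: is_derive_eq; rewrite /GRing.scale/=.
have hz : nrm2 z = (z.1 * cos s + z.2 * sin s) ^+ 2 + (z.1 * sin s - z.2 * cos s) ^+ 2.
  transitivity (nrm2 z * (cos s ^+ 2 + sin s ^+ 2)); first by rewrite cos2Dsin2 mulr1.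
  by rewrite /nrm2; ring.
move: Q0; rewrite chord2E hz.
have -> : z.1 * - sin s + z.2 * cos s = - (z.1 * sin s - z.2 * cos s) by ring.
have -> : z.1 * cos s - z.2 * - sin s = z.1 * cos s + z.2 * sin s by ring.
move: A0; set A := z.1 * cos s + z.2 * sin s; set B := z.1 * sin s - z.2 * cos s => A0 Q0.
by field; rewrite A0 Q0.
Qed.

Lemma derivable_chord2 z s :
  is_derive s 1 (chord2 z) (2 * (z.1 * sin s - z.2 * cos s)).
Proof. by rewrite /chord2; apply: is_derive_eq; rewrite /GRing.scale/=; ring. Qed.

Lemma argF_period z : argF z pi - argF z (- pi) = 2 * pi.
Proof. by rewrite /argF cosN sinN sinpi oppr0; ring. Qed.

Lemma chord2_period z : chord2 z (- pi) = chord2 z pi.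
Proof. by rewrite /chord2 cosN sinN sinpi oppr0. Qed.

(** The value at z of the harmonic function with the boundary values (1 - |w|^2)
    / |e^(is) - w|^2, namely (1 - |z|^2 |w|^2) / |1 - z w'|^2 where w' is the
    conjugate of w. *)
Definition poissonPP z w : R :=
  (1 - nrm2 z * nrm2 w) / (1 - 2 * dotp z w + nrm2 z * nrm2 w).

Lemma dotp_le z w : 2 * dotp z w <= nrm2 z + nrm2 w.
Proof.
rewrite -subr_ge0 (_ : _ - _ = (z.1 - w.1) ^+ 2 + (z.2 - w.2) ^+ 2).
  by rewrite addr_ge0// sqr_ge0.
by rewrite /nrm2 /dotp; ring.
Qed.

Lemma poissonPP_den z w : nrm2 z < 1 -> nrm2 w < 1 ->
  0 < 1 - 2 * dotp z w + nrm2 z * nrm2 w.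
Proof.
move=> z1 w1; have := dotp_le z w; have : 0 < (1 - nrm2 z) * (1 - nrm2 w).
  by rewrite mulr_gt0// subr_gt0.
nra.
Qed.

(** Partial fractions: for z <> w the inverse of the product of the two squared
    chords is a combination of the two Poisson kernels and of the logarithmic
    derivatives of the two chords. For z = w the logarithms degenerate to the
    quotient B / chord2. *)
Lemma integral_chord2_chord2 z w : nrm2 z < 1 -> nrm2 w < 1 ->
  (\int[leb]_(s in `[(- pi)%R, (pi : R)[) ((chord2 z s * chord2 w s)^-1)%:E =
   (2 * pi * (poissonPP z w / ((1 - nrm2 z) * (1 - nrm2 w))))%:E)%E.
Proof.
move=> z1 w1.
have dz s : is_derive s 1 (chord2 z) _ := derivable_chord2 z s.
have dw s : is_derive s 1 (chord2 w) _ := derivable_chord2 w s.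
have Qz s := chord2_neq0 s z1; have Qw s := chord2_neq0 s w1.
have Qz0 s := chord2_gt0 s z1; have Qw0 s := chord2_gt0 s w1.
have pz : 1 - nrm2 z != 0 by rewrite lt0r_neq0// subr_gt0.
have pw : 1 - nrm2 w != 0 by rewrite lt0r_neq0// subr_gt0.
have den0 : 1 - 2 * dotp z w + nrm2 z * nrm2 w != 0 by exact/lt0r_neq0/poissonPP_den.
have pi2 : - pi < pi :> R by have := @pi_gt0 R; lra.
have dint s : exists d, is_derive s 1 (fun s => (chord2 z s * chord2 w s)^-1) d.
  eexists; eapply derV; first by eapply derM; [exact: dz|exact: dw].
  by rewrite mulf_neq0.
have [zw|zw] := eqVneq (nrm2 z + nrm2 w - 2 * dotp z w) 0.
  have zE : z = w.
    have : (z.1 - w.1) ^+ 2 + (z.2 - w.2) ^+ 2 = 0 by rewrite -zw /nrm2 /dotp; ring.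
    move/eqP; rewrite paddr_eq0 ?sqr_ge0// !sqrf_eq0 !subr_eq0 => /andP[/eqP h1 /eqP h2].
    by case: z w h1 h2 {z1 w1 dz dw Qz Qw Qz0 Qw0 pz pw den0 dint zw} => [? ?] [? ?] /= -> ->.
  move: dint; rewrite -{w w1 dw Qw Qw0 pw den0 zw}zE => dint.
  pose B s := z.1 * sin s - z.2 * cos s.
  pose F s := (1 - nrm2 z) ^- 2 * (2 * (B s / chord2 z s) + (1 + nrm2 z) / (1 - nrm2 z) * argF z s).
  suff dF : forall s, - pi <= s <= pi -> is_derive s 1 F (chord2 z s * chord2 z s)^-1.
    rewrite (FTC_co pi2 dF)//.
    congr (_%:E); rewrite /F /B chord2_period cosN sinN sinpi oppr0.
    rewrite (_ : argF z (- pi) = argF z pi - 2 * pi); last by rewrite -(argF_period z); ring.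
    rewrite /poissonPP; have -> : dotp z z = nrm2 z by rewrite /dotp /nrm2 !expr2.
    field; apply/andP; split => //.
    have -> : 1 - 2 * nrm2 z + nrm2 z * nrm2 z = (1 - nrm2 z) ^+ 2 by ring.
    by rewrite sqrf_eq0 pz Qz.
  move=> s _; have dF := is_derive_argF s z1.
  have dB : is_derive s 1 B (z.1 * cos s + z.2 * sin s).
    by rewrite /B; apply: is_derive_eq; rewrite /GRing.scale/=; ring.
  apply: is_derive_eq; rewrite /GRing.scale/=.
  have hz : B s ^+ 2 = nrm2 z - (z.1 * cos s + z.2 * sin s) ^+ 2.
    transitivity (nrm2 z * (cos s ^+ 2 + sin s ^+ 2) - (z.1 * cos s + z.2 * sin s) ^+ 2); last by rewrite cos2Dsin2 mulr1.
    by rewrite /nrm2 /B; ring.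
  have hA : z.1 * cos s + z.2 * sin s = (1 + nrm2 z - chord2 z s) / 2.
    by rewrite /chord2; field.
  rewrite -/(B s); move: hz (Qz s); rewrite hA; move: (chord2 z s) (nrm2 z) pz (B s) => Q p pz b hb Q0.
  have -> : b * (- Q ^- 2 * (2 * b)) = - 2 * (b ^+ 2) * Q ^- 2 by ring.
  by rewrite hb; field; rewrite Q0.
pose p := nrm2 z; pose q := nrm2 w; pose m := dotp z w.
pose n := z.1 * w.2 - z.2 * w.1.
pose D := p + q - 2 * m; pose Dd := 1 - 2 * m + p * q.
have nE : n ^+ 2 = p * q - m ^+ 2 by rewrite /n /p /q /m /nrm2 /dotp; ring.
(* The coefficients are determined by the identity key below. *)
pose al := ((1 + q) * p - (1 + p) * m) / (D * Dd).
pose al' := ((1 + p) * q - (1 + q) * m) / (D * Dd).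
pose be := 2 * n / (D * Dd).
pose F s := al / (1 - p) * argF z s + be / 2 * ln (chord2 z s)
          + (al' / (1 - q) * argF w s - be / 2 * ln (chord2 w s)).
suff dF : forall s, - pi <= s <= pi -> is_derive s 1 F (chord2 z s * chord2 w s)^-1.
  rewrite (FTC_co pi2 dF)//.
  congr (_%:E); rewrite /F !chord2_period.
  rewrite (_ : argF z (- pi) = argF z pi - 2 * pi); last by rewrite -(argF_period z); ring.
  rewrite (_ : argF w (- pi) = argF w pi - 2 * pi); last by rewrite -(argF_period w); ring.
  rewrite /poissonPP /al /al' /be -/p -/q -/m.
  by move: zw den0 pz pw; rewrite /D /Dd -/p -/q -/m => zw den0 pz pw; field; rewrite zw den0 pz pw.
move=> s _; have dFz := is_derive_argF s z1; have dFw := is_derive_argF s w1.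
have dlz := derLn (dz s) (Qz0 s); have dlw := derLn (dw s) (Qw0 s).
apply: der_eq (derD (derD (derM (derC (al / (1 - p)) s) dFz) (derM (derC (be / 2) s) dlz))
  (derD (derM (derC (al' / (1 - q)) s) dFw) (derN (derM (derC (be / 2) s) dlw)))) _.
rewrite !mulr0 !addr0 -/p -/q.

set Bz := z.1 * sin s - z.2 * cos s; set Bw := w.1 * sin s - w.2 * cos s.
have key : (al + be * Bz) * chord2 w s + (al' - be * Bw) * chord2 z s = 1.
  have -> : (al + be * Bz) * chord2 w s + (al' - be * Bw) * chord2 z s =
    (((1 + q) * p - (1 + p) * m + 2 * n * Bz) * chord2 w s +
     ((1 + p) * q - (1 + q) * m - 2 * n * Bw) * chord2 z s) / (D * Dd).
    by rewrite /al /al' /be; field; apply/andP.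
  rewrite -[RHS](@divff _ (D * Dd)); last exact: mulf_neq0.
  congr (_ / _).
  pose Az := z.1 * cos s + z.2 * sin s; pose Aw := w.1 * cos s + w.2 * sin s.
  have e1 : n * Bz = p * Aw - m * Az.
    by rewrite /n /Bz /p /Aw /m /Az /nrm2 /dotp; ring.
  have e2 : n * Bw = m * Aw - q * Az.
    by rewrite /n /Bw /q /Aw /m /Az /nrm2 /dotp; ring.
  have e3 : Bz * Aw - Bw * Az = n.
    transitivity (n * (cos s ^+ 2 + sin s ^+ 2)); last by rewrite cos2Dsin2 mulr1.
    by rewrite /n /Bz /Bw /Aw /Az; ring.
  have -> : chord2 w s = 1 + q - 2 * Aw by [].
  have -> : chord2 z s = 1 + p - 2 * Az by [].
  transitivity (((1 + q) * p - (1 + p) * m) * (1 + q - 2 * Aw) +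
     ((1 + p) * q - (1 + q) * m) * (1 + p - 2 * Az) +
     2 * (1 + q) * (n * Bz) - 2 * (1 + p) * (n * Bw) - 4 * n * (Bz * Aw - Bw * Az)).
    by ring.
  rewrite e3 e1 e2 (_ : 4 * n * n = 4 * (p * q - m ^+ 2)); first by rewrite /D /Dd; ring.
  by rewrite -nE; ring.
move: key (Qz s) (Qw s) pz pw; rewrite -/p -/q.
move: (chord2 z s) (chord2 w s) => x y key x0 y0 pz pw.
transitivity (((al + be * Bz) * y + (al' - be * Bw) * x) / (x * y)); last by rewrite key mul1r.
by field; rewrite x0 y0 pz pw.
Qed.

End PoissonIntegrals.

(** * The Schur kernel of a circular arc *)

Section SchurKernel.
Context {R : realType}.
Local Notation leb := (@lebesgue_measure R).
Variables (be c : R).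
Hypothesis be_range : 0 < be < pi.
Hypothesis c_gt0 : 0 < c.

(** Proportional to 1 - |z|^2 at the point z of angle t on the second circle,
    see nrm2_arcpt: it is positive on the arc and vanishes at both ends. *)
Definition gap (t : R) : R := cos t - cos be.

Lemma gap_gt0 t : - be < t < be -> 0 < gap t.
Proof.
have /andP[be0 bepi] := be_range; move=> /andP[t1 t2]; rewrite /gap subr_gt0.
have tbe : `|t| < be by rewrite ltr_norml t1.
have t0 := normr_ge0 t.
by rewrite -(cos_norm t) ltr_cos// in_itv/=; apply/andP; split; lra.
Qed.

Definition gapden (t t' : R) : R := gap t * gap t' + c ^+ 2 * sin ((t - t') / 2) ^+ 2.

(** The leading part of the kernel of T T* along the arc. Near each end of the
    arc it is asymptotic to a kernel that is homogeneous of degree -1 in the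
    distances to the end. *)
Definition cornerK (t t' : R) : R :=
  c / (2 * pi) * ((cos ((t + t') / 2) - cos be * cos ((t - t') / 2)) / gapden t t').

(** A primitive in t' of the kernel times the weight (gap t')^(-1/2). That such
    an elementary primitive exists is what makes this weight the right one. *)
Definition cornerK_prim (t t' : R) : R :=
  pi^-1 / Num.sqrt (gap t) * atan (c * sin ((t' - t) / 2) / Num.sqrt (gap t * gap t')).

Lemma gapden_gt0 t t' : - be < t < be -> - be < t' < be -> 0 < gapden t t'.
Proof.
move=> /gap_gt0 g1 /gap_gt0 g2; rewrite ltr_pwDl ?mulr_gt0//.
by rewrite mulr_ge0 ?sqr_ge0.
Qed.

Lemma is_derive_gap t : is_derive t (1 : R) gap (- sin t).
Proof. by rewrite /gap; apply: is_derive_eq; rewrite oppr0 addr0. Qed.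

(** This identity identifies the numerator of the kernel with the one that comes
    out of the differentiation of the arctangent. *)
Lemma mean_gapE t t' : cos ((t + t') / 2) - cos be * cos ((t - t') / 2) =
  gap t' * cos ((t' - t) / 2) + sin ((t' - t) / 2) * sin t'.
Proof.
have -> : (t + t') / 2 = t' - (t' - t) / 2 by field.
have -> : (t - t') / 2 = - ((t' - t) / 2) by field.
by rewrite cosN cosB /gap; ring.
Qed.

Lemma is_derive_cornerK_prim t t' : - be < t < be -> - be < t' < be ->
  is_derive t' 1 (cornerK_prim t) (cornerK t t' / Num.sqrt (gap t')).
Proof.
move=> tb tb'; have g1 := gap_gt0 tb; have g2 := gap_gt0 tb'.
have g12 : 0 < gap t * gap t' by rewrite mulr_gt0.
have D0 := gapden_gt0 tb tb'.
have s1 : 0 < Num.sqrt (gap t) by rewrite sqrtr_gt0.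
have s2 : 0 < Num.sqrt (gap t') by rewrite sqrtr_gt0.
have dg : is_derive t' 1 (fun u => gap t * gap u) (gap t * - sin t').
  by apply: der_eq (derM (derC (gap t) t') (is_derive_gap t')) _; rewrite mulr0 addr0.
have dh : is_derive t' 1 (fun u : R => (u - t) / 2) 2^-1.
  by apply: is_derive_eq; rewrite /GRing.scale/=; ring.
have s12 : Num.sqrt (gap t * gap t') != 0 by rewrite lt0r_neq0// sqrtr_gt0.
have := derM (derC (pi^-1 / Num.sqrt (gap t)) t')
  (derAtan (derM (derM (derC c t') (derSin dh)) (derV (derSqrt dg g12) s12))).
move=> h; apply: der_eq h _; rewrite /cornerK /gapden mean_gapE.
have -> : (t - t') / 2 = - ((t' - t) / 2) by field.
move: D0; rewrite /gapden (_ : (t - t') / 2 = - ((t' - t) / 2)); last by field.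
rewrite sinN sqrrN sqrtrM ?(ltW g1)//.
have e1 : gap t = Num.sqrt (gap t) ^+ 2 by rewrite sqr_sqrtr ?(ltW g1).
have e2 : gap t' = Num.sqrt (gap t') ^+ 2 by rewrite sqr_sqrtr ?(ltW g2).
move: s1 s2 e1 e2; move: (Num.sqrt (gap t)) (Num.sqrt (gap t')) => a b a0 b0 -> ->.
move: (sin (_ / 2)) (cos (_ / 2)) (sin t') => x y z D0.
have := @pi_gt0 R; move: pi => p p0.
field; rewrite !(lt0r_neq0 a0) !(lt0r_neq0 b0) (lt0r_neq0 p0) /=.
by rewrite !exprMn andbT lt0r_neq0.
Qed.

Lemma integral_cornerK t a b : - be < t < be -> - be < a -> a < b -> b < be ->
  (\int[leb]_(t' in `[a, b]) (cornerK t t' / Num.sqrt (gap t'))%:E = (cornerK_prim t b - cornerK_prim t a)%:E)%E.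
Proof.
move=> tb ba ab bb.
have dF x : a <= x <= b -> is_derive x 1 (cornerK_prim t) (cornerK t x / Num.sqrt (gap x)).
  by move=> /andP[ax xb]; apply: is_derive_cornerK_prim => //; apply/andP; split; lra.
suff dint x : a <= x <= b -> exists d, is_derive x 1 (fun x => cornerK t x / Num.sqrt (gap x)) d.
  exact: (FTC ab dF dint).
move=> /andP[ax xb]; have xbe : - be < x < be by apply/andP; split; lra.
have g2 := gap_gt0 xbe; have D0 := gapden_gt0 tb xbe.
have dg := is_derive_gap x.
have s2 : Num.sqrt (gap x) != 0 by rewrite lt0r_neq0// sqrtr_gt0.
have dh : is_derive x 1 (fun u : R => (t - u) / 2) (- 2^-1).
  by apply: is_derive_eq; rewrite /GRing.scale/=; ring.
have dh' : is_derive x 1 (fun u : R => (t + u) / 2) (2^-1).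
  by apply: is_derive_eq; rewrite /GRing.scale/=; ring.
have dD := derD (derM (derC (gap t) x) dg) (derM (derC (c ^+ 2) x) (derX2 (derSin dh))).
eexists; exact: (derM (derM (derC (c / (2 * pi)) x)
  (derM (derD (derCos dh') (derN (derM (derC (cos be) x) (derCos dh)))) (derV dD (lt0r_neq0 D0))))
  (derV (derSqrt dg g2) s2)).
Qed.

(** At the ends of the arc the arctangent tends to pi / 2 and -pi / 2, so the
    two halves add up to the weight (gap t)^(-1/2) itself. *)
Lemma cornerK_prim_bound t t' : - be < t < be -> `|cornerK_prim t t'| <= (2 * Num.sqrt (gap t))^-1.
Proof.
move=> /gap_gt0 g1; have s1 : 0 < Num.sqrt (gap t) by rewrite sqrtr_gt0.
have pi0 := @pi_gt0 R.
rewrite /cornerK_prim normrM ger0_norm; last by rewrite divr_ge0 ?invr_ge0 ?pi_ge0// ltW.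
set x := _ / Num.sqrt (_ * _).
have h : `|atan x| <= pi / 2 by rewrite ler_norml !ltW ?atan_ltpi2 ?atan_gtNpi2.
have -> : (2 * Num.sqrt (gap t))^-1 = pi^-1 / Num.sqrt (gap t) * (pi / 2).
  move: pi pi0 (Num.sqrt _) s1 {h} => p p0 v v0.
  by field; rewrite (lt0r_neq0 p0) (lt0r_neq0 v0).
by rewrite ler_wpM2l// divr_ge0 ?invr_ge0 ?pi_ge0// ltW.
Qed.

End SchurKernel.

(** * The Poisson kernel along an arc *)

Section ArcKernel.
Context {R : realType}.
Local Notation plane := (R * R)%type.
Local Notation leb := (@lebesgue_measure R).
Variables (be rho D al : R).
Hypothesis be_range : 0 < be < pi.
Hypothesis rho_gt0 : 0 < rho.
Hypothesis D_gt0 : 0 < D.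
Hypothesis law_cos : 1 = rho ^+ 2 + D ^+ 2 - 2 * rho * D * cos be.

Local Notation gap := (gap be).
Local Notation cornerK := (cornerK be D^-1).
Local Notation E := (`](- be), be[%classic : set R).
Local Notation I := (`[(- pi), pi[%classic : set R).

(** The point of angle t on the second circle, in the frame where the first disk
    is the unit disk; rho is then the radius of the second circle and D the
    distance of its center from the origin. *)
Definition arcpt (t : R) : plane :=
  (rho * cos (al + t) - D * cos al, rho * sin (al + t) - D * sin al).

(** Normalized so that its integral over the circle is 1. *)
Definition unit_poisson (z : plane) (s : R) : R := (1 - nrm2 z) / (2 * pi * chord2 z s).

Lemma nrm2_arcpt t : 1 - nrm2 (arcpt t) = 2 * rho * D * gap t.
Proof.
rewrite /nrm2 /arcpt /= /gap [X in X - _]law_cos.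
have ht := cos2Dsin2 (al + t); have ha := cos2Dsin2 al.
have ct : cos t = cos (al + t) * cos al + sin (al + t) * sin al.
  by rewrite -cosB addrAC subrr add0r.
rewrite ct.
transitivity (rho ^+ 2 * (cos (al + t) ^+ 2 + sin (al + t) ^+ 2)
  + D ^+ 2 * (cos al ^+ 2 + sin al ^+ 2) - 2 * rho * D * cos be
  - ((rho * cos (al + t) - D * cos al) ^+ 2 + (rho * sin (al + t) - D * sin al) ^+ 2)).
  by rewrite ht ha !mulr1.
by ring.
Qed.

Lemma chord_arcpt t t' :
  nrm2 (arcpt t) + nrm2 (arcpt t') - 2 * dotp (arcpt t) (arcpt t') =
  4 * rho ^+ 2 * sin ((t - t') / 2) ^+ 2.
Proof.
have h : 2 * sin ((t - t') / 2) ^+ 2 = 1 - cos (t - t').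
  have -> : cos (t - t') = cos ((t - t') / 2 + (t - t') / 2) by congr cos; field.
  by rewrite cosD -!expr2 cos2sin2; ring.
have -> : 4 * rho ^+ 2 * sin ((t - t') / 2) ^+ 2 = rho ^+ 2 * 2 * (1 - cos (t - t')).
  by rewrite -h; ring.
have -> : t - t' = (al + t) - (al + t') by ring.
rewrite cosB; have h1 := cos2Dsin2 (al + t); have h2 := cos2Dsin2 (al + t').
transitivity (rho ^+ 2 * ((cos (al + t) ^+ 2 + sin (al + t) ^+ 2)
  + (cos (al + t') ^+ 2 + sin (al + t') ^+ 2)
  - 2 * (cos (al + t) * cos (al + t') + sin (al + t) * sin (al + t')))).
  by rewrite /nrm2 /dotp /arcpt/=; ring.
by rewrite h1 h2; ring.
Qed.

(** Both 1 - |z|^2 and |z - z'|^2 factor along the circle, hence so does the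
    denominator |1 - z z'|^2 = |z - z'|^2 + (1 - |z|^2) (1 - |z'|^2). *)
Lemma poissonPP_arc t t' : E t -> E t' ->
  rho * poissonPP (arcpt t) (arcpt t') =
  D^-1 / 2 * ((gap t + gap t' - 2 * rho * D * (gap t * gap t')) / gapden be D^-1 t t').
Proof.
rewrite /= !in_itv/= => tE t'E.
have D0 := gapden_gt0 D^-1 be_range tE t'E.
rewrite /poissonPP; have n1 := nrm2_arcpt t; have n2 := nrm2_arcpt t'; have ch := chord_arcpt t t'.
set p := nrm2 _ in n1 ch *; set q := nrm2 _ in n2 ch *; set m := dotp _ _ in ch *.
have -> : 1 - p * q = 2 * rho * D * (gap t + gap t' - 2 * rho * D * (gap t * gap t')).
  transitivity ((1 - p) + (1 - q) - (1 - p) * (1 - q)); first by ring.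
  by rewrite n1 n2; ring.
have -> : 1 - 2 * m + p * q = 4 * rho ^+ 2 * D ^+ 2 * gapden be D^-1 t t'.
  transitivity ((p + q - 2 * m) + (1 - p) * (1 - q)); first by ring.
  by rewrite ch n1 n2 /gapden; field; rewrite gt_eqF.
by field; rewrite !lt0r_neq0.
Qed.

Lemma mean_gap_gt0 t t' : E t -> E t' ->
  0 < cos ((t + t') / 2) - cos be * cos ((t - t') / 2).
Proof.
rewrite /= !in_itv/= => /andP[t1 t2] /andP[t'1 t'2].
have /andP[be0 bepi] := be_range.
have -> : cos ((t + t') / 2) - cos be * cos ((t - t') / 2) =
  sin ((be + t) / 2) * sin ((be - t') / 2) + sin ((be - t) / 2) * sin ((be + t') / 2).
  have hs x y : sin x * sin y = (cos (x - y) - cos (x + y)) / 2.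
    by rewrite cosB cosD; field.
  rewrite !hs.
  have -> : (be + t) / 2 - (be - t') / 2 = (t + t') / 2 by field.
  have -> : (be - t) / 2 - (be + t') / 2 = - ((t + t') / 2) by field.
  have -> : (be + t) / 2 + (be - t') / 2 = be + (t - t') / 2 by field.
  have -> : (be - t) / 2 + (be + t') / 2 = be - (t - t') / 2 by field.
  by rewrite cosN cosD cosB; field.
by rewrite addr_gt0// mulr_gt0// sin_gt0_pi//; apply/andP; split; lra.
Qed.

Lemma gap_addE t t' : gap t + gap t' = 2 * (cos ((t + t') / 2) * cos ((t - t') / 2) - cos be).
Proof.
rewrite /gap.
have -> : cos t = cos ((t + t') / 2 + (t - t') / 2) by congr cos; field.
have -> : cos t' = cos ((t + t') / 2 - (t - t') / 2) by congr cos; field.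
by rewrite cosD cosB; ring.
Qed.

(** What has to be added to cornerK if cos be < 0; its product with the length 2
    * be of the arc is the correction term of the bound from above. *)
Definition kappa : R := Num.max 0 (- (cos be * D)) / (2 * pi).

(** Put mu and eta for the half-sum and half-difference of t and t'. If cos be
    >= 0 the difference of the numerators is (1 - cos eta) (cos mu + cos be)
    plus a nonnegative multiple of gap t * gap t'. If cos be < 0 it is (1 - cos
    eta) (cos mu - cos be cos eta) plus such a multiple, after adding the
    multiple of the denominator that kappa provides. *)
Lemma arc_kernel_le t t' : E t -> E t' ->
  rho * (poissonPP (arcpt t) (arcpt t') / (2 * pi)) <= cornerK t t' + kappa.
Proof.
move=> tE t'E; have M0 := mean_gap_gt0 tE t'E.
have := tE; have := t'E; rewrite /= !in_itv/= => t'E' tE'.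
have g1 := gap_gt0 be_range tE'; have g2 := gap_gt0 be_range t'E'.
have Di : 0 < D^-1 by rewrite invr_gt0.
have G0 := gapden_gt0 D^-1 be_range tE' t'E'.
have pi0 := @pi_gt0 R.
rewrite mulrA poissonPP_arc// /cornerK /kappa.
pose mx := Num.max 0 (- (cos be * D)).
have mE : cos ((t + t') / 2) + cos be > (if 0 <= cos be then 0 else 2 * cos be).
  have := gap_gt0 be_range (_ : - be < (t + t') / 2 < be).
  have h : - be < (t + t') / 2 < be by move: tE' t'E' => /andP[? ?] /andP[? ?]; apply/andP; split; lra.
  move=> /(_ h); rewrite /gap; case: ifP => [b0|]; first by lra.
  by lra.
suff key : gap t + gap t' - 2 * rho * D * (gap t * gap t') <=
    2 * (cos ((t + t') / 2) - cos be * cos ((t - t') / 2)) + 2 * D * mx * gapden be D^-1 t t'.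
  rewrite -subr_ge0 -/mx.
  have -> : D^-1 / (2 * pi) * ((cos ((t + t') / 2) - cos be * cos ((t - t') / 2)) / gapden be D^-1 t t') +
    mx / (2 * pi) - D^-1 / 2 * ((gap t + gap t' - 2 * rho * D * (gap t * gap t')) / gapden be D^-1 t t') / (2 * pi) =
    (2 * (cos ((t + t') / 2) - cos be * cos ((t - t') / 2)) + 2 * D * mx * gapden be D^-1 t t' -
     (gap t + gap t' - 2 * rho * D * (gap t * gap t'))) * (D^-1 / (4 * pi * gapden be D^-1 t t')).
    move: pi pi0 => P P0.
    by field; rewrite !lt0r_neq0.
  by rewrite mulr_ge0 ?subr_ge0// divr_ge0// ?mulr_ge0 ?ltW.
have qq := gap_addE t t'.
have c1 : cos ((t - t') / 2) <= 1 by exact: cos_le1.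
have gg : 0 <= gap t * gap t' by rewrite mulr_ge0 ?ltW.
rewrite qq; case: (lerP 0 (cos be)) mE => b0 mE.
  have -> : mx = 0 by rewrite /mx max_l// oppr_le0 mulr_ge0 ?(ltW D_gt0).
  have h1 : 0 <= 2 * rho * D * (gap t * gap t') by rewrite !mulr_ge0 ?ltW.
  have h2 : 0 <= (1 - cos ((t - t') / 2)) * (cos ((t + t') / 2) + cos be) by rewrite mulr_ge0; lra.
  by move: h1 h2; move: (gap t * gap t') (cos ((t - t') / 2)) (cos ((t + t') / 2)) => x y z; lra.
have -> : mx = - (cos be * D) by rewrite /mx max_r// oppr_ge0 nmulr_rle0 ?(ltW D_gt0).
have -> : 2 * D * - (cos be * D) * gapden be D^-1 t t' =
   - 2 * cos be * (D ^+ 2 * (gap t * gap t') + sin ((t - t') / 2) ^+ 2).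
  by rewrite /gapden; field; rewrite lt0r_neq0.
rewrite sin2cos2.
have h1 : 0 <= 2 * D * (rho - cos be * D) * (gap t * gap t').
  have h : 0 <= - (cos be * D) by rewrite oppr_ge0 nmulr_rle0 ?(ltW D_gt0).
  by apply: mulr_ge0 => //; apply: mulr_ge0; [rewrite mulr_ge0// ltW|rewrite addr_ge0// ltW].
have h2 : 0 <= (1 - cos ((t - t') / 2)) * (cos ((t + t') / 2) - cos be * cos ((t - t') / 2)).
  by rewrite mulr_ge0 ?(ltW M0)//; lra.
rewrite -subr_ge0; move: h1 h2; move: (gap t * gap t') (cos ((t - t') / 2)) (cos ((t + t') / 2)) (cos be) => x y z b h1 h2.
rewrite (_ : _ - _ = 2 * D * (rho - b * D) * x + 2 * ((1 - y) * (z - b * y))); last by ring.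
by lra.
Qed.

Lemma unit_poisson_ge0 z s : nrm2 z < 1 -> 0 <= unit_poisson z s.
Proof.
move=> z1; rewrite /unit_poisson divr_ge0 ?subr_ge0 ?(ltW z1)//.
by rewrite !mulr_ge0 ?pi_ge0// ltW// chord2_gt0.
Qed.

Lemma integral_unit_poisson2 z w : nrm2 z < 1 -> nrm2 w < 1 ->
  (\int[leb]_(s in I) (unit_poisson z s * unit_poisson w s)%:E = (poissonPP z w / (2 * pi))%:E)%E.
Proof.
move=> z1 w1; have pi0 := @pi_gt0 R.
have pz : 0 < 1 - nrm2 z by rewrite subr_gt0.
have pw : 0 < 1 - nrm2 w by rewrite subr_gt0.
pose k := (1 - nrm2 z) * (1 - nrm2 w) / (2 * pi) ^+ 2.
have k0 : 0 <= k by rewrite divr_ge0 ?sqr_ge0// mulr_ge0// ltW.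
have -> : (\int[leb]_(s in I) (unit_poisson z s * unit_poisson w s)%:E =
  \int[leb]_(s in I) (k%:E * ((chord2 z s * chord2 w s)^-1)%:E))%E.
  apply: eq_integral => s _; rewrite -EFinM; congr (_%:E); rewrite /unit_poisson /k.
  move: pi pi0 (chord2 z s) (chord2_neq0 s z1) (chord2 w s) (chord2_neq0 s w1) => P P0 c c0 c' c'0.
  by field; rewrite c0 c'0 lt0r_neq0.
rewrite ge0_integralZl//.
- rewrite integral_chord2_chord2// -EFinM; congr (_%:E); rewrite /k.
  move: pi pi0 (poissonPP z w) => P P0 c.
  by field; rewrite (lt0r_neq0 P0) (lt0r_neq0 pz) (lt0r_neq0 pw).
- by apply/measurable_EFinP; rewrite /chord2; meas.
- by move=> s _; rewrite lee_fin invr_ge0 mulr_ge0// ltW// chord2_gt0.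
Qed.

Lemma integral_unit_poisson z : nrm2 z < 1 -> (\int[leb]_(s in I) (unit_poisson z s)%:E = 1)%E.
Proof.
move=> z1; have P0 := pi_gt0 R.
have n0 : nrm2 ((0, 0) : plane) = 0 by rewrite /nrm2/= expr0n addr0.
have pk0 s : unit_poisson (0, 0) s = (2 * pi)^-1.
  by rewrite /unit_poisson /chord2 n0/= !mul0r !addr0 mulr0 !subr0 mulr1 mul1r.
have := integral_unit_poisson2 (w := (0, 0)) z1; rewrite n0 ltr01 => /(_ isT).
rewrite /poissonPP /dotp n0/= !mulr0 !addr0 mulr0 !subr0 divr1 mul1r => e.
transitivity ((2 * pi : R)%:E * (2 * pi)^-1%:E)%E; last by rewrite -EFinM mulfV// mulf_neq0// gt_eqF.
rewrite -e -ge0_integralZl//.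
- apply: eq_integral => s _; rewrite pk0 -EFinM; congr (_%:E).
  by move: (unit_poisson z s) (pi) P0 => q P P0; field; rewrite gt_eqF.
- by apply/measurable_EFinP; rewrite /unit_poisson /chord2; meas.
- by move=> s _; rewrite lee_fin mulr_ge0// unit_poisson_ge0// n0.
- by rewrite lee_fin mulr_ge0// ltW.
Qed.

Lemma nrm2_arcpt_lt1 t : E t -> nrm2 (arcpt t) < 1.
Proof.
rewrite /= in_itv/= => tE; rewrite -subr_gt0 nrm2_arcpt !mulr_gt0//.
exact: (gap_gt0 be_range tE).
Qed.

Lemma cornerK_ge0 t t' : E t -> E t' -> 0 <= cornerK t t'.
Proof.
move=> tE t'E; rewrite /cornerK mulr_ge0//.
  by rewrite divr_ge0 ?invr_ge0 ?mulr_ge0 ?pi_ge0// ltW.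
rewrite divr_ge0 ?(ltW (mean_gap_gt0 tE t'E))// ltW//.
by apply: (gapden_gt0 D^-1 be_range); [move: tE|move: t'E]; rewrite /= in_itv.
Qed.

Lemma cornerK_sym t t' : cornerK t t' = cornerK t' t.
Proof.
rewrite /cornerK /gapden (addrC t) (mulrC (gap t)).
by have -> : (t - t') / 2 = - ((t' - t) / 2) by [field]; rewrite cosN sinN sqrrN.
Qed.

(** The weight (gap t)^(-1/2) satisfies Schur's condition with constant 1:
    exhaust the arc by compact arcs, on which the primitive is available. *)
Lemma integral_cornerK_le t : E t ->
  (\int[leb]_(t' in E) (cornerK t t' / Num.sqrt (gap t'))%:E <= ((Num.sqrt (gap t))^-1)%:E)%E.
Proof.
move=> tE; have /andP[be0 bepi] := be_range.
have tE' : - be < t < be by move: tE; rewrite /= in_itv.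
pose a (n : nat) : R := be - be / n.+2%:R.
have a_lt n : 0 < a n < be.
  have h : 0 < be / n.+2%:R by rewrite divr_gt0.
  have h2 : be / n.+2%:R < be by rewrite gtr_pMr// invf_lt1// ltr1n.
  by rewrite /a subr_gt0 h2/= ltrBlDr ltrDl.
pose F (n : nat) : set R := `[- a n, a n]%classic.
have aS m n : (m <= n)%N -> a m <= a n.
  by move=> mn; rewrite /a lerD2l lerN2 ler_pM2l// lef_pV2 ?posrE// ler_nat.
have ndF : nondecreasing_seq F.
  move=> m n mn; apply/subsetPset => u; rewrite /F /= !in_itv/= => /andP[? ?].
  by have h := aS _ _ mn; apply/andP; split; lra.
have FE n : F n `<=` E.
  move=> u; rewrite /F /= !in_itv/= => /andP[u1 u2]; have /andP[a0 a1] := a_lt n.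
  by apply/andP; split; lra.
have UE : \bigcup_n F n = E.
  apply/seteqP; split => [u [n _]|u]; first exact: FE.
  rewrite /= in_itv/= => /andP[u1 u2].
  have nu : `|u| < be by rewrite ltr_norml u1.
  have [n hn] : exists n : nat, be / (be - `|u|) <= n.+2%:R.
    exists (Num.truncn (be / (be - `|u|))); apply/ltW.
    by apply: (lt_trans (truncnS_gt _)); rewrite ltr_nat.
  exists n => //; rewrite /F/= in_itv/= -ler_norml /a.
  have : be / n.+2%:R <= be - `|u|.
    by move: hn; rewrite !ler_pdivrMr// ?subr_gt0// mulrC.
  by move=> h; rewrite lerBrDr addrC -lerBrDr.
have mF : measurable_fun E (fun t' => (cornerK t t' / Num.sqrt (gap t'))%:E).
  by apply/measurable_EFinP; rewrite /cornerK /gapden /gap; meas.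
have F0 t' : E t' -> (0 <= (cornerK t t' / Num.sqrt (gap t'))%:E)%E.
  by move=> t'E; rewrite lee_fin divr_ge0 ?cornerK_ge0.
have cvgF : (\int[leb]_(x in F i) (cornerK t x / Num.sqrt (gap x))%:E @[i --> \oo] -->
  \int[leb]_(x in E) (cornerK t x / Num.sqrt (gap x))%:E)%E.
  rewrite -UE; apply: ge0_nondecreasing_set_cvg_integral => //.
  - by move=> n; exact: measurable_itv.
  - by move=> n; apply: (measurable_funS _ (FE n) mF).
  - by move=> n x /FE; exact: F0.
rewrite -(cvg_lim _ cvgF)//; apply: lime_le; first by apply/cvg_ex; eexists; exact: cvgF.
apply: nearW => n; have /andP[an0 anbe] := a_lt n.
rewrite /F integral_cornerK ?invr_gt0//; [|lra..].
have Di : 0 < D^-1 by rewrite invr_gt0.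
rewrite lee_fin; have h1 := cornerK_prim_bound D^-1 be_range (a n) tE'; have h2 := cornerK_prim_bound D^-1 be_range (- a n) tE'.
have -> : (Num.sqrt (gap t))^-1 = (2 * Num.sqrt (gap t))^-1 + (2 * Num.sqrt (gap t))^-1.
  by field; rewrite gt_eqF// sqrtr_gt0; exact: (gap_gt0 be_range tE').
move: h1 h2; rewrite !ler_norml => /andP[? ?] /andP[? ?].
lra.
Qed.

(** The kernel of T, extended by 0 to the whole plane of parameters. *)
Definition arcp (t s : R) : R := unit_poisson (arcpt t) s * \1_E t * \1_I s.

(** The weight (gap t)^(-1/2), extended by 1 outside of the arc so that it is
    positive everywhere. *)
Definition schurw (t : R) : R := (Num.sqrt (gap t) * \1_E t + \1_(~` E) t)^-1.

Lemma arcp_ge0 t s : 0 <= arcp t s.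
Proof.
rewrite /arcp; have [tE|tE] := pselect (E t); last by rewrite (indic_notin tE) mulr0 mul0r.
by apply: mulr_ge0 => //; apply: mulr_ge0 => //; apply: unit_poisson_ge0; exact: nrm2_arcpt_lt1.
Qed.

Lemma measurable_arcp : measurable_fun setT (fun z : R * R => arcp z.1 z.2).
Proof.
rewrite /arcp; apply: measurable_funM; last exact: measurable_indE.
apply: measurable_funM; last exact: measurable_indE.
by rewrite /unit_poisson /chord2 /nrm2 /arcpt/=; meas.
Qed.

Lemma schurw_gt0 t : 0 < schurw t.
Proof.
rewrite /schurw invr_gt0; have [tE|tE] := pselect (E t).
  rewrite (indic_in tE) (@indic_notin _ (~` E)) ?mulr1 ?addr0 ?sqrtr_gt0; last by [].
  by apply: (gap_gt0 be_range); move: tE; rewrite /= in_itv.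
by rewrite (indic_notin tE) (@indic_in _ (~` E)) ?mulr0 ?add0r.
Qed.

Lemma measurable_schurwi : measurable_fun setT (fun t => (schurw t)^-1).
Proof.
rewrite /schurw (_ : (fun t => _) = fun t => Num.sqrt (gap t) * \1_E t + \1_(~` E) t); last first.
  by apply/funext => t; rewrite invrK.
apply: measurable_funD; last by apply: measurable_indE => //; exact: measurableC.
by apply: measurable_funM; [rewrite /gap; meas|exact: measurable_indE].
Qed.

Definition arcK (t t' : R) : R := cornerK t t' * (\1_E t * \1_E t').

Lemma arcK_ge0 t t' : 0 <= arcK t t'.
Proof.
rewrite /arcK; have [tE|tE] := pselect (E t); last by rewrite (indic_notin tE) mul0r mulr0.
have [t'E|t'E] := pselect (E t'); last by rewrite (indic_notin t'E) !mulr0.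
by apply: mulr_ge0; [exact: cornerK_ge0|exact: mulr_ge0].
Qed.

Lemma arcK_schur (f : R -> R) : measurable_fun setT f -> (forall x, 0 <= f x) ->
  (\int[leb]_x \int[leb]_y (f x * f y * arcK x y)%:E <= \int[leb]_x (f x ^+ 2)%:E)%E.
Proof.
move=> mf f0; apply: (@schur_test _ _ _ leb arcK schurw) => //.
- rewrite /arcK; apply: measurable_funM; last by apply: measurable_funM; exact: measurable_indE.
  by rewrite /cornerK /gapden /gap; meas.
- rewrite (_ : schurw = fun t => ((schurw t)^-1)^-1); last by apply/funext => t; rewrite invrK.
  by apply: measurable_funV; exact: measurable_schurwi.
- exact: measurable_schurwi.
- exact: arcK_ge0.
- by move=> x y; rewrite /arcK cornerK_sym (mulrC (\1_E x)).
- exact: schurw_gt0.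
move=> x; have [xE|xE] := pselect (E x); last first.
  rewrite integral0_eq; first by rewrite lee_fin ltW// schurw_gt0.
  by move=> y _; rewrite /arcK (indic_notin xE) mul0r mulr0 mul0r.
apply: (@le_trans _ _ ((Num.sqrt (gap x))^-1)%:E); last first.
  by rewrite lee_fin /schurw (indic_in xE) (@indic_notin _ (~` E)) ?mulr1 ?addr0.
apply: le_trans (integral_cornerK_le xE); rewrite le_eqVlt; apply/orP; left; apply/eqP/esym.
apply: eq_integral_support => y yE; rewrite /arcK (indic_in xE) mul1r; last by rewrite (indic_notin yE) mulr0 mul0r.
by rewrite /schurw (indic_in yE) (@indic_notin _ (~` E)) ?mulr1 ?addr0.
Qed.

Lemma lebesgue_arc : leb E = (2 * be)%:E.
Proof.
have /andP[be0 _] := be_range.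
rewrite lebesgue_measure_itv/= lte_fin gtrN// -EFinB; congr (_%:E); ring.
Qed.

Lemma const_schur (f : R -> R) : measurable_fun setT f -> (forall x, 0 <= f x) ->
  (\int[leb]_x \int[leb]_y (f x * f y * (\1_E x * \1_E y / (2 * be)))%:E
    <= \int[leb]_x (f x ^+ 2)%:E)%E.
Proof.
have /andP[be0 _] := be_range.
move=> mf f0; apply: (@schur_test _ _ _ leb (fun x y => \1_E x * \1_E y / (2 * be)) (fun=> 1)) => //.
- apply: measurable_funM => //; apply: measurable_funM; exact: measurable_indE.
- by move=> x y; rewrite divr_ge0 ?mulr_ge0// ltW.
- by move=> x y; rewrite (mulrC (\1_E x)).
move=> x; apply: (@le_trans _ _ (\int[leb]_y ((2 * be)^-1%:E * (\1_E y)%:E))%E).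
  apply: le_integral_nonmeas => y _.
    by rewrite lee_fin !mulr_ge0// ?invr_ge0 ?mulr_ge0// ltW.
  rewrite -EFinM lee_fin mulr1 mulrC ler_wpM2l ?invr_ge0 ?mulr_ge0 ?(ltW be0)//.
  by rewrite ler_piMl// indicE; case: (_ \in _).
rewrite ge0_integralZl//; last 2 first.
- by apply/measurable_EFinP; exact: measurable_indic.
- by rewrite lee_fin invr_ge0 mulr_ge0// ltW.
rewrite [X in (_ * X)%E](_ : _ = (2 * be)%:E); last by rewrite integral_indic// setIT; exact: lebesgue_arc.
by rewrite -EFinM lee_fin mulVf// gt_eqF// mulr_gt0.
Qed.

Definition arcN (t t' : R) : R := poissonPP (arcpt t) (arcpt t') / (2 * pi) * (\1_E t * \1_E t').

Lemma integral_arcp_arcp t t' : (\int[leb]_s (arcp t s * arcp t' s)%:E = (arcN t t')%:E)%E.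
Proof.
rewrite /arcN; have [tE|tE] := pselect (E t); last first.
  rewrite (indic_notin tE) mul0r mulr0 integral0_eq// => s _.
  by rewrite /arcp (indic_notin tE) mulr0 !mul0r.
have [t'E|t'E] := pselect (E t'); last first.
  rewrite (indic_notin t'E) !mulr0 integral0_eq// => s _.
  by rewrite /arcp (indic_notin t'E) mulr0 mul0r mulr0.
rewrite (indic_in tE) (indic_in t'E) !mulr1 -integral_unit_poisson2 ?nrm2_arcpt_lt1//.
apply/esym/eq_integral_support => s sI; rewrite /arcp (indic_in tE) (indic_in t'E) !mulr1.
  by rewrite (indic_in sI) !mulr1.
by rewrite (indic_notin sI) !mulr0.
Qed.

Lemma kappa_ge0 : 0 <= kappa.
Proof. by rewrite /kappa divr_ge0 ?mulr_ge0 ?pi_ge0// le_max lexx. Qed.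

Lemma arcN_ge0 t t' : 0 <= arcN t t'.
Proof.
rewrite -lee_fin -integral_arcp_arcp; apply: integral_ge0 => s _.
by rewrite lee_fin mulr_ge0// arcp_ge0.
Qed.

(** Schur's test bounds the form of cornerK with the weight schurw, and the form
    of the constant kappa with the constant weight. *)
Lemma arc_form_le (f : R -> R) : measurable_fun setT f -> (forall x, 0 <= f x) ->
  (\int[leb]_x \int[leb]_y ((f x * f y)%:E * \int[leb]_s (arcp x s * arcp y s)%:E) <=
  ((1 + 2 * be * kappa) / rho)%:E * \int[leb]_x (f x ^+ 2)%:E)%E.
Proof.
move=> mf f0; have /andP[be0 _] := be_range; have k0 := kappa_ge0.
have f1 : measurable_fun setT (fun z : R * R => f z.1) by exact: measurableT_comp.
have f2 : measurable_fun setT (fun z : R * R => f z.2) by exact: measurableT_comp.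
have i1 : measurable_fun setT (fun z : R * R => \1_E z.1 : R) by exact: measurable_indE.
have i2 : measurable_fun setT (fun z : R * R => \1_E z.2 : R) by exact: measurable_indE.
pose S (z : R * R) : \bar R := (f z.1 * f z.2 * arcK z.1 z.2)%:E.
pose S1 (z : R * R) : \bar R := (f z.1 * f z.2 * (\1_E z.1 * \1_E z.2 / (2 * be)))%:E.
have mS : measurable_fun setT S.
  apply/measurable_EFinP; apply: measurable_funM; first exact: measurable_funM.
  apply: measurable_funM; last exact: measurable_funM.
  by rewrite /cornerK /gapden /gap; meas.
have mS1 : measurable_fun setT S1.
  apply/measurable_EFinP; apply: measurable_funM; first exact: measurable_funM.
  by apply: measurable_funM => //; exact: measurable_funM.
have S0 z : (0 <= S z)%E.
  by rewrite lee_fin; apply: mulr_ge0; [exact: mulr_ge0|exact: arcK_ge0].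
have S10 z : (0 <= S1 z)%E by rewrite lee_fin; apply: mulr_ge0; [exact: mulr_ge0|apply: divr_ge0; [exact: mulr_ge0|rewrite mulr_ge0// ltW]].
pose N (z : R * R) : \bar R := (f z.1 * f z.2 * arcN z.1 z.2)%:E.
have N0 z : (0 <= N z)%E by rewrite lee_fin; apply: mulr_ge0; [exact: mulr_ge0|exact: arcN_ge0].
pose a : \bar R := (rho^-1)%:E; pose b : \bar R := (rho^-1 * kappa * (2 * be))%:E.
have a0 : (0 <= a)%E by rewrite lee_fin invr_ge0 ltW.
have b0 : (0 <= b)%E by rewrite lee_fin; apply: mulr_ge0; [apply: mulr_ge0 => //; rewrite invr_ge0 ltW|rewrite mulr_ge0// ltW].
have NS z : (N z <= a * S z + b * S1 z)%E.
  rewrite /N /S /S1 /a /b -!EFinM -EFinD lee_fin /arcN /arcK.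
  have [xE|xE] := pselect (E z.1); last by rewrite (indic_notin xE) !(mul0r, mulr0) addr0.
  have [yE|yE] := pselect (E z.2); last by rewrite (indic_notin yE) !(mul0r, mulr0) addr0.
  rewrite (indic_in xE) (indic_in yE) !mulr1.
  have := arc_kernel_le xE yE; set P := poissonPP _ _ / _; set K := cornerK _ _ => h.
  have -> : rho^-1 * (f z.1 * f z.2 * K) + rho^-1 * kappa * (2 * be) * (f z.1 * f z.2 * (1 / (2 * be))) =
     f z.1 * f z.2 * ((K + kappa) / rho).
    by field; rewrite !lt0r_neq0.
  by rewrite ler_wpM2l ?mulr_ge0// ler_pdivlMr// mulrC.
have mx (F : R * R -> \bar R) x : measurable_fun setT F -> measurable_fun setT (fun y => F (x, y)).
  by move=> mF; exact: (measurableT_comp mF (pair1_measurable x)).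
have mI (F : R * R -> \bar R) : measurable_fun setT F -> (forall z, 0 <= F z)%E ->
    measurable_fun setT (fun x => \int[leb]_y F (x, y))%E.
  by move=> mF F0; exact: measurable_fun_fubini_tonelli_F.
have I0 (F : R * R -> \bar R) x : (forall z, 0 <= F z)%E -> (0 <= \int[leb]_y F (x, y))%E.
  by move=> F0; apply: integral_ge0.
apply: (@le_trans _ _ (\int[leb]_x \int[leb]_y N (x, y))%E).
  rewrite le_eqVlt; apply/orP; left; apply/eqP; apply: eq_integral => x _; apply: eq_integral => y _.
  by rewrite integral_arcp_arcp -EFinM.
apply: (@le_trans _ _ (\int[leb]_x (a * \int[leb]_y S (x, y) + b * \int[leb]_y S1 (x, y)))%E).
  apply: le_integral_nonmeas => x _; first exact: I0.
  rewrite -!ge0_integralZl//; [|exact: mx..].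
  rewrite -ge0_integralD//; last 4 first.
  - by move=> y _; rewrite mule_ge0.
  - by apply: measurable_funeM; exact: mx.
  - by move=> y _; rewrite mule_ge0.
  - by apply: measurable_funeM; exact: mx.
  exact: le_integral_nonmeas.
rewrite ge0_integralD//; last 4 first.
- by move=> x _; rewrite mule_ge0// I0.
- by apply: measurable_funeM; exact: mI.
- by move=> x _; rewrite mule_ge0// I0.
- by apply: measurable_funeM; exact: mI.
rewrite !ge0_integralZl//; [|exact: mI|by move=> x _; exact: I0|exact: mI|by move=> x _; exact: I0].
have -> : ((1 + 2 * be * kappa) / rho)%:E = (a + b)%E.
  by rewrite /a /b -EFinD; congr (_%:E); field; rewrite lt0r_neq0.
rewrite ge0_muleDl//; have hS := arcK_schur mf f0; have hS1 := const_schur mf f0.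
exact: leeD (lee_wpmul2l a0 hS) (lee_wpmul2l b0 hS1).
Qed.

Lemma arc_bound (G : R -> R) : measurable_fun setT G -> (forall s, 0 <= G s) ->
  (\int[leb]_(t in E) ((\int[leb]_(s in I) (unit_poisson (arcpt t) s * G s)%:E) ^+ 2) <=
  ((1 + 2 * be * kappa) / rho)%:E * \int[leb]_(s in I) (G s ^+ 2)%:E)%E.
Proof.
move=> mG G0; have /andP[be0 _] := be_range; have k0 := kappa_ge0.
have C0 : 0 < (1 + 2 * be * kappa) / rho.
  by apply: divr_gt0 => //; apply: ltr_pwDl => //; apply: mulr_ge0 => //; rewrite mulr_ge0// ltW.
have mG' : measurable_fun setT (fun s => G s * \1_I s).
  by apply: measurable_funM => //; exact: measurable_indE.
have G'0 s : 0 <= G s * \1_I s by rewrite mulr_ge0.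
have muE : (leb E < +oo)%E by rewrite lebesgue_arc ltry.
have pE t s : ~ E t -> arcp t s = 0.
  by move=> tE; rewrite /arcp (indic_notin tE) mulr0 mul0r.
have mE : measurable E by [].
have := @TTstar_bound _ _ _ _ R leb leb arcp _ E measurable_arcp arcp_ge0 C0 mE muE pE arc_form_le _ mG' G'0.
have -> : (\int[leb]_s ((G s * \1_I s) ^+ 2)%:E = \int[leb]_(s in I) (G s ^+ 2)%:E)%E.
  apply/esym/eq_integral_support => s sI; first by rewrite (indic_in sI) mulr1.
  by rewrite (indic_notin sI) mulr0 expr0n.
apply: le_trans; rewrite integral_mkcond le_eqVlt; apply/orP; left; apply/eqP.
apply: eq_integral => t _; rewrite patchE; case: ifPn => [/set_mem tE|/negP tE].
  congr (_ ^+ 2)%E; apply: eq_integral_support => s sI; rewrite /arcp (indic_in tE).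
    by rewrite (indic_in sI) !mulr1.
  by rewrite (indic_notin sI) !mulr0.
rewrite integral0_eq ?expe2 ?mule0// => s _; rewrite pE ?mul0r//.
by move=> Et; apply: tE; rewrite inE.
Qed.

End ArcKernel.

(** * Test functions concentrated at a corner *)

Section Corner.
Context {R : realType}.
Local Notation leb := (@lebesgue_measure R).
Variables (be rho D al : R).
Hypothesis be_range : 0 < be < pi.
Hypothesis rho_gt0 : 0 < rho.
Hypothesis D_gt0 : 0 < D.
Hypothesis law_cos : 1 = rho ^+ 2 + D ^+ 2 - 2 * rho * D * cos be.

Local Notation gap := (gap be).
Local Notation cornerK := (cornerK be D^-1).
Local Notation cornerK_prim := (cornerK_prim be D^-1).
Local Notation E := (`](- be), be[%classic : set R).
Local Notation arcpt := (arcpt rho D al).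

Lemma sin_be_gt0 : 0 < sin be. Proof. exact: sin_gt0_pi. Qed.

Lemma gap_corner_le u : 0 <= u -> gap (be - u) <= u.
Proof.
move=> u0; have -> : gap (be - u) = 2 * (sin (be - u / 2) * sin (u / 2)).
  have -> : gap (be - u) = cos ((be - u / 2) - u / 2) - cos ((be - u / 2) + u / 2).
    by rewrite /gap; congr (cos _ - cos _); field.
  by move: (u / 2) => x; move: (be - x) => m; rewrite cosB cosD; ring.
apply: (le_trans (ler_norm _)); rewrite normrM normrM ger0_norm//.
have h1 : `|sin (be - u / 2)| <= 1 by rewrite ler_norml sin_geN1 sin_le1.
have h2 := abs_sin_le (u / 2).
have : `|sin (be - u / 2)| * `|sin (u / 2)| <= 1 * `|u / 2| by apply: ler_pM.
by rewrite [`|u / 2|]ger0_norm ?divr_ge0//; lra.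
Qed.

(** At the corner t = be the derivative of gap is - sin be, so gap is comparable
    to the distance to the corner. *)
Lemma gap_corner_ge u : 0 <= u <= sin be / 2 -> sin be / 2 * u <= gap (be - u).
Proof.
move=> /andP[u0 us]; have s0 := sin_be_gt0; have s1 := sin_le1 be.
have u1 : u <= 2^-1 by lra.
rewrite /gap cosB.
have c1 := cos_ge_quad u0; have c2 := sin_ge_cubic u0; have c3 := cos_le1 u.
have cb := cos_le1 be; have cb' := cos_geN1 be.
have e1 : - (u ^+ 2 / 2) <= cos be * (cos u - 1).
  have : `|cos be * (cos u - 1)| <= 1 * (u ^+ 2 / 2).
    rewrite normrM; apply: ler_pM => //; first by rewrite ler_norml cb cb'.
    by rewrite ler0_norm; lra.
  by rewrite mul1r ler_norml => /andP[].
have e2 : sin be * (u * (1 - u ^+ 2 / 2)) <= sin be * sin u by rewrite ler_wpM2l// ltW.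
have e3 : u ^+ 2 <= sin be / 2 * u by rewrite expr2 ler_wpM2r.
have e4 : sin be * (u * (u ^+ 2 / 2)) <= u ^+ 2 / 4.
  have -> : sin be * (u * (u ^+ 2 / 2)) = (sin be * u) * (u ^+ 2 / 2) by ring.
  have : sin be * u <= 1 * 2^-1 by apply: ler_pM => //; exact: ltW.
  move: (sqr_ge0 u); move: (u ^+ 2) => q q0 h.
  have : sin be * u * (q / 2) <= 2^-1 * (q / 2) by rewrite ler_wpM2r//; lra.
  lra.
move: e2; rewrite mulrBr mulrBr mulr1.
lra.
Qed.

(** With u and u' the distances to the corner, the numerators of rho times the
    kernel and of cornerK differ by O(h (u + u')), whereas the numerator of
    cornerK is at least (sin be / 8) (u + u'). *)
Lemma arcN_corner_ge (eps h u u' : R) : 0 < eps -> h <= sin be / 2 ->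
  h * (4^-1 + rho * D / 2) <= eps * (sin be / 8) -> 0 < u <= h -> 0 < u' <= h ->
  E (be - u) -> E (be - u') ->
  (1 - eps) * cornerK (be - u) (be - u') <=
  rho * (poissonPP (arcpt (be - u)) (arcpt (be - u')) / (2 * pi)).
Proof.
move=> eps0 hs hsmall /andP[u0 uh] /andP[u'0 u'h] tE t'E.
have s0 := sin_be_gt0; have P0 := pi_gt0 R.
set t := be - u in tE *; set t' := be - u' in t'E *.
have tE' : - be < t < be by move: tE; rewrite /= in_itv.
have t'E' : - be < t' < be by move: t'E; rewrite /= in_itv.
have Di : 0 < D^-1 by rewrite invr_gt0.
have G0 := gapden_gt0 D^-1 be_range tE' t'E'.
have q0 := gap_gt0 be_range tE'; have q'0 := gap_gt0 be_range t'E'.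
rewrite mulrA (poissonPP_arc al be_range rho_gt0 D_gt0 law_cos tE t'E).
have qq := gap_addE be t t'.
have qu : gap t <= u by apply: gap_corner_le; exact: ltW.
have q'u : gap t' <= u' by apply: gap_corner_le; exact: ltW.
have uq : sin be / 2 * u <= gap t by apply: gap_corner_ge; apply/andP; split; lra.
have u'q : sin be / 2 * u' <= gap t' by apply: gap_corner_ge; apply/andP; split; lra.
have eta : 1 - cos ((t - t') / 2) <= h * (u + u') / 8.
  have -> : (t - t') / 2 = (u' - u) / 2 by rewrite /t /t'; ring.
  have := cos_ge_quad (normr_ge0 ((u' - u) / 2)); rewrite cos_norm real_normK ?num_real//.
  have -> : ((u' - u) / 2) ^+ 2 / 2 = (u' - u) ^+ 2 / 8 by field.
  have : (u' - u) ^+ 2 <= h * (u + u').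
    rewrite -real_normK ?num_real// expr2; apply: ler_pM => //.
      by rewrite ler_norml; apply/andP; split; lra.
    by rewrite ler_norml; apply/andP; split; lra.
  by move: ((u' - u) ^+ 2) => v; lra.
have eta0 := cos_le1 ((t - t') / 2).
have cmu := cos_le1 ((t + t') / 2); have cmu' := cos_geN1 ((t + t') / 2).
have cb := cos_le1 be; have cb' := cos_geN1 be.
rewrite /cornerK; move: (gapden _ _ _ _) G0 => G G0.
set M := cos ((t + t') / 2) - cos be * cos ((t - t') / 2).
have Ma : M = (gap t + gap t') / 2 + (1 - cos ((t - t') / 2)) * (cos ((t + t') / 2) + cos be).
  by rewrite qq /M; field.
have Mlo : (gap t + gap t') / 2 - h * (u + u') / 4 <= M.
  have : (1 - cos ((t - t') / 2)) * (- (cos ((t + t') / 2) + cos be)) <= h * (u + u') / 8 * 2.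
    have [neg|pos] := leP 0 (- (cos ((t + t') / 2) + cos be)).
      by apply: ler_pM => //; lra.
    apply: (@le_trans _ _ 0); first by rewrite mulr_ge0_le0//; lra.
    by rewrite !mulr_ge0//; lra.
  by rewrite Ma mulrN; lra.
have Mhi : M <= (gap t + gap t') / 2 + h * (u + u') / 4.
  have : (1 - cos ((t - t') / 2)) * (cos ((t + t') / 2) + cos be) <= h * (u + u') / 8 * 2.
    have [neg|pos] := leP 0 (cos ((t + t') / 2) + cos be).
      by apply: ler_pM => //; lra.
    apply: (@le_trans _ _ 0); first by rewrite mulr_ge0_le0//; lra.
    by rewrite !mulr_ge0//; lra.
  by rewrite Ma; lra.
have huu : h * (u + u') / 4 <= sin be / 8 * (u + u').
  have : h * (u + u') <= sin be / 2 * (u + u') by rewrite ler_wpM2r//; lra.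
  lra.
have Mlo' : sin be / 8 * (u + u') <= M by lra.
have qq' : gap t * gap t' <= h * (u + u') / 2.
  have h1 : gap t * gap t' <= h * u' by apply: (ler_pM (ltW q0) (ltW q'0)) => //; exact: le_trans uh.
  have h2 : gap t * gap t' <= u * h by apply: (ler_pM (ltW q0) (ltW q'0)) => //; exact: le_trans u'h.
  by lra.
have rD : 0 < rho * D by exact: mulr_gt0.
have rq : rho * D * (gap t * gap t') <= rho * D * (h * (u + u') / 2) by rewrite ler_pM2l.
have key : (1 - eps) * M <= (gap t + gap t' - 2 * rho * D * (gap t * gap t')) / 2.
  have e1 : h * (4^-1 + rho * D / 2) * (u + u') <= eps * (sin be / 8) * (u + u').
    by rewrite ler_wpM2r//; lra.
  have e2 : eps * (sin be / 8 * (u + u')) <= eps * M by rewrite ler_pM2l.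
  have -> : 2 * rho * D * (gap t * gap t') = 2 * (rho * D * (gap t * gap t')) by ring.
  lra.
have -> : D^-1 / 2 * ((gap t + gap t' - 2 * rho * D * (gap t * gap t')) / G) / (2 * pi) =
   D^-1 / (2 * pi * G) * ((gap t + gap t' - 2 * rho * D * (gap t * gap t')) / 2).
  by move: (pi) P0 => P P0; field; rewrite !gt_eqF.
have -> : (1 - eps) * (D^-1 / (2 * pi) * (M / G)) = D^-1 / (2 * pi * G) * ((1 - eps) * M).
  by move: (pi) P0 => P P0; field; rewrite !gt_eqF.
rewrite ler_wpM2l// divr_ge0 ?(ltW Di)// mulr_ge0 ?(ltW G0)// mulr_ge0//; exact: ltW.
Qed.

(** If v and w differ by the factor A, the sine is of order w, whereas the
    square root is at most (v w)^(1/2) <= w A^(-1/2). *)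
Lemma atan_arg_ge (A v w : R) : 2 <= A -> 0 < v -> A * v <= w -> w <= 2^-1 ->
  w <= sin be / 2 ->
  Num.sqrt A / (8 * D) <=
  D^-1 * sin ((w - v) / 2) / Num.sqrt (gap (be - v) * gap (be - w)).
Proof.
move=> A2 v0 Avw w1 ws; have s0 := sin_be_gt0.
have vw : 2 * v <= w by apply: le_trans Avw; rewrite ler_wpM2r// ltW.
have w0 : 0 < w by lra.
have gv : 0 < gap (be - v).
  by apply: lt_le_trans (gap_corner_ge (u := v) _); [rewrite mulr_gt0// divr_gt0|apply/andP; split; lra].
have gw : 0 < gap (be - w).
  by apply: lt_le_trans (gap_corner_ge (u := w) _); [rewrite mulr_gt0// divr_gt0|apply/andP; split; lra].
have gg : 0 < Num.sqrt (gap (be - v) * gap (be - w)) by rewrite sqrtr_gt0 mulr_gt0.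
have sn : w / 8 <= sin ((w - v) / 2).
  have x0 : 0 <= (w - v) / 2 by lra.
  apply: le_trans (sin_ge_cubic x0).
  have : ((w - v) / 2) ^+ 2 <= 1 by rewrite expr_le1//; lra.
  move: (_ ^+ 2) => q q1; have : (w - v) / 2 * 2^-1 <= (w - v) / 2 * (1 - q / 2).
    by rewrite ler_wpM2l//; lra.
  lra.
have -> : Num.sqrt A / (8 * D) = D^-1 * (Num.sqrt A / 8) by field; rewrite gt_eqF.
rewrite -mulrA ler_wpM2l ?invr_ge0 ?(ltW D_gt0)//.
rewrite ler_pdivlMr//; apply: le_trans sn; rewrite mulrAC ler_wpM2r//.
rewrite -sqrtrM; last by lra.
apply: (@le_trans _ _ (Num.sqrt (w ^+ 2))); last by rewrite sqrtr_sqr ger0_norm// ltW.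
apply: ler_wsqrtr; rewrite mulrA expr2; apply: ler_pM.
- by rewrite mulr_ge0// ltW//; lra.
- exact: ltW.
- apply: le_trans Avw; rewrite ler_wpM2l//; first by lra.
  by apply: gap_corner_le; exact: ltW.
- by apply: gap_corner_le; exact: ltW.
Qed.

Lemma cornerK_prim_ge (A h h' u : R) : 2 <= A -> 0 < h' -> A * h' <= u -> A * u <= h ->
  h <= sin be / 2 ->
  2 * atan (Num.sqrt A / (8 * D)) / (pi * Num.sqrt (gap (be - u))) <=
  cornerK_prim (be - u) (be - h') - cornerK_prim (be - u) (be - h).
Proof.
move=> A2 h'0 h'u uh hs; have s1 := sin_le1 be; have P0 := pi_gt0 R.
have u0 : 0 < u by apply: lt_le_trans h'u; rewrite mulr_gt0//; lra.
have uh' : u <= h by apply: le_trans uh; rewrite ler_peMl ?(ltW u0)//; lra.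
have h1 : h <= 2^-1 by lra.
have u1 : u <= 2^-1 := le_trans uh' h1.
have us : u <= sin be / 2 := le_trans uh' hs.
have b1 := le_atan (atan_arg_ge A2 h'0 h'u u1 us).
have b2 := le_atan (atan_arg_ge A2 u0 uh h1 hs).
rewrite /cornerK_prim -mulrBr.
have -> : (be - h' - (be - u)) / 2 = (u - h') / 2 by congr (_ / _); ring.
have -> : (be - h - (be - u)) / 2 = - ((h - u) / 2) by field.
rewrite sinN mulrN mulNr atanN opprK (mulrC (gap (be - u)) (gap (be - h'))).
have -> : 2 * atan (Num.sqrt A / (8 * D)) / (pi * Num.sqrt (gap (be - u))) =
   pi^-1 / Num.sqrt (gap (be - u)) * (atan (Num.sqrt A / (8 * D)) + atan (Num.sqrt A / (8 * D))).
  by move: (atan _) => a; rewrite invfM; ring.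
by rewrite ler_wpM2l ?lerD// divr_ge0 ?sqrtr_ge0// invr_ge0 ltW.
Qed.

End Corner.

Section CornerTest.
Context {R : realType}.
Local Notation leb := (@lebesgue_measure R).
Variables (be rho D al A h h' eps : R).
Hypothesis be_range : 0 < be < pi.
Hypothesis rho_gt0 : 0 < rho.
Hypothesis D_gt0 : 0 < D.
Hypothesis law_cos : 1 = rho ^+ 2 + D ^+ 2 - 2 * rho * D * cos be.
Hypothesis A_ge2 : 2 <= A.
Hypothesis h'_gt0 : 0 < h'.
Hypothesis h'_small : A * h' < h / A.
Hypothesis h_small : h <= sin be / 2.
Hypothesis eps_range : 0 < eps < 1.
Hypothesis h_eps : h * (4^-1 + rho * D / 2) <= eps * (sin be / 8).

Local Notation gap := (gap be).
Local Notation cornerK := (cornerK be D^-1).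
Local Notation cornerK_prim := (cornerK_prim be D^-1).
Local Notation E := (`](- be), be[%classic : set R).
Local Notation J := (`[be - h, be - h']%classic : set R).
Local Notation J1 := (`[be - h / A, be - A * h']%classic : set R).
Local Notation arcN := (arcN be rho D al).

Lemma corner_sizes : [/\ 0 < A, A * h' < h, h' < A * h', h / A < h & h < be].
Proof.
have A2 := A_ge2; have h0 := h'_gt0; have hh := h'_small; have hs := h_small.
have A0 : 0 < A by lra.
have hA : h' < A * h' by rewrite ltr_pMl//; lra.
have h00 : 0 < h / A by apply: lt_trans hh; rewrite mulr_gt0.
have hA' : h / A < h.
  by rewrite ltr_pdivrMr// ltr_pMr; [lra|rewrite -(pmulr_lgt0 _ (_ : 0 < A^-1)) ?invr_gt0].
split => //; first exact: lt_trans hA'.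
have /andP[be0 _] := be_range; have := sin_le_id (ltW be0); lra.
Qed.

(** The Schur weight, cut to be - h <= t <= be - h'. In the middle window be - h
    / A <= t <= be - A h' the kernel reproduces it up to a factor close to 1;
    the mass of its square on the two remaining windows stays bounded as h'
    tends to 0, while that on the middle one grows like ln (1 / h'). *)
Definition corner_test (t : R) : R := (Num.sqrt (gap t))^-1 * \1_J t.

Lemma corner_E t : J t -> E t.
Proof.
have [? ? ? ? hb] := corner_sizes; have h0 := h'_gt0; have /andP[be0 _] := be_range.
by rewrite /= !in_itv/= => /andP[? ?]; apply/andP; split; lra.
Qed.

Lemma corner_J1 t : J1 t -> J t.
Proof.
have [? ? ? ? hb] := corner_sizes.
by rewrite /= !in_itv/= => /andP[? ?]; apply/andP; split; lra.
Qed.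

Lemma gap_corner t : J t -> sin be / 2 * (be - t) <= gap t.
Proof.
have hs := h_small; have h0 := h'_gt0.
rewrite /= in_itv/= => /andP[t1 t2]; have {2}-> : t = be - (be - t) by ring.
by apply: (gap_corner_ge be_range); apply/andP; split; lra.
Qed.

Lemma gap_corner_gt0 t : J t -> 0 < gap t.
Proof.
move=> tJ; apply: (gap_gt0 be_range); have := corner_E tJ; by rewrite /= in_itv.
Qed.

Lemma corner_test_ge0 t : 0 <= corner_test t.
Proof. by rewrite /corner_test mulr_ge0// invr_ge0 sqrtr_ge0. Qed.

Lemma measurable_corner_test : measurable_fun setT corner_test.
Proof.
rewrite /corner_test; apply: measurable_funM; last exact: measurable_indE.
by rewrite /gap; meas.
Qed.

Local Notation X := (Num.sqrt A / (8 * D)).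
Local Notation k := ((1 - eps) * (2 * atan X / pi)).
Local Notation Y := (\int[leb]_(t in J1) (gap t)^-1%:E)%E.

(** For t in the middle window both ends of the support are far away, relative
    to the distance from t to the corner, so both arctangents are close to pi /
    2. *)
Lemma corner_form_ge :
  ((k / rho)%:E * Y <=
   \int[leb]_x \int[leb]_y ((corner_test x * corner_test y)%:E * (arcN x y)%:E))%E.
Proof.
have [A0 Ah' hA' hA hbe] := corner_sizes.
have A2 := A_ge2; have h0 := h'_gt0; have hs := h_small; have hh := h'_small; have P0 := pi_gt0 R.
have /andP[eps0 eps1] := eps_range; have /andP[be0 bepi] := be_range.
have X0 : 0 <= atan X.
  by rewrite -atan0; apply: le_atan; rewrite divr_ge0 ?sqrtr_ge0 ?mulr_ge0// ltW.
have k0 : 0 <= k by rewrite mulr_ge0 ?divr_ge0 ?mulr_ge0 ?(ltW P0)//; lra.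
have kr0 : 0 <= k / rho by rewrite divr_ge0// ltW.
have mg : measurable_fun J1 (fun t => (gap t)^-1%:E).
  apply/measurable_EFinP; apply: measurable_funTS; rewrite /gap; meas.
rewrite -ge0_integralZl//; last first.
  by move=> t tJ; rewrite lee_fin invr_ge0 ltW// gap_corner_gt0//; exact: corner_J1.
rewrite integral_mkcond; apply: le_integral_nonmeas => x _.
  rewrite patchE; case: ifPn => // /set_mem xJ.
  by rewrite -EFinM lee_fin mulr_ge0// invr_ge0 ltW// gap_corner_gt0//; exact: corner_J1.
rewrite patchE; case: ifPn => [/set_mem xJ1|_]; last first.
  apply: integral_ge0 => y _; rewrite -EFinM lee_fin; apply: mulr_ge0; first by apply: mulr_ge0; exact: corner_test_ge0.
  exact: (arcN_ge0 al be_range rho_gt0 D_gt0 law_cos).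
have xJ := corner_J1 xJ1; have xE := corner_E xJ; have gx := gap_corner_gt0 xJ.
have sx : 0 < Num.sqrt (gap x) by rewrite sqrtr_gt0.
have c0 : 0 <= (1 - eps) / rho / Num.sqrt (gap x).
  by rewrite !divr_ge0 ?(ltW rho_gt0) ?(ltW sx)//; lra.
apply: (@le_trans _ _ (((1 - eps) / rho / Num.sqrt (gap x))%:E *
    \int[leb]_(y in J) (cornerK x y / Num.sqrt (gap y))%:E)%E).
  have xE' : - be < x < be by move: xE; rewrite /= in_itv.
  rewrite (integral_cornerK D^-1 be_range xE'); [|lra..].
  rewrite -EFinM lee_fin; have xu : x = be - (be - x) by ring.
  have := xJ1; rewrite /= in_itv/= => /andP[x1 x2].
  have xh' : A * h' <= be - x by lra.
  have xh : A * (be - x) <= h by rewrite mulrC -ler_pdivlMr//; lra.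
  have := cornerK_prim_ge be_range D_gt0 A2 h0 xh' xh hs; rewrite -xu => key.
  apply: le_trans (ler_wpM2l c0 key).
  rewrite le_eqVlt; apply/orP; left; apply/eqP.
  have -> : (gap x)^-1 = (Num.sqrt (gap x) * Num.sqrt (gap x))^-1 by rewrite -expr2 sqr_sqrtr// ltW.
  move: (atan _) (Num.sqrt (gap x)) sx (pi) P0 => a q q0 P P0.
  by field; rewrite !gt_eqF.
have mK : measurable_fun J (fun y => (cornerK x y / Num.sqrt (gap y))%:E).
  apply/measurable_EFinP; apply: measurable_funTS.
  by rewrite /cornerK /gapden /gap; meas.
have K00 y : J y -> 0 <= cornerK x y.
  by move=> yJ; exact: (cornerK_ge0 be_range D_gt0 xE (corner_E yJ)).
rewrite -ge0_integralZl//; last first.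
  by move=> y yJ; rewrite lee_fin; apply: divr_ge0; [exact: K00|exact: sqrtr_ge0].
rewrite integral_mkcond; apply: le_integral_nonmeas => y _.
  rewrite patchE; case: ifPn => // /set_mem yJ.
  rewrite -EFinM lee_fin; apply: mulr_ge0 => //; apply: divr_ge0; last exact: sqrtr_ge0.
  exact: K00.
rewrite patchE; case: ifPn => [/set_mem yJ|_]; last first.
  rewrite -EFinM lee_fin; apply: mulr_ge0; first by apply: mulr_ge0; exact: corner_test_ge0.
  exact: (arcN_ge0 al be_range rho_gt0 D_gt0 law_cos).
rewrite -!EFinM lee_fin /corner_test !indic_in// !mulr1 /arcN !indic_in//; last exact: corner_E.
have sy : 0 < Num.sqrt (gap y) by rewrite sqrtr_gt0; exact: gap_corner_gt0.
have rngx : 0 < be - x <= h by move: xJ; rewrite /= in_itv/= => /andP[? ?]; apply/andP; split; lra.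
have rngy : 0 < be - y <= h by move: yJ; rewrite /= in_itv/= => /andP[? ?]; apply/andP; split; lra.
have xu : be - (be - x) = x by ring. have yu : be - (be - y) = y by ring.
have := @arcN_corner_ge R be rho D al be_range rho_gt0 D_gt0 law_cos eps h (be - x) (be - y) eps0 hs h_eps rngx rngy.
rewrite xu yu => /(_ xE (corner_E yJ)) key.
rewrite !mulr1 -(ler_pM2l rho_gt0).
have -> : rho * ((1 - eps) / rho / Num.sqrt (gap x) * (cornerK x y / Num.sqrt (gap y))) =
   (Num.sqrt (gap x))^-1 / Num.sqrt (gap y) * ((1 - eps) * cornerK x y).
  by move: (cornerK x y) => K; field; rewrite !gt_eqF.
rewrite [leRHS]mulrCA; exact: ler_wpM2l.
Qed.

Lemma corner_mass_ge : ((ln (h / A) - ln (A * h'))%:E <= Y)%E.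
Proof.
have [A0 Ah' hA' hA hbe] := corner_sizes; have h0 := h'_gt0; have hh := h'_small.
have Ah0 : 0 < A * h' by exact: mulr_gt0.
have ab : be - h / A < be - A * h' by lra.
have ftc : (\int[leb]_(t in J1) ((be - t)^-1)%:E = (- ln (be - (be - A * h')) - - ln (be - (be - h / A)))%:E)%E.
  apply: (@FTC R (fun t => - ln (be - t)) (fun t => (be - t)^-1) _ _ ab).
  - move=> t /andP[t1 t2]; have bt : 0 < be - t by lra.
    apply: (der_eq (a := - ((be - t)^-1 * (0 + - 1)))); last by rewrite add0r; ring.
    by apply: derN; apply: derLn => //; apply: derD.
  - move=> t /andP[t1 t2]; have bt : be - t != 0 by apply: lt0r_neq0; lra.
    exists (- (be - t) ^- 2 * (0 + - 1)).
    by apply: derV => //; apply: derD.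
have : (\int[leb]_(t in J1) ((be - t)^-1)%:E <= Y)%E.
  apply: le_integral_nonmeas => t tJ1; rewrite lee_fin.
    by rewrite invr_ge0; move: tJ1; rewrite /= in_itv/= => /andP[? ?]; lra.
  have tJ := corner_J1 tJ1; have g0 := gap_corner_gt0 tJ.
  have bt : 0 < be - t by move: tJ1; rewrite /= in_itv/= => /andP[? ?]; lra.
  rewrite lef_pV2 ?posrE//; have {1}-> : t = be - (be - t) by ring.
  by apply: gap_corner_le; exact: ltW.
apply: le_trans; rewrite ftc lee_fin.
have -> : be - (be - A * h') = A * h' by ring.
have -> : be - (be - h / A) = h / A by ring.
lra.
Qed.

Lemma corner_mass_fin : (Y < +oo)%E.
Proof.
have [A0 Ah' hA' hA hbe] := corner_sizes; have h0 := h'_gt0; have hh := h'_small.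
have s0 := sin_be_gt0 be_range; have Ah0 : 0 < A * h' by exact: mulr_gt0.
apply: (@le_lt_trans _ _ (\int[leb]_(t in J1) (sin be / 2 * (A * h'))^-1%:E)%E).
  apply: le_integral_nonmeas => t tJ1; have tJ := corner_J1 tJ1; have g0 := gap_corner_gt0 tJ.
    by rewrite lee_fin invr_ge0 ltW.
  rewrite lee_fin lef_pV2 ?posrE// ?mulr_gt0 ?divr_gt0//; apply: le_trans (gap_corner tJ).
  by rewrite ler_wpM2l ?divr_ge0 ?(ltW s0)//; move: tJ1; rewrite /= in_itv/= => /andP[? ?]; lra.
rewrite integral_cst//= lebesgue_measure_itv/= lte_fin; case: ifP => _; last by rewrite mule0.
by rewrite -EFinB -EFinM ltry.
Qed.

(** On each outer window the square of the weight is at most 2 / (sin be * v)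
    where v is the smallest distance to the corner, and the length of the window
    is at most A v. *)
Lemma corner_energy_le :
  (\int[leb]_x (corner_test x ^+ 2)%:E <= Y + (4 * A / sin be)%:E)%E.
Proof.
have [A0 Ah' hA' hA hbe] := corner_sizes; have h0 := h'_gt0; have hh := h'_small.
have s0 := sin_be_gt0 be_range; have Ah0 : 0 < A * h' by exact: mulr_gt0.
have h00 : 0 < h by lra.
pose L1 := `[be - h, be - h / A]%classic : set R; pose L2 := `[be - A * h', be - h']%classic : set R.
have mL1 : measurable L1 by exact: measurable_itv.
have mL2 : measurable L2 by exact: measurable_itv.
pose c1 := (2 * A / (sin be * h)); pose c2 := 2 / (sin be * h').
have c10 : 0 <= c1 by rewrite divr_ge0 ?mulr_ge0// ltW.
have c20 : 0 <= c2 by rewrite divr_ge0 ?mulr_ge0// ltW.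
pose F0 x := ((gap x)^-1 * \1_J1 x)%:E; pose F1 x := (c1 * \1_L1 x)%:E; pose F2 x := (c2 * \1_L2 x)%:E.
have F00 x : (0 <= F0 x)%E.
  rewrite lee_fin; have [xJ|xJ] := pselect (J1 x); last by rewrite (indic_notin xJ) mulr0.
  by rewrite mulr_ge0// invr_ge0 ltW// gap_corner_gt0//; exact: corner_J1.
have F10 x : (0 <= F1 x)%E by rewrite lee_fin mulr_ge0.
have F20 x : (0 <= F2 x)%E by rewrite lee_fin mulr_ge0.
have mF0 : measurable_fun setT F0.
  apply/measurable_EFinP; apply: measurable_funM; last exact: measurable_indic.
  by rewrite /gap; meas.
have mF1 : measurable_fun setT F1 by apply/measurable_EFinP; apply: measurable_funM => //; exact: measurable_indic.
have mF2 : measurable_fun setT F2 by apply/measurable_EFinP; apply: measurable_funM => //; exact: measurable_indic.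
apply: (@le_trans _ _ (\int[leb]_x (F0 x + (F1 x + F2 x)))%E).
  apply: le_integral_nonmeas => x _; first by rewrite lee_fin sqr_ge0.
  have [xJ|xJ] := pselect (J x); last first.
    by rewrite /corner_test (indic_notin xJ) mulr0 expr0n adde_ge0// adde_ge0.
  have gx := gap_corner_gt0 xJ.
  rewrite /corner_test (indic_in xJ) mulr1 exprVn sqr_sqrtr ?(ltW gx)//.
  have := xJ; rewrite /= in_itv/= => /andP[x1 x2]; have glo := gap_corner xJ.
  have [xh|xh] := leP x (be - h / A).
    have xL : L1 x by rewrite /L1/= in_itv/= x1.
    apply: (@le_trans _ _ (F1 x)); last by rewrite addeCA leeDl// adde_ge0.
    rewrite /F1 (indic_in xL) mulr1 lee_fin /c1 -[_ / _]invrK lef_pV2 ?posrE//; last first.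
      by rewrite invr_gt0 divr_gt0// mulr_gt0.
    rewrite invf_div; apply: le_trans glo.
    have -> : sin be * h / (2 * A) = sin be / 2 * (h / A) by field; rewrite gt_eqF.
    by rewrite ler_wpM2l ?divr_ge0 ?(ltW s0)//; lra.
  have [xh'|xh'] := leP x (be - A * h').
    have xL : J1 x by rewrite /= in_itv/= (ltW xh).
    apply: (@le_trans _ _ (F0 x)); last by rewrite leeDl// adde_ge0.
    by rewrite /F0 (indic_in xL) mulr1.
  have xL : L2 x by rewrite /L2/= in_itv/= (ltW xh').
  apply: (@le_trans _ _ (F2 x)); last by rewrite addeA leeDr// adde_ge0.
  rewrite /F2 (indic_in xL) mulr1 lee_fin /c2 -[_ / _]invrK lef_pV2 ?posrE//; last first.
    by rewrite invr_gt0 divr_gt0// mulr_gt0.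
  rewrite invf_div; apply: le_trans glo.
  have -> : sin be * h' / 2 = sin be / 2 * h' by ring.
  by rewrite ler_wpM2l ?divr_ge0 ?(ltW s0)//; lra.
rewrite ge0_integralD//; [|by move=> x _; rewrite adde_ge0|exact: emeasurable_funD].
rewrite ge0_integralD//.
have YE : (\int[leb]_x F0 x = Y)%E by rewrite [RHS]integral_indicator.
rewrite YE; apply: leeD2l.
have i1 (c a b : R) : 0 <= c -> a < b -> (\int[leb]_x (c * \1_(`[a, b]%classic : set R) x)%:E = (c * (b - a))%:E)%E.
  move=> c0 ab; rewrite -(@integral_indicator _ _ _ leb `[a, b]%classic (fun=> c)).
  by rewrite integral_cst//= lebesgue_measure_itv/= lte_fin ab -EFinB -EFinM.
rewrite /F1 /F2 /L1 /L2 !i1//; [|lra..].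
rewrite -EFinD lee_fin.
have hA0 : 0 < h / A by rewrite divr_gt0.
have e1 : c1 * (be - h / A - (be - h)) <= c1 * h by rewrite ler_wpM2l//; lra.
have e2 : c2 * (be - h' - (be - A * h')) <= c2 * (A * h') by rewrite ler_wpM2l//; lra.
have f1 : c1 * h = 2 * A / sin be by rewrite /c1; field; rewrite !gt_eqF.
have f2 : c2 * (A * h') = 2 * A / sin be by rewrite /c2; field; rewrite !gt_eqF.
have -> : 4 * A / sin be = 2 * A / sin be + 2 * A / sin be by field; rewrite gt_eqF.
lra.
Qed.

Lemma corner_test_bounded t :
  0 <= corner_test t <= (Num.sqrt (sin be / 2 * h'))^-1.
Proof.
have s0 := sin_be_gt0 be_range; have h0 := h'_gt0.
have m0 : 0 < sin be / 2 * h' by rewrite mulr_gt0// divr_gt0.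
rewrite corner_test_ge0/= /corner_test; have [tJ|tJ] := pselect (J t); last first.
  by rewrite (indic_notin tJ) mulr0 invr_ge0 sqrtr_ge0.
rewrite (indic_in tJ) mulr1 lef_pV2 ?posrE ?sqrtr_gt0 ?gap_corner_gt0//.
apply: ler_wsqrtr; apply: le_trans (gap_corner tJ); rewrite ler_wpM2l ?divr_ge0 ?(ltW s0)//.
by move: tJ; rewrite /= in_itv/= => /andP[? ?]; lra.
Qed.

Lemma corner_test_supp t : corner_test t != 0 -> E t /\ sin be / 2 * h' <= gap t.
Proof.
have s0 := sin_be_gt0 be_range; have h0 := h'_gt0.
rewrite /corner_test; have [tJ _|tJ] := pselect (J t); last by rewrite (indic_notin tJ) mulr0 eqxx.
split; first exact: corner_E.
apply: le_trans (gap_corner tJ); rewrite ler_wpM2l ?divr_ge0 ?(ltW s0)//.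
by move: tJ; rewrite /= in_itv/= => /andP[? ?]; lra.
Qed.

End CornerTest.

(** * The operator in angular coordinates *)

Section Link.
Context {R : realType}.
Local Notation plane := (R * R)%type.
Local Notation H1 := (@hausdorff1 R).
Local Notation leb := (@lebesgue_measure R).
Local Notation I := (`[(- pi), pi[%classic : set R).

Lemma poweR_half_sqr (x : \bar R) : (0 <= x -> (x `^ 2^-1) ^+ 2 = x)%E.
Proof.
case: x => [x||] //; last by move=> _; rewrite poweRyr ?invr_eq0// expe2 mulyy.
rewrite lee_fin => x0; rewrite poweR_EFin -EFin_expe; congr (_%:E).
by rewrite powR12_sqrt// sqr_sqrtr.
Qed.

Lemma lee_sqr (a b : \bar R) : (0 <= a -> a <= b -> a ^+ 2 <= b ^+ 2)%E.
Proof. by move=> a0 ab; rewrite !expe2; apply: lee_pmul. Qed.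

Variables (x1 : plane) (r1 : R).
Hypothesis r1_gt0 : 0 < r1.

Definition rescale (x : plane) : plane := ((x.1 - x1.1) / r1, (x.2 - x1.2) / r1).

Definition poisson_kernel (x y : plane) : R := (r1 ^+ 2 - edist x x1 ^+ 2) / (r1 * edist x y ^+ 2).

Lemma nrm2_rescale x : edist x x1 ^+ 2 = r1 ^+ 2 * nrm2 (rescale x).
Proof. by rewrite sqr_edist /nrm2 /rescale/=; field; rewrite gt_eqF. Qed.

Lemma nrm2_rescale_lt1 x : edist x x1 < r1 -> nrm2 (rescale x) < 1.
Proof.
rewrite edist_lt_sqr// nrm2_rescale => h.
by rewrite -(ltr_pM2l (exprn_gt0 2 r1_gt0)) mulr1.
Qed.

Lemma edist_circ_rescale x s : edist x (circ x1 r1 0 s) ^+ 2 = r1 ^+ 2 * chord2 (rescale x) s.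
Proof.
rewrite sqr_edist /circ /chord2 /nrm2 /rescale/= add0r.
have e : cos s ^+ 2 + sin s ^+ 2 = 1 := cos2Dsin2 s.
transitivity ((x.1 - x1.1) ^+ 2 + (x.2 - x1.2) ^+ 2 - 2 * r1 * ((x.1 - x1.1) * cos s + (x.2 - x1.2) * sin s)
   + r1 ^+ 2 * (cos s ^+ 2 + sin s ^+ 2)); first by ring.
by rewrite e; field; rewrite gt_eqF.
Qed.

Lemma poisson_kernel_circ x s : edist x x1 < r1 ->
  (2 * pi)^-1 * (r1 * poisson_kernel x (circ x1 r1 0 s)) = unit_poisson (rescale x) s.
Proof.
move=> xr; have h := chord2_gt0 s (nrm2_rescale_lt1 xr); have p0 := pi_gt0 R.
rewrite /poisson_kernel /unit_poisson edist_circ_rescale nrm2_rescale; move: (pi) p0 => P P0.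
by field; rewrite !gt_eqF.
Qed.

Lemma poisson_kernel_ge0 x y : edist x x1 < r1 -> 0 <= poisson_kernel x y.
Proof.
move=> xr; apply: divr_ge0; last by apply: mulr_ge0; rewrite ?(ltW r1_gt0)// sqr_ge0.
by rewrite subr_ge0 ltW// -edist_lt_sqr.
Qed.

Lemma measurable_poisson_kernel x : measurable_fun setT (poisson_kernel x).
Proof.
have -> : poisson_kernel x = fun y => (r1 ^+ 2 - edist x x1 ^+ 2) / (r1 * edist y x ^+ 2).
  by apply/funext => y; rewrite /poisson_kernel (edistC x y).
apply: measurable_funM; first exact: measurable_cst.
apply: measurable_funV; apply: measurable_funM; first exact: measurable_cst.
by apply: measurable_funX; exact: measurable_edist.
Qed.

Local Notation bd1 := (boundary (disk x1 r1)).
Local Notation C1 := (circ x1 r1 0).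

Lemma circ_bd1 s : bd1 (C1 s).
Proof. by rewrite boundary_disk//= edist_circ_center// ltW. Qed.

Lemma measurable_comp_circ (h : plane -> R) : measurable_fun bd1 h ->
  measurable_fun setT (fun s => h (C1 s)).
Proof.
move=> mh; apply: (measurable_comp (measurable_circle x1 r1_gt0) _ mh); last exact: measurable_circ.
by move=> _ [s _ <-]; exact: circ_bd1.
Qed.

Lemma measurable_unit_poisson (z : plane) : measurable_fun setT (unit_poisson z).
Proof. by rewrite /unit_poisson /chord2; meas. Qed.

Lemma ge0_poisson_circ (h : plane -> R) x : measurable_fun bd1 h ->
  (forall y, bd1 y -> 0 <= h y) -> edist x x1 < r1 ->
  ((2 * pi)^-1%:E * \int[H1]_(y in bd1) (poisson_kernel x y * h y)%:E =
   \int[leb]_(s in I) (unit_poisson (rescale x) s * h (C1 s))%:E)%E.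
Proof.
move=> mh h0 xr; rewrite (ge0_integral_circle 0)//; last 2 first.
- apply/measurable_EFinP; apply: measurable_funM => //.
  exact: measurable_funS (measurable_poisson_kernel x).
- by move=> y yb; rewrite lee_fin mulr_ge0 ?poisson_kernel_ge0 ?h0.
have mPh : measurable_fun I (fun s => (poisson_kernel x (C1 s) * h (C1 s))%:E).
  apply/measurable_EFinP; apply: measurable_funM.
    apply: (@measurableT_comp _ _ _ _ _ _ (poisson_kernel x)); first exact: measurable_poisson_kernel.
    exact: measurable_funS (measurable_circ _ _ _).
  exact: measurable_funS (measurable_comp_circ mh).
have Ph0 s : I s -> (0 <= (poisson_kernel x (C1 s) * h (C1 s))%:E)%E.
  by move=> _; rewrite lee_fin mulr_ge0 ?poisson_kernel_ge0// h0//; exact: circ_bd1.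
rewrite -!ge0_integralZl//.
- by apply: eq_integral => s _; rewrite -!EFinM -(poisson_kernel_circ s xr); congr (_%:E); ring.
- by apply: measurable_funeM.
- by move=> s sI; rewrite mule_ge0 ?Ph0// lee_fin ltW.
- by rewrite lee_fin invr_ge0 mulr_ge0// pi_ge0.
- by rewrite lee_fin ltW.
Qed.

(** The integral of the definition is real valued, with value 0 when the
    extended integral is infinite or undefined; comparing it with an extended
    right-hand side covers that case as well. *)
Lemma poisson_part_le (h : plane -> R) x : measurable_fun bd1 h -> edist x x1 < r1 ->
  ((((2 * pi)^-1 * \int[H1]_(y in bd1) (poisson_kernel x y * h y)) ^+ 2)%:E <=
   (\int[leb]_(s in I) (unit_poisson (rescale x) s * `|h (C1 s)|)%:E) ^+ 2)%E.
Proof.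
move=> mh xr.
have c0 : 0 <= (2 * pi : R)^-1 by rewrite invr_ge0 mulr_ge0// pi_ge0.
rewrite -[X in (X%:E <= _)%E]real_normK ?num_real// EFin_expe; apply: lee_sqr; first by rewrite lee_fin.
rewrite -(@ge0_poisson_circ (fun y => `|h y|))//; last exact: measurableT_comp.
rewrite normrM (ger0_norm c0) EFinM; apply: lee_wpmul2l => //.
apply: (@le_trans _ _ `|\int[H1]_(y in bd1) (poisson_kernel x y * h y)%:E|%E).
  by rewrite /Rintegral; case: integral => //= *; rewrite leey.
apply: (le_trans (le_abse_integral _ _ _)); first exact: measurable_circle.
  apply/measurable_EFinP; apply: measurable_funM => //.
  exact: measurable_funS (measurable_poisson_kernel x).
rewrite le_eqVlt; apply/orP; left; apply/eqP; apply: eq_integral => y _.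
by rewrite /= normrM (ger0_norm (poisson_kernel_ge0 _ xr)).
Qed.

Lemma poisson_part_eq (h : plane -> R) x : measurable_fun bd1 h ->
  (forall y, bd1 y -> 0 <= h y) -> edist x x1 < r1 ->
  (\int[leb]_(s in I) (unit_poisson (rescale x) s * h (C1 s))%:E < +oo)%E ->
  ((2 * pi)^-1 * \int[H1]_(y in bd1) (poisson_kernel x y * h y))%:E =
   (\int[leb]_(s in I) (unit_poisson (rescale x) s * h (C1 s))%:E)%E.
Proof.
move=> mh h0 xr; rewrite -ge0_poisson_circ// EFinM /Rintegral => fin; congr (_ * _)%E.
have c0 : 0 < (2 * pi : R)^-1 by rewrite invr_gt0 mulr_gt0// pi_gt0.
rewrite fineK// ge0_fin_numE.
  by move: fin; case: (integral _ _ _) => //; [move=> *; rewrite ltry|rewrite gt0_muley].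
by apply: integral_ge0 => y yb; rewrite lee_fin mulr_ge0 ?poisson_kernel_ge0 ?h0.
Qed.

End Link.

Lemma dual_arith (R : realType) (rho g : R) (n B F X : \bar R) :
  0 < rho -> 0 < g -> (0 <= B -> B < +oo -> 0 <= F -> n <= g%:E ->
  B <= (g / rho / 2)%:E * F + (2 * (g / rho))^-1%:E * X ->
  (0 < B -> rho%:E * X <= n * B) -> rho%:E * B <= g%:E * F)%E.
Proof.
move=> rho0 g0 B0 Boo F0 ng dual low.
have [->|Bneq0] := eqVneq B 0%E; first by rewrite mule0 mule_ge0// lee_fin ltW.
have Bpos : (0 < B)%E by rewrite lt_neqAle eq_sym Bneq0.
have {}low : (rho%:E * X <= g%:E * B)%E by apply: (le_trans (low Bpos)); exact: lee_wpmul2r.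
case: B B0 Boo Bneq0 Bpos low dual => [B|//|//] _ _ _.
rewrite lte_fin => B0.
case: F F0 => [F|_ _ _|//]; last by rewrite gt0_muley ?lte_fin// leey.
rewrite lee_fin => F0; case: X => [X| |] /=.
- rewrite -!EFinM !lee_fin => low dual.
  have h : (2 * (g / rho))^-1 * X <= B / 2.
    rewrite invfM invf_div -mulrA (mulrC 2^-1) ler_pdivrMr//.
    by rewrite divfK ?pnatr_eq0// mulrAC ler_pdivrMr// (mulrC B).
  have {}dual : B / 2 <= g / rho / 2 * F by move: dual h; lra.
  have : B <= g / rho * F by move: dual; rewrite mulrAC ler_pM2r// invr_gt0.
  by rewrite mulrAC ler_pdivlMr// mulrC.
- by rewrite gt0_muley ?lte_fin// -EFinM.
- have h : 0 < (2 * (g / rho))^-1 by rewrite invr_gt0 mulr_gt0// divr_gt0.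
  by move=> _; rewrite (gt0_muleNy (x := (2 * (g / rho))^-1%:E)) ?lte_fin// addeNy.
Qed.

Lemma integral_sqr_lty (R : realType) (H : R -> R) (M : R) : (forall s, 0 <= H s <= M) ->
  (\int[@lebesgue_measure R]_(s in `[(- pi)%R, (pi : R)[) (H s ^+ 2)%:E < +oo)%E.
Proof.
move=> HM.
apply: (@le_lt_trans _ _ (\int[@lebesgue_measure R]_(s in `[(- pi)%R, (pi : R)[) (M ^+ 2)%:E)%E).
  apply: le_integral_nonmeas => s _; first by rewrite lee_fin sqr_ge0.
  have /andP[h1 h2] := HM s; rewrite lee_fin ler_pXn2r// nnegrE//; exact: le_trans h2.
rewrite integral_cst//= lebesgue_measure_itv/= lte_fin; case: ifP => _; last by rewrite mule0.
by rewrite -EFinB -EFinM ltry.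
Qed.

Lemma gain_contradiction (R : realType) (c Y g : R) :
  c <= (1 - g) / 2 * Y -> g * c < c -> (1 + g) / 2 * Y <= g * (Y + c) -> False.
Proof.
rewrite mulrDr => h1 h2 h3.
have e1 : (1 - g) / 2 * Y = Y / 2 - g * Y / 2 by field.
have e2 : (1 + g) / 2 * Y = Y / 2 + g * Y / 2 by field.
rewrite e1 in h1; rewrite e2 in h3.
move: (g * Y) (g * c) h1 h2 h3 => a b; lra.
Qed.

Section GammaNorm.
Context {R : realType}.
Local Notation plane := (R * R)%type.
Local Notation H1 := (@hausdorff1 R).
Local Notation leb := (@lebesgue_measure R).
Local Notation I := (`[(- pi), pi[%classic : set R).
Variables (x1 : plane) (r1 : R) (x2 : plane) (r2 d al be : R).
Hypothesis r1_gt0 : 0 < r1.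
Hypothesis r2_gt0 : 0 < r2.
Hypothesis d_gt0 : 0 < d.
Hypothesis be_range : 0 < be < pi.
Hypothesis x1E : x1 = (x2.1 + d * cos al, x2.2 + d * sin al).
Hypothesis r1E : r1 ^+ 2 = r2 ^+ 2 + d ^+ 2 - 2 * r2 * d * cos be.

Local Notation rho := (r2 / r1).
Local Notation D := (d / r1).
Local Notation E := (`](- be), be[%classic : set R).
Local Notation A := (int_arc (disk x2 r2) (disk x1 r1)).
Local Notation bd1 := (boundary (disk x1 r1)).
Local Notation bd2 := (boundary (disk x2 r2)).
Local Notation C1 := (circ x1 r1 0).
Local Notation C2 := (circ x2 r2 al).
Local Notation arcpt := (arcpt rho D al).

Let rho_gt0 : 0 < rho. Proof. exact: divr_gt0. Qed.
Let D_gt0 : 0 < D. Proof. exact: divr_gt0. Qed.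

Let law_cos : 1 = rho ^+ 2 + D ^+ 2 - 2 * rho * D * cos be.
Proof. exact: scaled_law_cos. Qed.

Local Notation arcp := (arcp be rho D al).
Local Notation arcN := (arcN be rho D al).
Local Notation gap := (gap be).
Local Notation N := (gamma2_norm x1 r1 x2 r2).

Lemma rescale_C2 t : rescale x1 r1 (C2 t) = arcpt t.
Proof.
rewrite /rescale /arcpt /circ {1 2}x1E/=.
by congr pair; field; rewrite gt_eqF.
Qed.

Lemma rescale_C1 s : rescale x1 r1 (C1 s) = (cos s, sin s).
Proof. by rewrite /rescale /circ/= add0r; congr pair; field; rewrite gt_eqF. Qed.

Lemma A_lt x : A x -> edist x x1 < r1.
Proof. by rewrite int_arc_disk// => -[]. Qed.

Lemma A_C2 t : I t -> A (C2 t) <-> E t.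
Proof.
move=> It; have := @int_arc_circ R x2 x1 r2 r1 d al be t r2_gt0 r1_gt0 d_gt0 be_range x1E r1E It.
by rewrite /= in_itv.
Qed.

(** The Poisson integral on the arc, extended by 0, with an extended real value:
    in this form it is measurable in x by Tonelli's theorem. *)
Definition arc_poisson (G : R -> R) (x : plane) : \bar R :=
  (\int[leb]_s (unit_poisson (rescale x1 r1 x) s * \1_A x * \1_I s * G s)%:E)%E.

Lemma arc_poisson_in G x : A x -> arc_poisson G x = (\int[leb]_(s in I) (unit_poisson (rescale x1 r1 x) s * G s)%:E)%E.
Proof.
move=> Ax; apply/esym/eq_integral_support => s sI; rewrite [\1_A x]indicE mem_set//.
  by rewrite (indic_in sI) !mulr1.
by rewrite (indic_notin sI) mulr0 mul0r.
Qed.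

Lemma arc_poisson_out G x : ~ A x -> arc_poisson G x = 0%E.
Proof.
by move=> Ax; rewrite /arc_poisson integral0_eq// => s _; rewrite indicE memNset// mulr0 !mul0r.
Qed.

Lemma arc_poisson_ge0 (G : R -> R) x : (forall s, 0 <= G s) -> (0 <= arc_poisson G x)%E.
Proof.
move=> G0; have [Ax|Ax] := pselect (A x); last by rewrite arc_poisson_out.
rewrite arc_poisson_in//; apply: integral_ge0 => s _; rewrite lee_fin; apply: mulr_ge0 => //.
by apply: unit_poisson_ge0; apply: nrm2_rescale_lt1 => //; exact: A_lt.
Qed.

Lemma measurable_arc_poisson (G : R -> R) : measurable_fun setT G -> (forall s, 0 <= G s) ->
  measurable_fun setT (arc_poisson G).
Proof.
move=> mG G0; pose F (z : plane * R) : \bar R :=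
  (unit_poisson (rescale x1 r1 z.1) z.2 * \1_A z.1 * \1_I z.2 * G z.2)%:E.
have mA : measurable A by exact: measurable_int_arc.
apply: (@measurable_fun_fubini_tonelli_F _ _ _ _ _ leb F) => /=.
  apply/measurable_EFinP; apply: measurable_funM; last by exact: measurableT_comp.
  apply: measurable_funM; last by apply: measurable_indE.
  apply: measurable_funM.
    rewrite /unit_poisson /chord2 /nrm2 /rescale/=.
    have m1 : measurable_fun setT (fun z : plane * R => z.1.1) by exact: measurableT_comp.
    have m2 : measurable_fun setT (fun z : plane * R => z.1.2) by exact: measurableT_comp.
    by meas; try exact: m1; exact: m2.
  by apply: (@measurableT_comp _ _ _ _ _ _ (\1_A : plane -> R)) => //; exact: measurable_indic.
move=> z; rewrite /F lee_fin; have [Ax|Ax] := pselect (A z.1); last by rewrite indicE memNset// mulr0 !mul0r.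
apply: mulr_ge0 => //; apply: mulr_ge0 => //; apply: mulr_ge0 => //.
by apply: unit_poisson_ge0; apply: nrm2_rescale_lt1 => //; exact: A_lt.
Qed.

Lemma integral_arc_poisson (G : R -> R) : measurable_fun setT G -> (forall s, 0 <= G s) ->
  (\int[H1]_(x in bd2) (arc_poisson G x) ^+ 2 = r2%:E *
   \int[leb]_(t in E) (\int[leb]_(s in I) (unit_poisson (arcpt t) s * G s)%:E) ^+ 2)%E.
Proof.
move=> mG G0; rewrite (@ge0_integral_circle R x2 r2 al (fun x => arc_poisson G x ^+ 2)%E r2_gt0); last 2 first.
- apply: measurable_funTS.
  by apply: measurable_sqre; exact: measurable_arc_poisson.
- by move=> x _; rewrite expe2 mule_ge0// arc_poisson_ge0.
congr (_ * _)%E.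
have EI : E `<=` I.
  have /andP[? ?] := be_range.
  by move=> t; rewrite /= !in_itv/= => /andP[? ?]; apply/andP; split; lra.
rewrite integral_mkcond [RHS]integral_mkcond; apply: eq_integral => t _.
rewrite !patchE; have [tI|tI] := pselect (I t); last first.
  by rewrite !memNset// => /EI.
rewrite (mem_set tI); case: ifPn => [/set_mem tE|/negP tE].
  by rewrite arc_poisson_in ?rescale_C2//; apply/A_C2.
by rewrite arc_poisson_out ?expe2 ?mule0// => /(A_C2 tI) h; apply: tE; rewrite inE.
Qed.

Lemma sqr_normc (z : R[i]) : Normc.normc z ^+ 2 = complex.Re z ^+ 2 + complex.Im z ^+ 2.
Proof. by case: z => a b /=; rewrite sqr_sqrtr// addr_ge0// sqr_ge0. Qed.

(** Real and imaginary parts are treated separately, after passing to absolute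
    values, which is possible because the kernel is nonnegative. *)
Lemma gamma2_energy_le (g : plane -> R[i]) :
  measurable_fun bd1 (fun x => complex.Re (g x)) ->
  measurable_fun bd1 (fun x => complex.Im (g x)) ->
  (\int[H1]_(x in bd2) (Normc.normc (gamma2 x1 r1 x2 r2 g x) ^+ 2)%:E <=
   (1 + 2 * be * kappa be D)%:E * \int[H1]_(x in bd1) (Normc.normc (g x) ^+ 2)%:E)%E.
Proof.
move=> mRe mIm.
pose G1 (s : R) : R := `|complex.Re (g (C1 s))|; pose G2 (s : R) : R := `|complex.Im (g (C1 s))|.
have mG1 : measurable_fun setT G1 by apply: measurableT_comp => //; exact: (measurable_comp_circ r1_gt0 mRe).
have mG2 : measurable_fun setT G2 by apply: measurableT_comp => //; exact: (measurable_comp_circ r1_gt0 mIm).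
have G10 s : 0 <= G1 s := normr_ge0 _.
have G20 s : 0 <= G2 s := normr_ge0 _.
have msq (G : R -> R) : measurable_fun setT G -> (forall s, 0 <= G s) -> measurable_fun bd2 (fun x => (arc_poisson G x ^+ 2)%E).
  move=> mG G0; apply: measurable_funTS.
  by apply: measurable_sqre; exact: measurable_arc_poisson.
have sq0 (G : R -> R) x : (forall s, 0 <= G s) -> (0 <= arc_poisson G x ^+ 2)%E.
  by move=> G0; rewrite expe2 mule_ge0// arc_poisson_ge0.
apply: (@le_trans _ _ (\int[H1]_(x in bd2) (arc_poisson G1 x ^+ 2 + arc_poisson G2 x ^+ 2))%E).
  apply: le_integral_nonmeas => x xb; first by rewrite lee_fin sqr_ge0.
  rewrite /gamma2; case: ifPn => [/set_mem Ax|_]; last first.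
    by rewrite sqr_normc/= expr0n addr0; apply: adde_ge0; exact: sq0.
  have xr := A_lt Ax.
  rewrite sqr_normc/= EFinD !arc_poisson_in//; apply: leeD.
    exact: (poisson_part_le r1_gt0 mRe xr).
  exact: (poisson_part_le r1_gt0 mIm xr).
rewrite ge0_integralD//; last 5 first.
- exact: measurable_circle.
- by move=> x _; exact: sq0.
- exact: msq.
- by move=> x _; exact: sq0.
- exact: msq.
rewrite !integral_arc_poisson// (ge0_integral_circle 0)//; last 2 first.
- apply/measurable_EFinP.
  rewrite (_ : (fun x => _) = fun x => complex.Re (g x) ^+ 2 + complex.Im (g x) ^+ 2).
    by apply: measurable_funD; exact: measurable_funX.
  by apply/funext => x; exact: sqr_normc.
- by move=> x _; rewrite lee_fin sqr_ge0.
have -> : (\int[leb]_(t in I) (Normc.normc (g (C1 t)) ^+ 2)%:E =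
   \int[leb]_(t in I) (G1 t ^+ 2)%:E + \int[leb]_(t in I) (G2 t ^+ 2)%:E)%E.
  have mq (G : R -> R) : measurable_fun setT G -> measurable_fun I (fun t => (G t ^+ 2)%:E).
    move=> mG; apply/measurable_EFinP; apply: measurable_funTS; exact: measurable_funX.
  rewrite -ge0_integralD//; last 4 first.
  - by move=> t _; rewrite lee_fin sqr_ge0.
  - exact: mq.
  - by move=> t _; rewrite lee_fin sqr_ge0.
  - exact: mq.
  by apply: eq_integral => t _; rewrite sqr_normc -EFinD /G1 /G2 !real_normK ?num_real.
have b1 := arc_bound al be_range rho_gt0 D_gt0 law_cos mG1 G10.
have b2 := arc_bound al be_range rho_gt0 D_gt0 law_cos mG2 G20.
have r20 : (0 <= r2%:E)%E by rewrite lee_fin ltW.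
apply: (le_trans (leeD (lee_wpmul2l r20 b1) (lee_wpmul2l r20 b2))).
rewrite !muleA -!EFinM.
have -> : r2 * ((1 + 2 * be * kappa be D) / (r2 / r1)) = (1 + 2 * be * kappa be D) * r1.
  by field; rewrite !gt_eqF.
have i0 (G : R -> R) : (0 <= \int[leb]_(s in I) (G s ^+ 2)%:E)%E.
  by apply: integral_ge0 => s _; rewrite lee_fin sqr_ge0.
by rewrite (ge0_muleDr _ (i0 G1) (i0 G2)) lexx.
Qed.

Lemma gamma2_norm_ge0 : (0 <= gamma2_norm x1 r1 x2 r2)%E.
Proof.
apply: (le_trans (poweR_ge0 _ _)); apply: ereal_sup_ubound.
exists (fun=> 0) => //.
have e0 : L2norm bd1 (fun=> 0 : R[i]) = 0%E.
  rewrite /L2norm integral0_eq ?poweR0r ?invr_eq0// => x _.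
  by rewrite sqr_normc/= expr0n addr0.
split; last by rewrite e0.
by split; [exact: measurable_cst|exact: measurable_cst|rewrite e0].
Qed.

Lemma gamma2_norm_le : (gamma2_norm x1 r1 x2 r2 ^+ 2 <= (1 + 2 * be * kappa be D)%:E)%E.
Proof.
set c := 1 + _.
have /andP[be0 _] := be_range.
have c0 : 0 <= c.
  rewrite /c; apply: addr_ge0 => //; apply: mulr_ge0; first by rewrite mulr_ge0// ltW.
  exact: kappa_ge0.
apply: (@le_trans _ _ ((Num.sqrt c)%:E ^+ 2)%E); last by rewrite -EFin_expe sqr_sqrtr.
apply: lee_sqr; first exact: gamma2_norm_ge0.
apply: ge_ereal_sup => _ [g [[mRe mIm _] gle] <-].
rewrite -powR12_sqrt// -poweR_EFin; apply: gt0_ler_poweR; rewrite ?invr_ge0//.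
- by rewrite in_itv/= leey andbT; apply: integral_ge0 => x _; rewrite lee_fin sqr_ge0.
- by rewrite in_itv/= leey andbT lee_fin.
apply: (le_trans (gamma2_energy_le mRe mIm)).
rewrite -[X in (_ <= X)%E]mule1; apply: lee_wpmul2l => //.
rewrite -[X in (X <= _)%E]poweR_half_sqr; last by apply: integral_ge0 => x _; rewrite lee_fin sqr_ge0.
by rewrite -[X in (_ <= X)%E](mule1 1%E) -expe2; apply: lee_sqr => //; exact: poweR_ge0.
Qed.

(** The boundary function is G, rescaled to the first circle and divided by its
    norm. *)
Lemma gamma2_norm_ge (G : plane -> R) (M : R) : measurable_fun setT G ->
  (forall s, 0 <= G (cos s, sin s) <= M) ->
  (0 < \int[leb]_(s in I) (G (cos s, sin s) ^+ 2)%:E)%E ->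
  (rho%:E * \int[leb]_(t in E) (\int[leb]_(s in I) (unit_poisson (arcpt t) s * G (cos s, sin s))%:E) ^+ 2 <=
   gamma2_norm x1 r1 x2 r2 ^+ 2 * \int[leb]_(s in I) (G (cos s, sin s) ^+ 2)%:E)%E.
Proof.
move=> mG GM; set H := fun s => G (cos s, sin s).
have mH : measurable_fun setT H.
  by apply: (@measurableT_comp _ _ _ _ _ _ G) => //; apply: measurable_fun_pair; meas.
have := integral_sqr_lty GM; rewrite -/H.
case NE : (\int[leb]_(s in I) _)%E => [N||]//; rewrite ?ltxx// => _; rewrite lte_fin => N0.
have r1N : 0 < r1 * N by exact: mulr_gt0.
set q := (Num.sqrt (r1 * N))^-1.
have q0 : 0 < q by rewrite invr_gt0 sqrtr_gt0.
have q2 : q ^+ 2 = (r1 * N)^-1 by rewrite exprVn sqr_sqrtr// ltW.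
pose g (y : plane) : R[i] := Complex (q * G (rescale x1 r1 y)) 0.
have mrel : measurable_fun setT (rescale x1 r1) by apply: measurable_fun_pair; meas.
have mGr : measurable_fun bd1 (fun y => q * G (rescale x1 r1 y)).
  apply: measurable_funTS; apply: measurable_funM => //.
  exact: (measurableT_comp mG mrel).
have gn y : Normc.normc (g y) ^+ 2 = q ^+ 2 * G (rescale x1 r1 y) ^+ 2.
  by rewrite sqr_normc/= expr0n addr0 exprMn.
have gE : (\int[H1]_(x in bd1) (Normc.normc (g x) ^+ 2)%:E = 1)%E.
  rewrite (@ge0_integral_circle R x1 r1 0 _ r1_gt0); last 2 first.
  - apply/measurable_EFinP; rewrite (_ : (fun x => _) = fun x => (q * G (rescale x1 r1 x)) ^+ 2); first exact: measurable_funX.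
    by apply/funext => x; rewrite gn exprMn.
  - by move=> x _; rewrite lee_fin sqr_ge0.
  transitivity (r1%:E * ((q ^+ 2)%:E * N%:E))%E; last first.
    by rewrite q2 -!EFinM; congr (_%:E); field; rewrite !gt_eqF.
  congr (_ * _)%E; rewrite -NE -ge0_integralZl//; last 3 first.
  - by apply/measurable_EFinP; apply: measurable_funTS; exact: measurable_funX.
  - by move=> x _; rewrite lee_fin sqr_ge0.
  - by rewrite lee_fin sqr_ge0.
  by apply: eq_integral => s _; rewrite gn rescale_C1 -EFinM.
have L2g : L2norm bd1 g = 1%E by rewrite /L2norm gE poweR1r.
have : (L2norm bd2 (gamma2 x1 r1 x2 r2 g) <= gamma2_norm x1 r1 x2 r2)%E.
  rewrite /gamma2_norm /opnorm; apply: ereal_sup_ubound; exists g => //=; rewrite L2g; split; last by [].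
  split; [exact: mGr|exact: measurable_cst|by rewrite L2g ltry].
move=> /(lee_sqr (poweR_ge0 _ _)); rewrite /L2norm poweR_half_sqr; last first.
  by apply: integral_ge0 => x _; rewrite lee_fin sqr_ge0.
move=> le2.
have mqH : measurable_fun setT (fun s => q * H s) by apply: measurable_funM.
have qH0 s : 0 <= q * H s by have /andP[h _] := GM s; rewrite mulr_ge0// ltW.
have low : (\int[H1]_(x in bd2) (arc_poisson (fun s => (q * H s)%R) x) ^+ 2 <= gamma2_norm x1 r1 x2 r2 ^+ 2)%E.
  apply: le_trans le2; apply: le_integral_nonmeas => x xb; first by rewrite expe2 mule_ge0// arc_poisson_ge0.
  rewrite /gamma2; case: ifPn => [/set_mem Ax|/negP Ax]; last first.
    rewrite arc_poisson_out; last by move=> h; apply: Ax; rewrite inE.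
    by rewrite expe2 mule0 lee_fin sqr_ge0.
  have xr := A_lt Ax.
  have HE s : G (rescale x1 r1 (C1 s)) = H s by rewrite rescale_C1.
  have fin : (\int[leb]_(s in I) (unit_poisson (rescale x1 r1 x) s * (q * G (rescale x1 r1 (C1 s))))%:E < +oo)%E.
    apply: (@le_lt_trans _ _ (\int[leb]_(s in I) ((q * M)%:E * (unit_poisson (rescale x1 r1 x) s)%:E))%E).
      apply: le_integral_nonmeas => s _; rewrite HE; have /andP[h1 h2] := GM s.
        by rewrite lee_fin; apply: mulr_ge0 => //; apply: unit_poisson_ge0; apply: nrm2_rescale_lt1.
      rewrite -EFinM lee_fin mulrC ler_wpM2r//; first by apply: unit_poisson_ge0; apply: nrm2_rescale_lt1.
      by rewrite ler_wpM2l// ltW.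
    have /andP[h1 h2] := GM 0.
    rewrite ge0_integralZl//.
    - by rewrite integral_unit_poisson ?mule1 ?ltry//; exact: nrm2_rescale_lt1.
    - by apply/measurable_EFinP; apply: measurable_funTS; exact: measurable_unit_poisson.
    - by move=> s _; rewrite lee_fin; apply: unit_poisson_ge0; apply: nrm2_rescale_lt1.
    - by rewrite lee_fin mulr_ge0 ?(ltW q0)//; exact: le_trans h2.
  have ge0 y : bd1 y -> 0 <= q * G (rescale x1 r1 y).
    rewrite boundary_disk// -[[set _ | _]](circ_image x1 0 r1_gt0) => -[s _ <-].
    by rewrite HE; exact: qH0.
  rewrite sqr_normc/= EFinD !EFin_expe arc_poisson_in//.
  have := poisson_part_eq r1_gt0 mGr ge0 xr fin; rewrite /poisson_kernel => e.
  set P := (X in (_ <= X%:E ^+ 2 + _)%E).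
  have -> : P%:E = (\int[leb]_(s in I) (unit_poisson (rescale x1 r1 x) s * (q * H s))%:E)%E.
    by rewrite /P e; apply: eq_integral => s _; rewrite HE.
  by rewrite leeDl// -EFin_expe lee_fin sqr_ge0.
have H0 s : 0 <= H s by have /andP[] := GM s.
have arcUZ x : arc_poisson (fun s => (q * H s)%R) x = (q%:E * arc_poisson H x)%E.
  have [Ax|Ax] := pselect (A x); last by rewrite !arc_poisson_out// mule0.
  rewrite !arc_poisson_in// -ge0_integralZl//; last 3 first.
  - apply/measurable_EFinP; apply: measurable_funTS.
    by apply: measurable_funM => //; exact: measurable_unit_poisson.
  - move=> s _; rewrite lee_fin; apply: mulr_ge0 => //; apply: unit_poisson_ge0.
    by apply: nrm2_rescale_lt1 => //; exact: A_lt.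
  - by rewrite lee_fin ltW.
  by apply: eq_integral => s _; rewrite -EFinM mulrCA.
have mU : measurable_fun bd2 (fun x => (arc_poisson H x ^+ 2)%E).
  apply: measurable_funTS.
  by apply: measurable_sqre; exact: measurable_arc_poisson.
have := low.
have -> : (\int[H1]_(x in bd2) (arc_poisson (fun s => (q * H s)%R) x) ^+ 2 =
    (q ^+ 2)%:E * \int[H1]_(x in bd2) (arc_poisson H x) ^+ 2)%E.
  rewrite -ge0_integralZl//.
  - by apply: eq_integral => x _; rewrite arcUZ !expe2 EFinM muleACA.
  - exact: measurable_circle.
  - by move=> x _; rewrite expe2 mule_ge0// arc_poisson_ge0.
  - by rewrite lee_fin sqr_ge0.
rewrite integral_arc_poisson// => le3.
have := lee_wpmul2r (_ : (0 <= N%:E)%E) le3; rewrite lee_fin (ltW N0) => /(_ isT).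
apply: le_trans; rewrite -/H (muleA (q ^+ 2)%:E) -EFinM q2 [X in (_ <= X)%E]muleC muleA -EFinM.
have -> : N * ((r1 * N)^-1 * r2) = rho by field; rewrite !gt_eqF.
exact: lexx.
Qed.
(** The kernel is at most (1 + |z|) / (1 - |z|) <= 4 / (1 - |z|^2), up to 2 pi. *)
Lemma unit_poisson_le_gap t s : E t -> unit_poisson (arcpt t) s <= (pi * rho * D * gap t)^-1.
Proof.
move=> tE; have tE' : - be < t < be by move: tE; rewrite /= in_itv.
have g0 := gap_gt0 be_range tE'; have n1 := nrm2_arcpt_lt1 al be_range rho_gt0 D_gt0 law_cos tE.
have nE := nrm2_arcpt al law_cos t.
have P0 := pi_gt0 R.
set n := nrm2 (arcpt t) in n1 nE.
have n0 : 0 <= n by rewrite addr_ge0 ?sqr_ge0.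
have m0 : 0 < 1 - n by lra.
have ch0 := chord2_gt0 s n1.
have chE : ((1 - n) / 2) ^+ 2 <= chord2 (arcpt t) s.
  have [r r0 rE] : exists2 r, 0 <= r & n = r ^+ 2 by exists (Num.sqrt n); rewrite ?sqr_sqrtr.
  have h : ((arcpt t).1 * cos s + (arcpt t).2 * sin s) <= r.
    rewrite -[leRHS]ger0_norm//; apply: le_trans (ler_norm _) _.
    rewrite -(ler_pXn2r (n := 2)) ?nnegrE// !real_normK ?num_real// -rE /n /nrm2 -subr_ge0.
    have <- : ((arcpt t).1 * sin s - (arcpt t).2 * cos s) ^+ 2 =
       (arcpt t).1 ^+ 2 + (arcpt t).2 ^+ 2 - ((arcpt t).1 * cos s + (arcpt t).2 * sin s) ^+ 2.
      have cs : cos s ^+ 2 + sin s ^+ 2 = 1 := cos2Dsin2 s.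
      rewrite -[(arcpt t).1 ^+ 2 + _]mulr1 -cs; ring.
    exact: sqr_ge0.
  rewrite /chord2 -/n; apply: (@le_trans _ _ (1 + n - 2 * r)); last by lra.
  have r1' : r <= 1 by rewrite -(expr_le1 (n := 2))// -rE ltW.
  rewrite rE -subr_ge0.
  have -> : 1 + r ^+ 2 - 2 * r - ((1 - r ^+ 2) / 2) ^+ 2 = (1 - r) ^+ 2 * (1 - ((1 + r) / 2) ^+ 2) by field.
  apply: mulr_ge0; first exact: sqr_ge0.
  by rewrite subr_ge0 expr_le1//; lra.
rewrite /unit_poisson -/n -[leRHS]mul1r ler_pdivrMr ?mulr_gt0//.
have -> : 1 * (pi * rho * D * gap t)^-1 * (2 * pi * chord2 (arcpt t) s) = 4 * chord2 (arcpt t) s / (1 - n).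
  rewrite nE; move: (pi) P0 (rho) rho_gt0 (D) D_gt0 (chord2 _ _) => P P0 ? ? ? ? ch; field.
  by rewrite !gt_eqF.
by rewrite ler_pdivlMr//; move: chE; rewrite expr_div_n; lra.
Qed.

(** Apply the operator to T* f. If rho times the square of the norm of T T* f is
    at most g times that of T* f, then the duality <T* f, T* f> = <f, T T* f>
    bounds the square of the norm of T* f by g / rho times that of f. *)
Lemma gamma2_form_le (m Mf g : R) (f : R -> R) : 0 < m ->
  measurable_fun setT f -> (forall t, 0 <= f t <= Mf) ->
  (forall t, f t != 0 -> E t /\ m <= gap t) ->
  0 < g -> (N ^+ 2 <= g%:E)%E ->
  (rho%:E * \int[leb]_x \int[leb]_y ((f x * f y)%:E * (arcN x y)%:E) <=
   g%:E * \int[leb]_x (f x ^+ 2)%:E)%E.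
Proof.
move=> m0 mf fM f_supp g0 Ng.
have f0 t : 0 <= f t by have /andP[] := fM t.
have Mf0 : 0 <= Mf by have /andP[h /(le_trans h)] := fM 0.
have fE t : ~ E t -> f t = 0 by move=> tE; apply: contra_notP tE => /eqP/f_supp[].
have P0 := pi_gt0 R.
have c0 : 0 < pi * rho * D by apply: mulr_gt0 => //; exact: mulr_gt0.
pose K := (pi * rho * D * m)^-1.
have K0 : 0 <= K by rewrite invr_ge0 mulr_ge0// ltW.
have HK t s : f t != 0 -> 0 <= unit_poisson (arcpt t) s <= K.
  move=> /f_supp[tE mt]; rewrite unit_poisson_ge0 ?(nrm2_arcpt_lt1 al be_range rho_gt0 D_gt0 law_cos tE)//=.
  apply: (le_trans (unit_poisson_le_gap s tE)).
  have gt0 : 0 < gap t := lt_le_trans m0 mt.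
  rewrite /K lef_pV2 ?posrE; [|exact: mulr_gt0|exact: mulr_gt0].
  by rewrite ler_wpM2l// ltW.
(* T* f extends to the plane as a measurable function, the absolute value
   keeping it nonnegative off the circle. *)
pose kern (y : plane) (t : R) : R :=
  `|(1 - nrm2 (arcpt t)) / (2 * pi * (1 + nrm2 (arcpt t) - 2 * ((arcpt t).1 * y.1 + (arcpt t).2 * y.2)))| * f t.
have kernE s t : kern (cos s, sin s) t = unit_poisson (arcpt t) s * f t.
  rewrite /kern -/(unit_poisson (arcpt t) s); have [->|ft] := eqVneq (f t) 0; first by rewrite !mulr0.
  by rewrite ger0_norm//; have /andP[] := HK t s ft.
have mkern : measurable_fun setT (fun z : plane * R => (kern z.1 z.2)%:E).
  apply/measurable_EFinP; apply: measurable_funM; last exact: measurableT_comp.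
  apply: measurableT_comp => //; rewrite /nrm2 /arcpt/=.
  have m1 : measurable_fun setT (fun z : plane * R => z.1.1) by exact: measurableT_comp.
  have m2 : measurable_fun setT (fun z : plane * R => z.1.2) by exact: measurableT_comp.
  by meas; try exact: m1; exact: m2.
have kern0 y t : 0 <= kern y t by rewrite mulr_ge0.
pose G (y : plane) : R := fine (\int[leb]_t (kern y t)%:E).
have mG : measurable_fun setT G.
  apply: measurableT_comp => //.
  apply: (@measurable_fun_fubini_tonelli_F _ _ _ _ _ leb (fun z : plane * R => (kern z.1 z.2)%:E)) => //.
  by move=> z; rewrite lee_fin; exact: kern0.
pose M := K * Mf * (2 * be).
have intM s : (\int[leb]_t (kern (cos s, sin s) t)%:E <= M%:E)%E.
  apply: (@le_trans _ _ (\int[leb]_(t in E) (K * Mf)%:E)%E); last first.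
    by rewrite integral_cst//= lebesgue_arc// EFinM.
  rewrite [leRHS]integral_indicator; apply: le_integral_nonmeas => t _; rewrite lee_fin ?kern0// kernE.
  have [->|ft] := eqVneq (f t) 0; first by rewrite mulr0 mulr_ge0// mulr_ge0.
  have /andP[h1 h2] := HK t s ft; have [tE _] := f_supp t ft.
  by rewrite indic_in// mulr1 ler_pM//; have /andP[] := fM t.
have int0 s : (0 <= \int[leb]_t (kern (cos s, sin s) t)%:E)%E.
  by apply: integral_ge0 => t _; rewrite lee_fin.
pose H s := G (cos s, sin s).
have HE s : (H s)%:E = (\int[leb]_t (kern (cos s, sin s) t)%:E)%E.
  by rewrite /H /G fineK// ge0_fin_numE// (le_lt_trans (intM s))// ltry.
have HM s : 0 <= H s <= M by rewrite -!lee_fin HE int0 intM.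
have arcpf x s : arcp x s * f x = kern (cos s, sin s) x * \1_I s.
  rewrite kernE /arcp; have [xE|xE] := pselect (E x); last by rewrite fE// !(mulr0, mul0r).
  by rewrite indic_in// mulr1 mulrAC.
have hI s : (\int[leb]_x (arcp x s * f x)%:E = (H s * \1_I s)%:E)%E.
  have [sI|sI] := pselect (I s).
    rewrite (indic_in sI) mulr1 HE; apply: eq_integral => x _.
    by rewrite arcpf (indic_in sI) mulr1.
  by rewrite (indic_notin sI) mulr0 integral0_eq// => x _; rewrite arcpf (indic_notin sI) mulr0.
have mp := measurable_arcp be rho D al.
have p0 := arcp_ge0 al be_range rho_gt0 D_gt0 law_cos.
pose HI s := H s * \1_I s.
have HI0 s : 0 <= HI s by rewrite mulr_ge0//; have /andP[] := HM s.
have mH : measurable_fun setT H.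
  by apply: (@measurableT_comp _ _ _ _ _ _ G) => //; apply: measurable_fun_pair; meas.
have mHI : measurable_fun setT HI by apply: measurable_funM => //; exact: measurable_indE.
have hI' s : (\int[leb]_x (arcp x s * f x)%:E = (HI s)%:E)%E := hI s.
have dual g' (g'0 : 0 < g') := @TTstar_dual _ _ _ _ R leb leb arcp g' mp p0 g'0 f HI mf f0 mHI HI0 hI'.
have formE : (\int[leb]_x \int[leb]_y ((f x * f y)%:E * (arcN x y)%:E) =
    \int[leb]_s (HI s ^+ 2)%:E)%E.
  transitivity (\int[leb]_s ((\int[leb]_x (arcp x s * f x)%:E) ^+ 2))%E; last first.
    by apply: eq_integral => s _; rewrite hI' -EFin_expe.
  rewrite (adjoint_norm leb leb mp p0 mf f0); apply: eq_integral => x _; apply: eq_integral => y _.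
  by rewrite (integral_arcp_arcp al be_range rho_gt0 D_gt0 law_cos).
have HIE : (\int[leb]_s (HI s ^+ 2)%:E = \int[leb]_(s in I) (H s ^+ 2)%:E)%E.
  apply/esym/eq_integral_support => s sI; rewrite /HI; first by rewrite (indic_in sI) mulr1.
  by rewrite (indic_notin sI) mulr0 expr0n.
have XE : (\int[leb]_(t in E) (\int[leb]_(s in I) (unit_poisson (arcpt t) s * G (cos s, sin s))%:E) ^+ 2 =
    \int[leb]_t (\int[leb]_s (arcp t s * HI s)%:E) ^+ 2)%E.
  rewrite integral_mkcond; apply: eq_integral => t _; rewrite patchE.
  case: ifPn => [/set_mem tE|/negP tE]; last first.
    have tE' : ~ E t by move=> h; apply: tE; rewrite inE.
    by rewrite integral0_eq ?expe2 ?mule0// => s _; rewrite /arcp (indic_notin tE') mulr0 !mul0r.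
  congr (_ ^+ 2)%E; apply: eq_integral_support => s sI; rewrite /arcp (indic_in tE) /HI.
    by rewrite (indic_in sI) !mulr1.
  by rewrite (indic_notin sI) !mulr0.
have Boo := integral_sqr_lty HM.
have F0 : (0 <= \int[leb]_x (f x ^+ 2)%:E)%E by apply: integral_ge0 => x _; rewrite lee_fin sqr_ge0.
have B0 : (0 <= \int[leb]_(s in I) (H s ^+ 2)%:E)%E by apply: integral_ge0 => s _; rewrite lee_fin sqr_ge0.
have low := gamma2_norm_ge mG HM.
rewrite formE; apply: (dual_arith rho_gt0 g0 _ _ F0 Ng (dual _ (divr_gt0 g0 rho_gt0))).
- by rewrite HIE.
- by rewrite HIE.
by rewrite HIE -XE; exact: low.
Qed.

Lemma atan_near_pihalf (dl : R) : 0 < dl -> dl < 1 ->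
  exists2 A, 2 <= A & 1 - dl <= 2 * atan (Num.sqrt A / (8 * D)) / pi.
Proof.
move=> dl0 dl1; have P0 := pi_gt0 R.
have D0 : 0 < D by exact: divr_gt0.
pose th := pi / 2 * (1 - dl).
have thR : th \in `](- (pi / 2)), (pi / 2)[.
  have h : 0 < pi / 2 * dl by rewrite !mulr_gt0// invr_gt0.
  have h' : 0 < pi / 2 * (1 - dl) by rewrite !mulr_gt0// ?invr_gt0// subr_gt0.
  have h'' : 0 < pi / 2 :> R by rewrite divr_gt0.
  by rewrite in_itv/= /th; apply/andP; split; lra.
exists (Num.max 2 ((8 * D * tan th) ^+ 2)); first by rewrite le_max lexx.
have tX : tan th <= Num.sqrt (Num.max 2 ((8 * D * tan th) ^+ 2)) / (8 * D).
  have D8 : 0 < 8 * D by exact: mulr_gt0.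
  rewrite (ler_pdivlMr _ _ D8) mulrC.
  apply: (@le_trans _ _ (Num.sqrt ((8 * D * tan th) ^+ 2))); first by rewrite sqrtr_sqr ler_norm.
  by apply: ler_wsqrtr; rewrite le_max lexx orbT.
have := le_atan tX; rewrite (tanK thR) => h.
rewrite ler_pdivlMr//; move: h; rewrite /th; lra.
Qed.

(** If the square of the norm were at most g < 1, the test functions of the
    corner would give (1 - dl)^2 Y <= g (Y + c), with a mass Y that can be taken
    arbitrarily large while c stays fixed. *)
Lemma gamma2_norm_ge1 : (1 <= N ^+ 2)%E.
Proof.
rewrite leNgt; apply/negP => N1.
have [rho0 D0] : 0 < rho /\ 0 < D by split; exact: divr_gt0.
have law := scaled_law_cos r1_gt0 r1E.
have s0 := sin_be_gt0 be_range; have P0 := pi_gt0 R.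
have [g [g0 g1 Ng]] : exists g : R, [/\ 0 < g, g < 1 & (N ^+ 2 <= g%:E)%E].
  have N0 : (0 <= N ^+ 2)%E by rewrite expe2 mule_ge0// gamma2_norm_ge0.
  move: N1 N0; case: (N ^+ 2)%E => // n; rewrite lte_fin lee_fin => n1 n0.
  exists (Num.max n 2^-1); rewrite lt_max gt_max lee_fin le_max lexx n1.
  by rewrite invr_gt0 ltr0n orbT invf_lt1// ltr1n.
(* So that (1 - dl)^2 >= (1 + g) / 2. *)
pose dl := (1 - g) / 4.
have dl0 : 0 < dl by rewrite divr_gt0// subr_gt0.
have dl1 : dl < 1 by rewrite /dl; lra.
have [A A2 Aatan] := atan_near_pihalf dl0 dl1.
have A0 : 0 < A by lra.
pose h := Num.min (sin be / 2) (dl * (sin be / 8) / (4^-1 + rho * D / 2)).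
have rD : 0 < 4^-1 + rho * D / 2 by rewrite addr_gt0 ?invr_gt0// divr_gt0// mulr_gt0.
have h0 : 0 < h by rewrite lt_min !divr_gt0// mulr_gt0// divr_gt0.
have hs : h <= sin be / 2 by rewrite /h ge_min lexx.
have heps : h * (4^-1 + rho * D / 2) <= dl * (sin be / 8).
  by rewrite -ler_pdivlMr// /h ge_min lexx orbT.
pose c := 4 * A / sin be; have c0 : 0 < c by rewrite divr_gt0// mulr_gt0.
(* A mass Y >= L of the middle window contradicts the bound by g, and h' is
   chosen such that ln (h / A) - ln (A * h') = L. *)
pose L := 2 * c / (1 - g).
have g10 : 0 < 1 - g by rewrite subr_gt0.
have L0 : 0 < L by apply: divr_gt0 => //; exact: mulr_gt0.
pose h' := h / A * expR (- L) / A.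
have hA0 : 0 < h / A by rewrite divr_gt0.
have h'0 : 0 < h' by rewrite divr_gt0// mulr_gt0// expR_gt0.
have Ah'E : A * h' = h / A * expR (- L) by rewrite /h'; field; rewrite gt_eqF.
have Ah' : A * h' < h / A.
  by rewrite Ah'E gtr_pMr// -expR0 ltr_expR oppr_lt0.
have epsR : 0 < dl < 1 by rewrite dl0.
have form := corner_form_ge al be_range rho0 D0 law A2 h'0 Ah' hs epsR heps.
have energy := corner_energy_le be_range A2 h'0 Ah' hs.
have mass := corner_mass_ge be_range A2 h'0 Ah' hs.
have fin := corner_mass_fin be_range A2 h'0 Ah' hs.
have m0 : 0 < sin be / 2 * h' by rewrite mulr_gt0// divr_gt0.
have up := gamma2_form_le m0 (measurable_corner_test _ _ _)
  (corner_test_bounded be_range A2 h'0 Ah' hs) (corner_test_supp be_range A2 h'0 Ah' hs) g0 Ng.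
move: form up energy mass fin; set Y := (\int[_]_(t in _) _)%E.
set B := (\int[_]_x _)%E; set F := (\int[_]_x _)%E.
set k := (1 - dl) * _.
case: Y => [Y| |]//= form up energy; rewrite lee_fin => mass _.
have YL : L <= Y.
  apply: le_trans mass.
  by rewrite Ah'E (@lnM _ (h / A) (expR (- L))) ?posrE ?expR_gt0// expRK; lra.
have : (k%:E * Y%:E <= g%:E * (Y + c)%:E)%E.
  apply: (@le_trans _ _ (g%:E * F)%E); last by apply: lee_wpmul2l => //; rewrite lee_fin ltW.
  apply: le_trans up.
  have -> : (k%:E * Y%:E = rho%:E * ((k / rho)%:E * Y%:E))%E.
    by rewrite -!EFinM mulrA (mulrC rho) divfK ?gt_eqF.
  by apply: lee_wpmul2l => //; rewrite lee_fin ltW.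
rewrite -!EFinM lee_fin => kY.
have k1 : (1 - dl) * (1 - dl) <= k by rewrite ler_wpM2l//; lra.
have Y0 : 0 < Y := lt_le_trans L0 YL.
have k2 : (1 - dl) * (1 - dl) * Y <= g * (Y + c) by apply: le_trans kY; rewrite ler_wpM2r// ltW.
have k3 : (1 + g) / 2 * Y <= (1 - dl) * (1 - dl) * Y.
  rewrite ler_wpM2r ?(ltW Y0)//.
  have -> : (1 + g) / 2 = 1 - 2 * dl by rewrite /dl; field.
  by have := sqr_ge0 dl; rewrite expr2; lra.
have k4 : (1 - g) / 2 * L = c by rewrite /L; field; rewrite gt_eqF.
have k5 : (1 - g) / 2 * L <= (1 - g) / 2 * Y by rewrite ler_wpM2l// divr_ge0// ltW.
have k6 : g * c < c by rewrite gtr_pMl.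
have k7 := le_trans k3 k2.
rewrite k4 in k5; exact: (gain_contradiction k5 k6 k7).
Qed.

End GammaNorm.

(** * The angular form of the bound from above *)

Section UpperBound.
Context {R : realType}.
Local Notation plane := (R * R)%type.

Lemma gamma2_norm_upper (x1 : plane) (r1 : R) (x2 : plane) (r2 : R) (p : plane)
    (theta sigma : R) : two_disks x1 r1 x2 r2 p theta sigma ->
  (gamma2_norm x1 r1 x2 r2 ^+ 2 <=
    (1 + Num.max 0 (if sigma + theta == pi / 2 then 0
                    else sin theta / tan (sigma + theta))
         * ((pi - sigma - theta) / pi))%:E)%E.
Proof.
move=> TD; have [r10 r20 _ _ _ _ _ _ _ _] := TD.
have [d [al [d0 x1E beR r1E dsin]]] := two_disks_angles TD.
apply: (le_trans (gamma2_norm_le r10 r20 d0 beR x1E r1E)); rewrite lee_fin.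
set be := pi - sigma - theta; rewrite le_eqVlt; apply/orP; left; apply/eqP.
have beE : sigma + theta = pi - be by rewrite /be; ring.
have ssE : sin (sigma + theta) = sin be by rewrite beE addrC sinDpi sinN opprK.
have scE : cos (sigma + theta) = - cos be by rewrite beE addrC cosDpi cosN.
have sbe : 0 < sin be by apply: sin_gt0_pi.
have DE : d / r1 = sin theta / sin be.
  by apply/eqP; rewrite eqr_div ?(gt_eqF sbe) ?(gt_eqF r10)// -ssE dsin mulrC.
have -> : (if sigma + theta == pi / 2 then 0 else sin theta / tan (sigma + theta)) = - (cos be * (d / r1)).
  case: eqP => [e|_].
    have -> : cos be = 0 by apply/eqP; rewrite -oppr_eq0 -scE e cos_pihalf.
    by rewrite mul0r oppr0.
  by rewrite /tan invf_div ssE scE DE; ring.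
rewrite /kappa; move: (pi_gt0 R); move: (Num.max _ _) (pi) => m P P0.
by field; rewrite gt_eqF.
Qed.

End UpperBound.

(** * A configuration with norm above one *)

Section NormGt1.
Context {R : realType}.
Local Notation plane := (R * R)%type.
Local Notation leb := (@lebesgue_measure R).
Local Notation I := (`[(- pi), pi[%classic : set R).

Variable e : R.
Hypothesis e0 : 0 < e.
Hypothesis e1 : 200 * e <= 1.

Local Notation c := ((2 * cos e)^-1 : R).
Local Notation be := (pi - 2 * e).
Local Notation x1 := ((0, 0) : plane).
Local Notation x2 := ((c, 0) : plane).
Local Notation p := ((cos e, sin e) : plane).
Local Notation E := (`](- be), be[%classic : set R).

Lemma thin_range : 0 < e < pi.
Proof. have h0 := e0; have h1 := e1; have h := @pi_ge2 R; apply/andP; split; lra. Qed.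

Lemma thin_be_range : 0 < be < pi.
Proof. have h0 := e0; have h1 := e1; have h := @pi_ge2 R; apply/andP; split; lra. Qed.

Lemma thin_cos : 2^-1 < cos e < 1.
Proof.
have /andP[_ epi] := thin_range; apply/andP; split.
  apply: (lt_le_trans _ (cos_ge_quad (ltW e0))).
  have e11 : e < 1 by have h0 := e0; have h1 := e1; lra.
  have : e ^+ 2 <= e by rewrite expr2 ler_piMl// ltW.
  move: (e ^+ 2) e11 => q; lra.
by rewrite -[X in _ < X](@cos0 R) ltr_cos ?in_itv/= ?lexx ?pi_ge0 ?e0 ?(ltW e0) ?(ltW epi).
Qed.

Lemma thin_radius : 2^-1 < c < 1.
Proof.
have /andP[c1 c2] := thin_cos; have c0 : 0 < cos e by lra.
have h : 0 < 2 * cos e by lra.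
by apply/andP; split; [rewrite ltf_pV2 ?posrE//|rewrite invf_lt1//]; lra.
Qed.

Lemma thin_cosM : c * cos e = 2^-1.
Proof. by have /andP[c1 _] := thin_cos; field; apply: lt0r_neq0; lra. Qed.

Lemma edist_def (a b : plane) (r : R) : 0 <= r -> (a.1 - b.1) ^+ 2 + (a.2 - b.2) ^+ 2 = r ^+ 2 -> edist a b = r.
Proof. by move=> r0 h; rewrite /edist h sqrtr_sqr ger0_norm. Qed.

(** The second circle passes through x1, so that the triangle with vertices x1,
    x2 and p is isosceles with base from x1 to p, and both base angles are e. *)
Lemma thin_two_disks : two_disks x1 1 x2 c p e e.
Proof.
have cs : cos e ^+ 2 + sin e ^+ 2 = 1 := cos2Dsin2 e.
have /andP[c_gt c_lt] := thin_radius; have /andP[ce_gt ce_lt] := thin_cos; have cE := thin_cosM.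
have eR := thin_range; have /andP[_ epi] := eR.
move: (c) c_gt c_lt cE => C C_gt C_lt CE; have c_gt0 : 0 < C by lra.
have p1 : edist p x1 = 1 by apply: edist_def => //=; rewrite !subr0 cs expr1n.
have p2 : edist p (C, 0) = C.
  apply: edist_def; rewrite ?(ltW c_gt0)//= subr0.
  transitivity (cos e ^+ 2 + sin e ^+ 2 - 2 * (C * cos e) + C ^+ 2); first by ring.
  by rewrite cs CE; field.
split => //.
- exists (C, 0); split; rewrite /disk/=.
    by rewrite (edist_def (ltW c_gt0))//=; ring.
  by rewrite (@edist_def (C, 0) (C, 0) 0)//=; ring.
- move=> /(_ (- 2^-1, 0)); rewrite /disk/=.
  rewrite (@edist_def _ _ (2^-1)) ?invr_ge0//=; last by ring.
  rewrite (@edist_def _ _ (2^-1 + C)) ?addr_ge0 ?invr_ge0 ?(ltW c_gt0)//=; last by ring.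
  by move=> /(_ _); lra.
- move=> /(_ (1, 0)); rewrite /disk/=.
  rewrite (@edist_def _ x1 1)//=; last by ring.
  rewrite (@edist_def _ (C, 0) (1 - C))//=; [|lra|ring].
  by move=> /(_ _); lra.
- by rewrite !boundary_disk.
- rewrite /angle ![edist _ p]edistC p1 p2 mul1r/=.
  have -> : (0 - cos e) * (C - cos e) + (0 - sin e) * (0 - sin e) = C * cos e.
    transitivity (cos e ^+ 2 + sin e ^+ 2 - C * cos e); first by ring.
    by rewrite cs CE; field.
  rewrite (mulrC C) mulfK ?gt_eqF// cosK//.
  by rewrite in_itv/=; apply/andP; split; lra.
exists 0.
have x2E : (C, 0) = (x1.1 + C * cos 0, x1.2 + C * sin 0).
  by rewrite cos0 sin0 /= mulr1 mulr0 !add0r.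
have H : C ^+ 2 = 1 ^+ 2 + C ^+ 2 - 2 * 1 * C * cos e.
  by rewrite -mulrA CE; field.
have ia t := @int_arc_circ R x1 (C, 0) 1 C C 0 e t ltr01 c_gt0 c_gt0 eR x2E H.
apply/seteqP; split=> [x xA|_ [t/= tE <-]].
  have : [set x | edist x x1 = 1] x by move: xA; rewrite int_arc_disk// => -[].
  rewrite -(circ_image x1 0 ltr01) => -[t tI tx]; exists t => //.
  by rewrite /= in_itv/=; apply/(ia t tI); rewrite tx.
rewrite in_itv/= in tE; apply/(ia t) => //.
by rewrite /= in_itv/=; move: tE => /andP[? ?]; apply/andP; split; lra.
Qed.

Local Notation s := (4 / 5 * cos e).
Local Notation x0 := ((s, 0) : plane).
Local Notation arcpt := (arcpt (c / 1) (c / 1) pi).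

Lemma thin_arcpt t : arcpt t = (c * (1 - cos t), - (c * sin t)).
Proof. by rewrite /arcpt cospi sinpi (addrC pi t) cosDpi sinDpi !divr1; congr pair; ring. Qed.

Lemma thin_nrm2_x0 : nrm2 x0 < 1.
Proof.
have /andP[h1 h2] := thin_cos; rewrite /nrm2/= expr0n addr0 expr_lt1//; lra.
Qed.

Lemma thin_nrm2_arcpt t : nrm2 (arcpt t) = 2 * c ^+ 2 * (1 - cos t).
Proof.
rewrite thin_arcpt /nrm2/= sqrrN !exprMn (sin2cos2 t); ring.
Qed.

(** The harmonic function whose boundary values are the Poisson kernel at x0 is,
    on the second circle, a constant plus a Poisson kernel in the angle. The
    point x0 is chosen such that the coefficients do not depend on e. *)
Definition thin_profile (t : R) : R :=
  (3 * pi)^-1 + 5 / 3 * unit_poisson ((- (2 / 3), 0) : plane) t.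

Lemma thin_profileE t : thin_profile t = (17 + 8 * cos t) / (13 + 12 * cos t) / (2 * pi).
Proof.
have := cos_geN1 t; have := pi_gt0 R.
rewrite /thin_profile /unit_poisson /chord2 /nrm2/= !expr0n/= !mul0r.
move: (cos t) (pi) => C P P0 C1.
have h1 : 13 + 12 * C != 0 by apply: lt0r_neq0; lra.
have h2 : 1 + ((- (2 / 3)) ^+ 2 + 0) - 2 * (- (2 / 3) * C + 0) = (13 + 12 * C) / 9 by field.
by rewrite h2; field; rewrite h1 gt_eqF.
Qed.

Lemma thin_poissonPP t : poissonPP (arcpt t) x0 / (2 * pi) = thin_profile t.
Proof.
have /andP[h1 h2] := thin_cos.
rewrite thin_profileE /poissonPP thin_nrm2_arcpt thin_arcpt /dotp /nrm2/= expr0n !mulr0 !addr0.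
have := cos_geN1 t; move: (cos t) => C C1.
congr (_ / _).
have e1' : 2 * c ^+ 2 * (1 - C) * s ^+ 2 = 8 / 25 * (1 - C).
  have := thin_cosM; move: (c) => k kE.
  transitivity (32 / 25 * (1 - C) * (k * cos e) ^+ 2); first by field.
  by rewrite kE; field.
have e2' : 2 * (c * (1 - C) * s) = 4 / 5 * (1 - C).
  have := thin_cosM; move: (c) => k kE.
  transitivity (8 / 5 * (1 - C) * (k * cos e)); first by field.
  by rewrite kE; field.
rewrite e1' e2'; field; apply/andP; split; apply: lt0r_neq0; lra.
Qed.

Lemma integral_thin_profile : (\int[leb]_(t in I) (thin_profile t ^+ 2)%:E = (89 / (18 * pi))%:E)%E.
Proof.
set z : plane := (- (2 / 3), 0).
have z1 : nrm2 z < 1 by rewrite /nrm2/= expr0n addr0 sqrrN expr_lt1//; lra.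
have P0 := pi_gt0 R.
have mpk : measurable_fun I (fun t => (unit_poisson z t)%:E).
  by apply/measurable_EFinP; apply: measurable_funTS; exact: measurable_unit_poisson.
have mpk2 : measurable_fun I (fun t => (unit_poisson z t * unit_poisson z t)%:E).
  by apply/measurable_EFinP; apply: measurable_funM; exact/measurable_EFinP.
have pk0 t : 0 <= unit_poisson z t by apply: unit_poisson_ge0.
pose a : R := (9 * pi ^+ 2)^-1; pose b : R := 10 / (9 * pi); pose k : R := 25 / 9.
have a0 : 0 <= a by rewrite invr_ge0 mulr_ge0// sqr_ge0.
have b0 : 0 <= b by rewrite divr_ge0// mulr_ge0// ltW.
have k0 : 0 <= k by rewrite divr_ge0.
transitivity (\int[leb]_(t in I) (a%:E + (b%:E * (unit_poisson z t)%:E + k%:E * (unit_poisson z t * unit_poisson z t)%:E)))%E.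
  apply: eq_integral => t _; rewrite -!EFinM -!EFinD; congr (_%:E); rewrite /thin_profile -/z.
  by rewrite /a /b /k; move: (unit_poisson z t) (pi) P0 => q P P0; field; rewrite gt_eqF.
rewrite ge0_integralD//; last 2 first.
- by move=> t _; rewrite -!EFinM -EFinD lee_fin addr_ge0// mulr_ge0// mulr_ge0.
- by apply: emeasurable_funD; apply: measurable_funeM.
rewrite ge0_integralD//; last 4 first.
- by move=> t _; rewrite -EFinM lee_fin mulr_ge0.
- by apply: measurable_funeM.
- by move=> t _; rewrite -EFinM lee_fin mulr_ge0// mulr_ge0.
- by apply: measurable_funeM.
have n1 t : I t -> (0 <= (unit_poisson z t)%:E)%E by rewrite lee_fin.
have n2 t : I t -> (0 <= (unit_poisson z t * unit_poisson z t)%:E)%E by rewrite lee_fin mulr_ge0.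
rewrite !ge0_integralZl//.
rewrite integral_cst// integral_unit_poisson// integral_unit_poisson2//= lebesgue_measure_itv/= lte_fin.
rewrite ifT; last by rewrite ltrNl; lra.
rewrite mule1 -EFinB -!EFinM -!EFinD; congr (_%:E).
rewrite /poissonPP /dotp /nrm2 /z /a /b /k/= !expr0n/= mulr0; move: (pi) P0 => P P0; field.
by rewrite gt_eqF.
Qed.

(** If the whole second circle were taken into account, the ratio of the squares
    of the norms would be c * (89/18) / (41/18) > 89/82, since c > 1/2. The
    missing arc has length 4 e and the extension is at most 9 / (2 * pi) there,
    which costs less than the margin. *)
Lemma thin_norm_gt1 : (1 < gamma2_norm x1 1 x2 c)%E.
Proof.
have /andP[c1 c2] := thin_radius; have /andP[ce1 ce2] := thin_cos.
have P0 := pi_gt0 R; have P2 := @pi_ge2 R; have eE := e1; have e0' := e0.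
have c0 : 0 < c by lra.
have x1E : x1 = (x2.1 + c * cos pi, x2.2 + c * sin pi).
  by rewrite /= cospi sinpi mulrN1 mulr0 addr0 subrr.
have r1E : 1 ^+ 2 = c ^+ 2 + c ^+ 2 - 2 * c * c * cos be.
  have -> : cos be = 1 - 2 * cos e ^+ 2.
    by rewrite addrC cosDpi cosN mulr_natl cos_mulr2n -mulr_natl opprB.
  have := thin_cosM; move: (c) => k kE.
  transitivity (4 * (k * cos e) ^+ 2); last by ring.
  by rewrite kE; field.
have z0 := thin_nrm2_x0.
pose G (y : plane) : R := (1 - nrm2 x0) / (2 * pi * (1 + nrm2 x0 - 2 * (x0.1 * y.1 + x0.2 * y.2))).
have GE t : G (cos t, sin t) = unit_poisson x0 t by [].
have mG : measurable_fun setT G by rewrite /G; meas.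
have GM t : 0 <= G (cos t, sin t) <= (1 - nrm2 x0) / (2 * pi * (1 - s) ^+ 2).
  rewrite GE unit_poisson_ge0//= /unit_poisson ler_wpM2l ?subr_ge0 ?(ltW z0)//.
  have s1 : 0 < (1 - s) ^+ 2 by apply: exprn_gt0; lra.
  have : (1 - s) ^+ 2 <= chord2 x0 t.
    rewrite /chord2 /nrm2/= expr0n/= mul0r !addr0.
    have : s * cos t <= s by rewrite ler_piMr ?cos_le1//; lra.
    by move: (s) => S h; rewrite sqrrB expr1n; lra.
  have P2' : 0 < 2 * pi :> R by rewrite mulr_gt0.
  move=> h; rewrite lef_pV2 ?posrE; [|by rewrite mulr_gt0// (lt_le_trans s1)|by rewrite mulr_gt0].
  by rewrite ler_wpM2l// ltW.
have G2 : (\int[leb]_(t in I) (G (cos t, sin t) ^+ 2)%:E = (poissonPP x0 x0 / (2 * pi))%:E)%E.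
  rewrite -integral_unit_poisson2//; apply: eq_integral => t _; rewrite GE expr2//.
have Q : 0 < poissonPP x0 x0 / (2 * pi) <= 41 / (18 * pi).
  have sq : 0 <= s ^+ 2 <= 16 / 25.
    rewrite sqr_ge0 exprMn.
    have : cos e ^+ 2 <= 1 by rewrite expr_le1//; lra.
    by rewrite expr_div_n; lra.
  move: sq => /andP[sq0 sq1].
  have -> : poissonPP x0 x0 = (1 + s ^+ 2) / (1 - s ^+ 2).
    rewrite /poissonPP /dotp /nrm2/= expr0n/= mulr0 !addr0 -!expr2.
    move: (s ^+ 2) sq1 => S S1.
    have -> : 1 - 2 * S + S ^+ 2 = (1 - S) ^+ 2 by ring.
    by field; apply: lt0r_neq0; lra.
  move: (s ^+ 2) sq0 sq1 => S S0 S1.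
  have d0 : 0 < 1 - S by lra.
  apply/andP; split; first by rewrite !divr_gt0// ?mulr_gt0//; lra.
  rewrite ler_pdivrMr ?mulr_gt0//.
  have -> : 41 / (18 * pi) * (2 * pi) = 41 / 9 :> R by move: (pi) P0 => P P0; field; rewrite gt_eqF.
  by rewrite ler_pdivrMr//; lra.
move: Q => /andP[Q0 Q1].
have := gamma2_norm_ge ltr01 c0 c0 thin_be_range x1E r1E mG GM.
rewrite G2 lte_fin => /(_ Q0) low.
have inner t : E t -> (\int[leb]_(u in I) (unit_poisson (arcpt t) u * G (cos u, sin u))%:E = (thin_profile t)%:E)%E.
  move=> tE.
  have tE' : - be < t < be by move: tE; rewrite /= in_itv.
  have z1 : nrm2 (arcpt t) < 1.
    have c1' : 0 < c / 1 by rewrite divr1.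
    have law : 1 = (c / 1) ^+ 2 + (c / 1) ^+ 2 - 2 * (c / 1) * (c / 1) * cos be.
      by rewrite !divr1 -r1E expr1n.
    exact: (nrm2_arcpt_lt1 pi thin_be_range c1' c1' law tE).
  rewrite -thin_poissonPP -integral_unit_poisson2//.
have prof_ge0 t : 0 <= thin_profile t.
  have := cos_geN1 t; have := cos_le1 t; rewrite thin_profileE; move: (cos t) => C h1 h2.
  by apply: divr_ge0; [apply: divr_ge0; lra|apply: mulr_ge0 => //; exact: ltW].
have prof_le t : thin_profile t <= 9 / (2 * pi).
  have := cos_geN1 t; have := cos_le1 t; rewrite thin_profileE; move: (cos t) => C h1 h2.
  by rewrite ler_wpM2r ?invr_ge0 ?mulr_ge0 ?(ltW P0)// ler_pdivrMr; lra.
have mprof : measurable_fun setT (fun t => (thin_profile t ^+ 2)%:E).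
  by apply/measurable_EFinP; rewrite /thin_profile /unit_poisson /chord2; meas.
have EI : E `<=` I.
  by move=> t; rewrite /= !in_itv/= => /andP[? ?]; apply/andP; split; lra.
have split_I : ((89 / (18 * pi))%:E <= \int[leb]_(t in E) (thin_profile t ^+ 2)%:E + (81 * e / pi ^+ 2)%:E)%E.
  rewrite -integral_thin_profile -{1}(setDUK EI) ge0_integral_setU//=; last 4 first.
  - exact: measurableD.
  - exact: measurable_funS mprof.
  - by move=> t _; rewrite lee_fin sqr_ge0.
  - by rewrite disj_set2E setDIK.
  apply: leeD2l.
  apply: (@le_trans _ _ (\int[leb]_(t in I `\` E) ((9 / (2 * pi)) ^+ 2)%:E)%E).
    apply: le_integral_nonmeas => t _; first by rewrite lee_fin sqr_ge0.
    by rewrite lee_fin ler_pXn2r// nnegrE//; exact: le_trans (prof_le t).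
  rewrite integral_cst//; last exact: measurableD.
  rewrite (_ : I `\` E = `[(- pi), (- be)]%classic `|` `[be, pi[%classic); last first.
    apply/seteqP; split=> t; rewrite /= !in_itv/=.
      by move=> [/andP[t1 t2] /negP]; rewrite negb_and -!leNgt => /orP[h|h]; [left; rewrite t1|right; rewrite h t2].
    move=> [|] /andP[t1 t2]; split; try (apply/andP; split; lra).
      by move=> /andP[t3 t4]; lra.
    by move=> /andP[t3 t4]; lra.
  rewrite measureU//=; last first.
    by apply/seteqP; split=> t//=; rewrite !in_itv/= => -[/andP[? ?] /andP[? ?]]; lra.
  have lt1 : - pi < - be :> R by lra. have lt2 : be < pi :> R by lra.
  rewrite !lebesgue_measure_itv/= !lte_fin lt1 lt2 -!EFinB -EFinD -EFinM lee_fin.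
  rewrite le_eqVlt; apply/orP; left; apply/eqP.
  by move: (pi) P0 => P P0; field; rewrite gt_eqF.
have Efin : (\int[leb]_(t in E) (thin_profile t ^+ 2)%:E)%E =
   (\int[leb]_(t in E) (\int[leb]_(u in I) (unit_poisson (arcpt t) u * G (cos u, sin u))%:E) ^+ 2)%E.
  by apply: eq_integral => t /set_mem tE; rewrite inner.
rewrite Efin in split_I; move: split_I low.
set X := (\int[leb]_(t in E) _)%E; set N := gamma2_norm _ _ _ _ => split_I low.
have N0 : (0 <= N)%E := gamma2_norm_ge0 _ _ _ _.
rewrite ltNge; apply/negP => N1.
have N2 : (N ^+ 2 <= 1)%E.
  by rewrite -[X in (_ <= X)%E](mule1 1%E) -expe2; exact: lee_sqr.
have : (c%:E * X <= (41 / (18 * pi))%:E)%E.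
  rewrite -[c in (c%:E * _)%E]divr1; apply: (le_trans low).
  apply: (@le_trans _ _ (1 * (poissonPP x0 x0 / (2 * pi))%:E)%E); last by rewrite mul1e lee_fin.
  by apply: lee_wpmul2r => //; rewrite lee_fin ltW.
have X0 : (0 <= X)%E by rewrite /X -Efin; apply: integral_ge0 => t _; rewrite lee_fin sqr_ge0.
move: split_I X0; case: X {Efin low} => [X| |//]; last by rewrite gt0_muley ?lte_fin.
rewrite -EFinM -EFinD !lee_fin => h1 X0 h2.
have h3 : 2^-1 * X <= 41 / (18 * pi) by apply: le_trans h2; rewrite ler_wpM2r// ltW.
have h4 : 81 * e / pi ^+ 2 <= 81 / 400 / pi.
  rewrite ler_pdivrMr ?exprn_gt0//.
  have -> : 81 / 400 / pi * pi ^+ 2 = 81 / 400 * pi :> R by move: (pi) P0 => P P0'; field; rewrite gt_eqF.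
  lra.
have : 0 < pi^-1 :> R by rewrite invr_gt0.
move: h1 h3 h4; rewrite !invfM; move: (pi^-1) (X) (81 * e * _) => q Y w; lra.
Qed.
End NormGt1.

Theorem theorem5p4 (R : realType) :
  (forall (x1 : R * R) (r1 : R) (x2 : R * R) (r2 : R) (p : R * R)
      (theta sigma : R),
    two_disks x1 r1 x2 r2 p theta sigma ->
    (1 <= gamma2_norm x1 r1 x2 r2 ^+ 2)%E /\
    (gamma2_norm x1 r1 x2 r2 ^+ 2 <=
      (1 + Num.max 0 (if sigma + theta == pi / 2 then 0
                      else sin theta / tan (sigma + theta))
           * ((pi - sigma - theta) / pi))%:E)%E) /\
  (exists (x1 : R * R) (r1 : R) (x2 : R * R) (r2 : R) (p : R * R)
      (theta sigma : R),
    two_disks x1 r1 x2 r2 p theta sigma /\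
    (1 < gamma2_norm x1 r1 x2 r2)%E).
Proof.
split=> [x1 r1 x2 r2 p theta sigma TD|].
  split; last exact: gamma2_norm_upper TD.
  have [d [al [d0 x1E beR r1E _]]] := two_disks_angles TD.
  exact: (gamma2_norm_ge1 (radius1_gt0 TD) (radius2_gt0 TD) d0 beR x1E r1E).
have e0 : 0 < 200^-1 :> R by rewrite invr_gt0.
have e1 : 200 * 200^-1 <= 1 :> R by rewrite divff// pnatr_eq0.
by do 7![eexists]; split; [exact: (thin_two_disks e0 e1)|exact: (thin_norm_gt1 e0 e1)].
Qed.
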